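(* Every algebraic extension (with any extension of the valuation) of a deeply ramified field is again a deeply ramified field. The same holds for semitame fields and for gdr fields.
   Context: For a valued field $(F,u)$ with value group $uF$, residue field $Fu$, completion $\hat F$ with valuation ring $\mathcal{O}_{\hat F}$: (DRvg): whenever $\Gamma_1\subsetneq\Gamma_2$ are convex subgroups of $uF$, $\Gamma_2/\Gamma_1\not\cong\mathbb{Z}$. (DRvr): if $\operatorname{char}Fu=p>0$, then $x\mapsto x^p$ is surjective on $\mathcal{O}_{\hat F}/p\mathcal{O}_{\hat F}$. (DRvp): if $\operatorname{char}Fu=p>0$, then $up$ is not the smallest positive element of $uF$ ($up=\infty$ if $\operatorname{char}F=p$). (DRst): if $\operatorname{char}Fu=p>0$, then $uF$ is $p$-divisible. Deeply ramified: $\Omega_{\mathcal{O}_{F^{sep}}|\mathcal{O}_F}=0$ (module of relative differentials, for an extension of $u$ to $F^{sep}$); for nontrivially valued fields equivalently (DRvg) and (DRvr). Gdr field: (DRvr)+(DRvp). Semitame field: (DRvr)+(DRst). *)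

(* Defs.v *)
(* Valued fields are given by a Krull valuation
   v : F -> option G, where None plays the role of +infinity and G is an
   (additively written) totally ordered abelian group. *)
From HB Require Import structures.
From mathcomp Require Import all_boot all_order all_algebra all_field.
Set Implicit Arguments. Unset Strict Implicit. Unset Printing Implicit Defensive.
Import GRing.Theory.
Local Open Scope ring_scope.

Section ValuedFields.

Definition is_oag (G : zmodType) (le : G -> G -> Prop) : Prop :=
  [/\ (forall x, le x x),
      (forall x y z, le x y -> le y z -> le x z),
      (forall x y, le x y -> le y x -> x = y),
      (forall x y, le x y \/ le y x)
    & (forall x y z, le x y -> le (x + z) (y + z))].

Definition leO (G : zmodType) (le : G -> G -> Prop) (a b : option G) : Prop :=
  match a, b with
  | _, None => True
  | None, Some _ => False
  | Some x, Some y => le x y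
  end.
Definition ltO (G : zmodType) (le : G -> G -> Prop) (a b : option G) : Prop :=
  leO le a b /\ a <> b.

Definition addO (G : zmodType) (a b : option G) : option G :=
  match a, b with Some x, Some y => Some (x + y) | _, _ => None end.

Definition is_valuation (F : fieldType) (G : zmodType) (le : G -> G -> Prop)
  (v : F -> option G) : Prop :=
  [/\ (forall x, v x = None <-> x = 0),
      (forall x y, v (x * y) = addO (v x) (v y))
    & (forall x y, leO le (v x) (v (x + y)) \/ leO le (v y) (v (x + y)))].

Definition in_vgroup (F : fieldType) (G : zmodType) (v : F -> option G) (g : G) : Prop :=
  exists x, x <> 0 /\ v x = Some g.

Definition in_vring (F : fieldType) (G : zmodType) (le : G -> G -> Prop)
  (v : F -> option G) (x : F) : Prop := leO le (Some 0) (v x).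

Definition res_char (F : fieldType) (G : zmodType) (le : G -> G -> Prop)
  (v : F -> option G) (p : nat) : Prop :=
  prime p /\ ltO le (Some 0) (v p%:R).

Definition extends_val (F L : fieldType) (i : {rmorphism F -> L})
  (G : zmodType) (le : G -> G -> Prop) (v : F -> option G)
  (H : zmodType) (leH : H -> H -> Prop) (w : L -> option H) : Prop :=
  forall x, in_vring leH w (i x) <-> in_vring le v x.

Definition is_filter (K : Type) (Fl : (K -> Prop) -> Prop) : Prop :=
  [/\ Fl (fun _ => True),
      (forall A, Fl A -> exists x, A x),
      (forall A B, Fl A -> (forall x, A x -> B x) -> Fl B)
    & (forall A B, Fl A -> Fl B -> Fl (fun x => A x /\ B x))].

Definition is_complete (K : fieldType) (G : zmodType) (le : G -> G -> Prop)
  (w : K -> option G) : Prop :=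
  forall Fl : (K -> Prop) -> Prop, is_filter Fl ->
    (forall g, in_vgroup w g -> exists A, Fl A /\
        forall x y, A x -> A y -> ltO le (Some g) (w (x - y))) ->
    exists a, forall g, in_vgroup w g -> exists A, Fl A /\
        forall x, A x -> ltO le (Some g) (w (x - a)).

Definition is_completion (F : fieldType) (G : zmodType) (le : G -> G -> Prop)
  (v : F -> option G) (K : fieldType) (iota : {rmorphism F -> K})
  (w : K -> option G) : Prop :=
  [/\ is_valuation le w,
      (forall x, w (iota x) = v x),
      (forall a, exists x, w a = v x),
      (forall a g, in_vgroup v g -> exists x, ltO le (Some g) (w (a - iota x)))
    & is_complete le w].

(* (DRvr): Frobenius surjective on O_Fhat / p O_Fhat *)
Definition DRvr (F : fieldType) (G : zmodType) (le : G -> G -> Prop)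
  (v : F -> option G) : Prop :=
  forall p, res_char le v p ->
  forall (K : fieldType) (iota : {rmorphism F -> K}) (w : K -> option G),
    is_completion le v iota w ->
    forall x, in_vring le w x ->
      exists y, in_vring le w y /\ leO le (w p%:R) (w (y ^+ p - x)).

Definition DRvp (F : fieldType) (G : zmodType) (le : G -> G -> Prop)
  (v : F -> option G) : Prop :=
  forall p, res_char le v p ->
    ~ (exists g, v p%:R = Some g /\ ltO le (Some 0) (Some g) /\
         forall d, in_vgroup v d -> ltO le (Some 0) (Some d) -> le g d).

Definition DRst (F : fieldType) (G : zmodType) (le : G -> G -> Prop)
  (v : F -> option G) : Prop :=
  forall p, res_char le v p ->
    forall g, in_vgroup v g -> exists d, in_vgroup v d /\ g = d *+ p.

Definition is_sepclosure (F S : fieldType) (j : {rmorphism F -> S}) : Prop :=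
  (forall s : S, exists q : {poly F}, separable_poly q /\ root (map_poly j q) s) /\
  (forall q : {poly S}, separable_poly q -> (1 < size q)%N -> exists r, root q r).

(* ---------- Omega_{O_S | O_F} = 0 (via its universal property:
   every O_F-derivation of O_S into an O_S-module vanishes) ---------- *)
Definition is_Omodule (S : fieldType) (H : zmodType) (leH : H -> H -> Prop)
  (w : S -> option H) (M : zmodType) (act : S -> M -> M) : Prop :=
  forall a b, in_vring leH w a -> in_vring leH w b -> forall m n : M,
  [/\ act a (m + n) = act a m + act a n,
      act (a + b) m = act a m + act b m,
      act (a * b) m = act a (act b m)
    & act 1 m = m].

Definition is_derivation (F S : fieldType) (j : {rmorphism F -> S})
  (G : zmodType) (le : G -> G -> Prop) (v : F -> option G)
  (H : zmodType) (leH : H -> H -> Prop) (w : S -> option H)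
  (M : zmodType) (act : S -> M -> M) (D : S -> M) : Prop :=
  [/\ (forall a b, in_vring leH w a -> in_vring leH w b -> D (a + b) = D a + D b),
      (forall a b, in_vring leH w a -> in_vring leH w b ->
          D (a * b) = act a (D b) + act b (D a))
    & (forall c, in_vring le v c -> D (j c) = 0)].

Definition Omega_zero (F S : fieldType) (j : {rmorphism F -> S})
  (G : zmodType) (le : G -> G -> Prop) (v : F -> option G)
  (H : zmodType) (leH : H -> H -> Prop) (w : S -> option H) : Prop :=
  forall (M : zmodType) (act : S -> M -> M) (D : S -> M),
    is_Omodule leH w act -> is_derivation j le v leH w act D ->
    forall b, in_vring leH w b -> D b = 0.

Definition deeply_ramified (F : fieldType) (G : zmodType) (le : G -> G -> Prop)
  (v : F -> option G) : Prop :=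
  forall (S : fieldType) (j : {rmorphism F -> S}) (H : zmodType)
         (leH : H -> H -> Prop) (w : S -> option H),
    is_sepclosure j -> is_oag leH -> is_valuation leH w ->
    extends_val j le v leH w -> Omega_zero j le v leH w.

Definition gdr (F : fieldType) (G : zmodType) (le : G -> G -> Prop)
  (v : F -> option G) : Prop := DRvr le v /\ DRvp le v.

Definition semitame (F : fieldType) (G : zmodType) (le : G -> G -> Prop)
  (v : F -> option G) : Prop := DRvr le v /\ DRst le v.

Definition algebraic_ext (F L : fieldType) (i : {rmorphism F -> L}) : Prop :=
  forall y : L, exists q : {poly F}, q != 0 /\ root (map_poly i q) y.

End ValuedFields.

(* Main.v *)
(* Valuations enter only through their valuation rings [O].

   Mixed characteristic. (DRvr) says that [p]-th
   powers are dense modulo [p]; with (DRvp) there is [th] with [th^p] of the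
   same value as [p]. After coarsening [O], every nonunit has a power divisible
   by [p]. In a finite Galois extension, an approximation argument in the style
   of Ax and Tate shows that an element which is almost fixed by a group is close
   to a fixed one, with arbitrarily small loss. Between consecutive fixed fields
   this provides an element [z] moved by a large amount, and Lagrange
   interpolation at the conjugates of [z ^+ p] writes [p]-th power approximations
   of the larger field in terms of those of the smaller one.

   Equal characteristic [p]. (DRvr) says that the [p]-th powers are dense in [F].
   If [s = l ^+ (p ^ k)] satisfies [F[s] = F[s ^+ p]], then [l] is a limit of
   elements of [F[s]], and density passes to algebraic extensions.

   Deep ramification in characteristic [p]. If [Omega = 0], a root [b] of
   [X^p - t X - a] with [t] a [p]-th power gives [da = t * sum_i c_i dx_i] with
   integral [c_i] and [x_i]. If [a] were not in [F^p + t O], a derivation [D] with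
   [D y] divisible by [y] for all [y = x_i] but [D a] not divisible by [t] would
   contradict this; it is built along a purely inseparable tower over [F^p], the
   main step being [u d/du] for a generator [u] with respect to which values can
   be read off the Taylor coefficients. So [F^p] is dense in [F]. Finally,
   an integral [b] in the separable closure of [L] is a polynomial over [L] in
   some [b ^+ (p ^ n)] separable over [F], and by density each coefficient is
   separable over [F] up to an integral element of [L]; hence a derivation over
   the valuation ring of [L] kills [b].

   Deep ramification in characteristic 0: a separable closure of [L] is one of [F]. *)

From HB Require Import structures.
Require Import Defs.
From mathcomp Require Import all_boot all_order all_algebra all_fingroup all_field.
From mathcomp Require Import boolp functions ring zify.
From mathcomp Require classical_sets.
Set Implicit Arguments. Unset Strict Implicit. Unset Printing Implicit Defensive.
Import GRing.Theory.
Local Open Scope ring_scope.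

(** * Valuation rings *)

(** The base field is neither complete nor henselian, and its value group has arbitrary rank.
    Automorphisms permute the extensions of the valuation, so descent along a Galois group works
    directly only inside the decomposition group; the passage to it is made by quotients of weighted
    traces. Coarsening serves twice: a ring in which every nonunit has a power divisible by [p]
    extends to a splitting field with prescribed restriction to a subfield, and iterations gaining a
    fixed factor end after finitely many steps. Interpolation loses a discriminant, bounded by a
    power of a small element whose exponent depends only on [p] and the group order; since that
    element can be taken arbitrarily small, the square of the loss stays below [p], and one
    refinement of the approximation makes up for it. In characteristic [p], [u d/du] multiplies the
    Taylor term of degree [l < p] by [l], which is [0] or a unit; hence it respects divisibility
    once the Taylor terms do not cancel. As [L] may be inseparable over [F], a separable closure of
    [L] need not be one of [F], which is why density enters the transfer of deep ramification. *)

Section ValuationRings.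
Variable K : fieldType.
Implicit Types (O : K -> Prop) (x y z t : K).

Record vring O : Prop := Vring {
  vr1 : O 1;
  vrB : forall x y, O x -> O y -> O (x - y);
  vrM : forall x y, O x -> O y -> O (x * y);
  vrV : forall x, O x \/ O x^-1 }.

(* In terms of the valuation [v] of [O]: [dv O x y] is [v x <= v y], and
   [vunit O x] only says [v x <= 0], so that [~ vunit O x] means that [x] lies in
   the maximal ideal. *)
Definition dv O x y := exists2 r, O r & y = r * x.
Definition vunit O x := dv O x 1.

Variable O : K -> Prop.
Hypothesis vO : vring O.
Local Notation "x %|| y" := (dv O x y) (at level 70).

Lemma vr0 : O 0. Proof. by rewrite -(subrr 1); apply: (vrB vO); apply: (vr1 vO). Qed.
Lemma vrN x : O x -> O (- x).
Proof. by move=> Ox; rewrite -sub0r; apply: (vrB vO) => //; apply: vr0. Qed.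
Lemma vrD x y : O x -> O y -> O (x + y).
Proof. by move=> Ox Oy; rewrite -[y]opprK; apply: (vrB vO) => //; apply: vrN. Qed.
Lemma vrX x n : O x -> O (x ^+ n).
Proof.
by move=> Ox; elim: n => [|n IH]; rewrite ?expr0 ?exprS; [apply: vr1|apply: vrM].
Qed.
Lemma vr_nat n : O n%:R.
Proof. by elim: n => [|n IH]; [apply: vr0|rewrite -natr1; apply: vrD; last apply: vr1]. Qed.
Lemma vr_sum (I : Type) (r : seq I) (P : pred I) (f : I -> K) :
  (forall i, P i -> O (f i)) -> O (\sum_(i <- r | P i) f i).
Proof. by move=> H; apply: (big_ind O) => //; [apply: vr0|apply: vrD]. Qed.
Lemma vr_prod (I : Type) (r : seq I) (P : pred I) (f : I -> K) :
  (forall i, P i -> O (f i)) -> O (\prod_(i <- r | P i) f i).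
Proof. by move=> H; apply: (big_ind O) => //; [apply: (vr1 vO)|apply: (vrM vO)]. Qed.

Lemma dvxx x : x %|| x. Proof. by exists 1; [apply: (vr1 vO)|rewrite mul1r]. Qed.
Lemma dvx0 x : x %|| 0. Proof. by exists 0; [apply: vr0|rewrite mul0r]. Qed.
Lemma dv_trans y x z : x %|| y -> y %|| z -> x %|| z.
Proof.
by case=> r Or -> [s Os ->]; exists (s * r); [apply: (vrM vO)|rewrite mulrA].
Qed.
Lemma dvD x y z : x %|| y -> x %|| z -> x %|| y + z.
Proof.
by case=> r Or -> [s Os ->]; exists (r + s); [apply: vrD|rewrite mulrDl].
Qed.
Lemma dvN x y : x %|| y -> x %|| - y.
Proof. by case=> r Or ->; exists (- r); [apply: vrN|rewrite mulNr]. Qed.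
Lemma dvB x y z : x %|| y -> x %|| z -> x %|| y - z.
Proof. by move=> ? ?; apply: dvD => //; apply: dvN. Qed.
Lemma dvC x y z : x %|| y - z -> x %|| z - y.
Proof. by move/dvN; rewrite opprB. Qed.
Lemma dv_subr z x y : x %|| y - z -> x %|| z -> x %|| y.
Proof. by move=> h /(dvD h); rewrite subrK. Qed.
Lemma dvM x y z t : x %|| y -> z %|| t -> x * z %|| y * t.
Proof. by case=> r Or -> [s Os ->]; exists (r * s); [apply: (vrM vO)|ring]. Qed.
Lemma dv_mull z x y : x %|| y -> z * x %|| z * y.
Proof. by apply: dvM; apply: dvxx. Qed.
Lemma dv_mulr z x y : x %|| y -> x * z %|| y * z.
Proof. by move=> h; apply: dvM => //; apply: dvxx. Qed.
Lemma dv_mulO z x y : O z -> x %|| y -> x %|| z * y.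
Proof. by move=> Oz [r Or ->]; exists (z * r); [apply: (vrM vO)|rewrite mulrA]. Qed.
Lemma dv_Omul x z : O z -> x %|| z * x. Proof. by move=> Oz; exists z. Qed.
Lemma dvX x y n : x %|| y -> x ^+ n %|| y ^+ n.
Proof. by case=> r Or ->; exists (r ^+ n); [apply: vrX|rewrite exprMn]. Qed.
Lemma dv_sum (I : Type) (r : seq I) (P : pred I) (f : I -> K) x :
  (forall i, P i -> x %|| f i) -> x %|| \sum_(i <- r | P i) f i.
Proof. by move=> H; apply: (big_ind (dv O x)) => //; [apply: dvx0|move=> y z; apply: dvD]. Qed.
Lemma dv_prod (I : Type) (r : seq I) (P : pred I) (f g : I -> K) :
  (forall i, P i -> g i %|| f i) -> \prod_(i <- r | P i) g i %|| \prod_(i <- r | P i) f i.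
Proof.
move=> H; apply: (big_ind2 (dv O)) => //; first exact: dvxx.
by move=> *; apply: dvM.
Qed.
Lemma dv1 x : 1 %|| x <-> O x.
Proof. by split=> [[r Or ->]|Ox]; [rewrite mulr1|exists x; rewrite ?mulr1]. Qed.
Lemma dvE x y : x != 0 -> x %|| y <-> O (y / x).
Proof.
move=> x0; split=> [[r Or ->]|h]; first by rewrite mulfK.
by exists (y / x); rewrite ?divfK.
Qed.
Lemma dv0x x : 0 %|| x -> x = 0. Proof. by case=> r _ ->; rewrite mulr0. Qed.
Lemma dv_neq0 x y : x %|| y -> y != 0 -> x != 0.
Proof. by move=> h; apply: contraNneq => x0; apply/eqP/dv0x; rewrite -x0. Qed.
Lemma dv_total x y : x %|| y \/ y %|| x.
Proof.
have [->|y0] := eqVneq y 0; first by left; apply: dvx0.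
have [->|x0] := eqVneq x 0; first by right; apply: dvx0.
by case: (vrV vO (y / x)) => h; [left|right]; apply/dvE => //; rewrite -invf_div.
Qed.
Lemma ndv x y : ~ x %|| y -> y %|| x.
Proof. by case: (dv_total x y). Qed.
Lemma dv_mul2l z x y : z != 0 -> z * x %|| z * y -> x %|| y.
Proof.
move=> z0 [r Or e]; exists r => //; apply: (mulfI z0); rewrite e; ring.
Qed.
Lemma dv_mul2r z x y : z != 0 -> x * z %|| y * z -> x %|| y.
Proof. by rewrite ![_ * z]mulrC; apply: dv_mul2l. Qed.
Lemma dv_divr z x y : z != 0 -> x * z %|| y -> x %|| y / z.
Proof. by move=> z0 h; apply: (dv_mul2r z0); rewrite divfK. Qed.

(** Divisibility is total, so only the case that [y] divides [x] needs an argument; there a power of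
    the quotient is invertible. *)
Lemma dvX_inv n x y : (0 < n)%N -> x ^+ n %|| y ^+ n -> x %|| y.
Proof.
case: n => // n _ h; case: (dv_total x y) => // -[r Or e].
have [->|y0] := eqVneq y 0; first exact: dvx0.
case: h => s Os; rewrite e exprMn mulrA => e1.
have e2 : s * r ^+ n.+1 = 1.
  by apply: (mulIf (expf_neq0 n.+1 y0)); rewrite -e1 mul1r.
exists (s * r ^+ n); first by apply: (vrM vO) => //; apply: vrX.
by rewrite -[LHS]mul1r -e2 exprSr; ring.
Qed.
Lemma vr_root n x : (0 < n)%N -> O (x ^+ n) -> O x.
Proof. by move=> n0 /dv1 h; apply/dv1; apply: (dvX_inv n0); rewrite expr1n. Qed.

Lemma vunitE x : vunit O x <-> x != 0 /\ O x^-1.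
Proof.
split=> [h|[x0 Ox]]; last by apply/dvE; rewrite // mul1r.
have x0 := dv_neq0 h (oner_neq0 _).
by split => //; move/(dvE _ x0): h; rewrite mul1r.
Qed.
Lemma nunitO x : ~ vunit O x -> O x.
Proof. by move/ndv/dv1. Qed.
Lemma nunit_dv x y : x %|| y -> ~ vunit O x -> ~ vunit O y.
Proof. by move=> h nx uy; apply: nx; apply: dv_trans uy. Qed.
Lemma nunitD x y : ~ vunit O x -> ~ vunit O y -> ~ vunit O (x + y).
Proof.
by move=> nx ny; case: (dv_total x y) => h; [apply: (@nunit_dv x) => //|
  apply: (@nunit_dv y) => //]; apply: dvD => //; apply: dvxx.
Qed.
Lemma nunitN x : ~ vunit O x -> ~ vunit O (- x).
Proof. by apply: nunit_dv; apply: dvN; apply: dvxx. Qed.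
Lemma nunitB x y : ~ vunit O x -> ~ vunit O y -> ~ vunit O (x - y).
Proof. by move=> nx ny; apply: nunitD => //; apply: nunitN. Qed.
Lemma nunit0 : ~ vunit O 0.
Proof. by move/dv0x/eqP; rewrite oner_eq0. Qed.
Lemma nunitMl x y : O x -> ~ vunit O y -> ~ vunit O (x * y).
Proof. by move=> Ox; apply: nunit_dv; apply: dv_Omul. Qed.
Lemma nunit_sum (I : Type) (r : seq I) (P : pred I) (f : I -> K) :
  (forall i, P i -> ~ vunit O (f i)) -> ~ vunit O (\sum_(i <- r | P i) f i).
Proof.
by move=> H; apply: (big_ind (fun x => ~ vunit O x)) => //; [apply: nunit0|apply: nunitD].
Qed.
Lemma vunitM x y : vunit O x -> vunit O y -> vunit O (x * y).
Proof. by move=> ux uy; rewrite /vunit -[1]mulr1; apply: dvM. Qed.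
Lemma vunitX x n : vunit O x -> vunit O (x ^+ n).
Proof. by move=> ux; rewrite /vunit -(expr1n _ n); apply: dvX. Qed.
Lemma vunit1 : vunit O 1. Proof. exact: dvxx. Qed.
Lemma vunitD x y : vunit O x -> ~ vunit O y -> vunit O (x + y).
Proof.
by move=> ux ny; apply: contrapT => h; apply: (nunitB h ny); rewrite addrK.
Qed.
Lemma nunitX_inv n x : ~ vunit O (x ^+ n) -> ~ vunit O x.
Proof. by move=> h ux; apply: h; apply: vunitX. Qed.
Lemma nunitX n x : (0 < n)%N -> ~ vunit O x -> ~ vunit O (x ^+ n).
Proof.
by move=> n0 nx; rewrite /vunit -(expr1n _ n) => /(dvX_inv n0).
Qed.

Lemma vr_exprD p x y : prime p -> O x -> O y ->
  exists2 r, O r & (x + y) ^+ p = x ^+ p + y ^+ p + p%:R * y * r.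
Proof.
move=> pr Ox Oy; case: p pr => [//|[//|p]] pr.
rewrite exprDn big_ord_recl big_ord_recr /= bin0 binn subn0 subnn !expr0 mulr1 mul1r.
rewrite !mulr1n.
exists (\sum_(i < p.+1) (x ^+ (p.+2 - i.+1) * y ^+ i) * ('C(p.+2, i.+1) %/ p.+2)%:R).
  apply: vr_sum => i _; apply: (vrM vO); last exact: vr_nat.
  by apply: (vrM vO); apply: vrX.
rewrite -addrA; congr (_ + _).
rewrite addrC mulr_sumr; congr (_ + _); apply: eq_bigr => i _.
have dvd : (p.+2 %| 'C(p.+2, i.+1))%N by apply: prime_dvd_bin => //=; have := ltn_ord i; lia.
rewrite /= /bump /= add1n -{1}(divnK dvd) -mulr_natr natrM exprS; ring.
Qed.
Lemma vr_exprB p x y : prime p -> O x -> O y ->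
  p%:R %|| (x - y) ^+ p - (x ^+ p - y ^+ p).
Proof.
move=> pr Ox Oy; have [r Or e] := vr_exprD pr (vrB vO Ox Oy) Oy.
rewrite subrK in e; rewrite e; exists (- (y * r)); last ring.
by apply: vrN; apply: (vrM vO).
Qed.
Lemma vr_expr_sum p n (f : nat -> K) : prime p -> (forall i, O (f i)) ->
  p%:R %|| (\sum_(i < n) f i) ^+ p - \sum_(i < n) f i ^+ p.
Proof.
move=> pr Of; elim: n => [|n IH].
  by rewrite !big_ord0 expr0n gtn_eqF ?prime_gt0 // subr0; apply: dvx0.
rewrite !big_ord_recr /=; set A := \sum_(i < n) f i in IH *; set B := \sum_(i < n) f i ^+ p in IH *.
have [|r Or ->] := @vr_exprD p A (f n) pr _ (Of n); first by apply: vr_sum.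
rewrite (_ : _ - _ = (A ^+ p - B) + f n * r * p%:R); last by ring.
by apply: dvD => //; apply: dv_Omul; apply: (vrM vO).
Qed.

(** Were [l] the only index of least value, the sum would have the value of [f l]. *)
Lemma dv_sum_two n (f : nat -> K) e l : (l < n)%N ->
  (forall j, (j < n)%N -> e %|| f j) -> f l %|| e -> ~ \sum_(j < n) f j %|| e ->
  exists j, [/\ (j < n)%N, j != l & f j %|| e].
Proof.
move=> ln ef le ns; apply: contrapT => h; apply: ns.
have [e0|e0] := eqVneq e 0; first by rewrite e0; apply: dvx0.
have ne j : (j < n)%N -> j != l -> ~ vunit O (f j / e).
  move=> jn jl u; apply: h; exists j; split => //.
  by move/dv_mulr: u => /(_ e); rewrite divfK // mul1r.
have : vunit O ((\sum_(j < n) f j) / e).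
  rewrite (bigD1 (Ordinal ln)) //= mulrDl mulr_suml; apply: vunitD.
    by apply: (dv_mul2r e0); rewrite divfK // mul1r.
  by apply: nunit_sum => j jl; apply: ne => //; apply: contraNneq jl => jl; apply/eqP/val_inj.
by move=> u; rewrite -[e in _ %|| e]mul1r -[X in X %|| _](divfK e0); apply: dv_mulr.
Qed.

End ValuationRings.

Lemma dv_preim (F K : fieldType) (i : {rmorphism F -> K}) (O : K -> Prop) x y :
  vring O -> dv (fun x => O (i x)) x y <-> dv O (i x) (i y).
Proof.
move=> vO; split=> [[r Or ->]|h]; first by exists (i r); rewrite ?rmorphM.
have [x0|x0] := eqVneq x 0.
  move: h; rewrite x0 rmorph0 => /dv0x /eqP; rewrite fmorph_eq0 => /eqP ->.
  by exists 1; rewrite ?rmorph1 ?mul1r //; apply: vr1.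
apply/dvE => //.
by rewrite fmorph_div; apply/dvE; rewrite ?fmorph_eq0.
Qed.

(** * Subfields as predicates, and p-th roots modulo p *)

Record subfd (K : fieldType) (P : K -> Prop) : Prop := Subfd {
  sf1 : P 1;
  sfB : forall x y, P x -> P y -> P (x - y);
  sfdiv : forall x y, P x -> P y -> P (x / y) }.

Section Subfields.
Variables (K : fieldType) (P : K -> Prop).
Hypothesis sP : subfd P.
Lemma sf0 : P 0. Proof. by rewrite -(subrr 1); apply: (sfB sP); apply: (sf1 sP). Qed.
Lemma sfN x : P x -> P (- x).
Proof. by move=> Px; rewrite -sub0r; apply: (sfB sP) => //; apply: sf0. Qed.
Lemma sfD x y : P x -> P y -> P (x + y).
Proof. by move=> Px Py; rewrite -[y]opprK; apply: (sfB sP) => //; apply: sfN. Qed.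
Lemma sfV x : P x -> P x^-1.
Proof. by move=> Px; rewrite -div1r; apply: (sfdiv sP) => //; apply: (sf1 sP). Qed.
Lemma sfM x y : P x -> P y -> P (x * y).
Proof. by move=> Px Py; rewrite -[y]invrK; apply: (sfdiv sP) => //; apply: sfV. Qed.
Lemma sfX x n : P x -> P (x ^+ n).
Proof. by move=> Px; elim: n => [|n IH]; rewrite ?expr0 ?exprS; [apply: (sf1 sP)|apply: sfM]. Qed.
End Subfields.

Lemma subfd_image (F K : fieldType) (j : {rmorphism F -> K}) : subfd (fun x => exists c, x = j c).
Proof.
split; first by exists 1; rewrite rmorph1.
  by move=> _ _ [x ->] [y ->]; exists (x - y); rewrite rmorphB.
by move=> _ _ [x ->] [y ->]; exists (x / y); rewrite fmorph_div.
Qed.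

Section Semiperfect.
Variables (K : fieldType) (O : K -> Prop).
Hypothesis vO : vring O.
Variable p : nat.
Hypothesis pr : prime p.
Local Notation "x %|| y" := (dv O x y) (at level 70).

(** (DRvr) without a completion and relative to a subfield, which must also contain the root.
    Integrality of the root is automatic by [semiperf_int]. *)
Definition semiperf (P : K -> Prop) :=
  forall x, O x -> P x -> exists y, P y /\ p%:R %|| x - y ^+ p.

Lemma semiperf_int x y : O x -> p%:R %|| x - y ^+ p -> O y.
Proof.
move=> Ox [q Oq e]; apply: (vr_root vO (prime_gt0 pr)); rewrite -(subKr x (y ^+ p)) e.
by apply: (vrB vO) => //; apply: (vrM vO) => //; apply: vr_nat.
Qed.

Variable P : K -> Prop.
Hypothesis sP : subfd P.

(** Two passes: if [x = y^p + r t^p] and [r = z^p + q t^p], then [(y + t z)^p] differs from [x] by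
    [q t^(2p)] and a multiple of [p], and [p] divides [t^(2p)]. *)
Lemma semiperf_upgrade t : P t -> O t -> t != 0 -> p%:R %|| t ^+ p * t ^+ p ->
  (forall x, O x -> P x -> exists y, P y /\ t ^+ p %|| x - y ^+ p) ->
  semiperf P.
Proof.
move=> it Ot t0 pt h.
have h' x : O x -> P x -> exists y r, [/\ P y, P r, O y, O r &
    x = y ^+ p + r * t ^+ p].
  move=> Ox ix; have [y [iy ty]] := h x Ox ix.
  have tp0 : t ^+ p != 0 by rewrite expf_neq0.
  have Or : O ((x - y ^+ p) / t ^+ p) by apply/dvE.
  exists y, ((x - y ^+ p) / t ^+ p); split => //; last by rewrite divfK //; ring.
    by apply: (sfdiv sP); [apply: (sfB sP) => //|]; apply: sfX.
  apply: (vr_root vO (prime_gt0 pr)).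
  have -> : y ^+ p = x - (x - y ^+ p) / t ^+ p * t ^+ p by rewrite divfK //; ring.
  by apply: (vrB vO) => //; apply: (vrM vO) => //; apply: vrX.
move=> x Ox ix; have [y [r [iy ir Oy Or ex]]] := h' x Ox ix.
have [z [q [iz iq Oz Oq er]]] := h' r Or ir.
exists (y + t * z); split; first by apply: sfD => //; apply: sfM.
have Otz : O (t * z) by apply: (vrM vO).
have [s Os ->] := vr_exprD vO pr Oy Otz.
rewrite ex er exprMn.
rewrite (_ : _ - _ = q * (t ^+ p * t ^+ p) - t * z * s * p%:R); last by ring.
by apply: dvB => //; [apply: dv_mulO|apply: dv_Omul; apply: (vrM vO)].
Qed.

(** A root [y] of [r] modulo [p] satisfies [y^p = (1 - q u th) r], and the first factor is a unit
    because [th] is a nonunit. *)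
Lemma semiperf_proot th r : semiperf P -> p%:R != 0 :> K -> ~ vunit O th ->
  P r -> O r -> r * th %|| p%:R ->
  exists y, [/\ P y, O y, y ^+ p %|| r & r %|| y ^+ p].
Proof.
move=> SP p0 nth Pr Or rth.
have [y [iy [q Oq hy]]] := SP r Or Pr; case: rth => u Ou eu.
have ey : y ^+ p = (1 - q * u * th) * r by rewrite -[LHS](subKr r) hy eu; ring.
have n1 : ~ vunit O (q * u * th) by apply: nunitMl => //; apply: (vrM vO).
have ry : r %|| y ^+ p.
  rewrite ey; apply: dv_Omul; apply: (vrB vO); [exact: vr1|exact: nunitO].
exists y; split => //.
  by apply: (vr_root vO (prime_gt0 pr)); case: ry => z Oz ->; apply: (vrM vO).
rewrite ey -[X in _ %|| X]mul1r; apply: dv_mulr => //.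
by apply: vunitD => //; [apply: vunit1|apply: nunitN].
Qed.
End Semiperfect.

(** * Descent along a finite group of automorphisms *)

Section GaloisSemiperfect.
Variables (N : fieldType) (gT : finGroupType) (a : gT -> {rmorphism N -> N}).
Hypothesis aM : forall g h x, a (g * h)%g x = a h (a g x).
Variable O : N -> Prop.
Hypothesis vO : vring O.
Variable p : nat.
Hypothesis pr : prime p.
Hypothesis pN0 : p%:R != 0 :> N.
Hypothesis np : ~ vunit O p%:R.
Hypothesis arch : forall x, ~ vunit O x -> exists n, dv O p%:R (x ^+ n).
Local Notation "x %|| y" := (dv O x y) (at level 70).

Definition ginv (H : {set gT}) x := forall g, g \in H -> a g x = x.
(** The decomposition group: an inclusion suffices, as the group is finite. *)
Definition gstab (g : gT) := forall x, O x -> O (a g x).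

Lemma act1 x : a 1%g x = x.
Proof. by apply: (fmorph_inj (a 1%g)); rewrite -aM mulg1. Qed.
Lemma actK g x : a g^-1%g (a g x) = x.
Proof. by rewrite -aM mulgV act1. Qed.

Lemma ginvB H x y : ginv H x -> ginv H y -> ginv H (x - y).
Proof. by move=> ix iy g gH; rewrite rmorphB ix ?iy. Qed.
Lemma ginvD H x y : ginv H x -> ginv H y -> ginv H (x + y).
Proof. by move=> ix iy g gH; rewrite rmorphD ix ?iy. Qed.
Lemma ginvM H x y : ginv H x -> ginv H y -> ginv H (x * y).
Proof. by move=> ix iy g gH; rewrite rmorphM ix ?iy. Qed.
Lemma ginvV H x : ginv H x -> ginv H x^-1.
Proof. by move=> ix g gH; rewrite fmorphV ix. Qed.
Lemma ginvX H x n : ginv H x -> ginv H (x ^+ n).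
Proof. by move=> ix g gH; rewrite rmorphXn ix. Qed.
Lemma ginv_nat H n : ginv H n%:R.
Proof. by move=> g gH; rewrite rmorph_nat. Qed.
Lemma ginv_sum H (I : Type) (r : seq I) (P : pred I) (f : I -> N) :
  (forall i, P i -> ginv H (f i)) -> ginv H (\sum_(i <- r | P i) f i).
Proof.
move=> h; apply: (big_ind (ginv H)) => //; last by move=> x y; apply: ginvD.
by move=> g gH; rewrite rmorph0.
Qed.
Lemma ginv_trace (H : {group gT}) x : ginv H (\sum_(g in H) a g x).
Proof.
move=> h hH; rewrite rmorph_sum [RHS](reindex_inj (mulIg h)) /=.
apply: eq_big => [g|g gH]; first by rewrite groupMr.
by rewrite aM.
Qed.

(** The part of [n] prime to [p] is a unit, by a Bezout relation with the nonunit [p]. Division by a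
    group order thus costs at most a power of [p]. *)
Lemma nat_dv_pexp n : (0 < n)%N -> exists m, n%:R %|| p%:R ^+ m.
Proof.
move=> n0; have [q cop en] := pfactor_coprime pr n0; exists (logn p n).
rewrite {1}en natrM natrX -[X in _ %|| X]mul1r; apply: dv_mulr => //.
apply: contrapT => nuq; rewrite coprime_sym in cop.
case: (egcdnP p (_ : 0 < q)%N); first by case: (q) en n0 => // ->; rewrite mul0n.
move=> u v e _; have {}e : (u * q)%:R = 1 + (v * p)%:R :> N.
  by rewrite e (eqP cop) addnC natrD.
have : ~ vunit O (u%:R * q%:R - v%:R * p%:R).
  by apply: nunitB => //; apply: nunitMl => //; apply: vr_nat.
by apply; rewrite -!natrM e addrK; apply: vunit1.
Qed.

Lemma char0 n : (0 < n)%N -> n%:R != 0 :> N.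
Proof. by move=> /nat_dv_pexp [m hm]; apply: dv_neq0 hm _; rewrite expf_neq0. Qed.

Lemma arch_nat x n : ~ vunit O x -> (0 < n)%N -> exists k, n%:R %|| x ^+ k.
Proof.
move=> nx n0; have [m hm] := nat_dv_pexp n0; have [k hk] := arch nx.
by exists (k * m)%N; apply: (dv_trans vO hm); rewrite exprM; apply: dvX.
Qed.

Lemma dvXle x m n : O x -> (m <= n)%N -> x ^+ m %|| x ^+ n.
Proof. by move=> Ox mn; rewrite -(subnK mn) exprD; apply: dv_Omul; apply: vrX. Qed.

(** * Approximating elements fixed by the decomposition group *)

Section Density.
Variables H Z : {group gT}.
Hypothesis ZP : forall h, h \in Z <-> h \in H /\ gstab h.
(** The intersection of the conjugates of [O] under [H]. *)
Let ginR x := forall h, h \in H -> O (a h x).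

(* Every element of [O] is a fraction of elements that are integral at all the
   conjugates of [O], with denominator a unit of [O]. The denominator is a tail
   of the characteristic polynomial of [x], normalised by a coefficient of minimal value. *)
Lemma localize x : O x -> exists b, [/\ ginR b, ginR (b * x) & vunit O b].
Proof.
move=> Ox; pose P := \prod_(s in H) ('X - (a s x)%:P).
have Pinv i : ginv H P`_i.
  move=> h hH; rewrite -coef_map; congr (nth 0 (polyseq _) i).
  rewrite rmorph_prod [RHS](reindex_inj (mulIg h)) /=.
  by apply: eq_big => [g|g gH]; rewrite ?groupMr // map_polyXsubC aM.
have Px h : h \in H -> P.[a h x] = 0.
  by move=> hH; rewrite horner_prod (bigD1 h) //= hornerXsubC subrr mul0r.
have monP : P \is monic by apply: monic_prod_XsubC.
have P0 : P != 0 by apply: monic_neq0.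
have [j [jP minj]] : exists j, P`_j != 0 /\ forall i, P`_j %|| P`_i.
  have : forall n, (0 < n)%N -> exists j, forall i, (i < n)%N -> P`_j %|| P`_i.
    elim=> // -[_ _|n IH _]; first by exists 0%N; case=> // _; apply: dvxx.
    have [//|j hj] := IH; have [h|h] := dv_total vO P`_j P`_n.+1.
      exists j => i; rewrite ltnS leq_eqVlt => /predU1P [->|] //; exact: hj.
    exists n.+1 => i; rewrite ltnS leq_eqVlt => /predU1P [->|ii]; first exact: dvxx.
    by apply: (dv_trans vO h); apply: hj.
  move=> /(_ (size P)) [|j hj]; first by rewrite size_poly_gt0.
  have hj' i : P`_j %|| P`_i.
    by have [/hj //|ge] := ltnP i (size P); rewrite (nth_default _ ge); apply: dvx0.
  exists j; split => //; apply: dv_neq0 (hj' (size P).-1) _.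
  by rewrite -[_`_(_)]/(lead_coef P) lead_coef_eq0.
pose c i := P`_i / P`_j.
have Oc i : O (c i) by apply/dvE.
have cinv i h : h \in H -> a h (c i) = c i.
  by move=> hH; rewrite rmorphM fmorphV !Pinv.
have cj : c j = 1 by rewrite /c divff.
have cx h : h \in H -> \sum_(i < size P) c i * a h x ^+ i = 0.
  move=> hH; have := Px h hH; rewrite horner_coef => e.
  apply: (mulfI jP); rewrite mulr0 -{}[RHS]e mulr_sumr; apply: eq_bigr => i _.
  by rewrite mulrA [P`_j * _]mulrC divfK.
have jsz : (j < size P)%N by rewrite ltnNge; apply: contra_neqN jP => ge; rewrite nth_default.
have [k kn [uk kmax]] : exists2 k, (k < size P)%N &
    vunit O (c k) /\ forall i, (k < i < size P)%N -> ~ vunit O (c i).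
  pose Q i := (i < size P)%N && `[< vunit O (c i) >].
  have exQ : exists i, Q i.
    by exists j; rewrite /Q jsz; apply/asboolP; rewrite cj; apply: vunit1.
  have ubQ i : Q i -> (i <= size P)%N by case/andP => /ltnW.
  case: (ex_maxnP exQ ubQ) => k /andP [kn /asboolP uk] kmax; exists k => //.
  split=> // i /andP [ki ii] ui; have := kmax i; rewrite /Q ii leqNgt ki.
  by move/(_ (introT (asboolP _) ui)).
(* [b * x ^+ k] is minus the lower part of the relation [cx]. So where a conjugate of [x] is not
   integral, that of [b * x] is a polynomial in its integral inverse. The choice of [k] as last unit
   index makes [b] a unit plus a nonunit. *)
pose b := \sum_(k <= i < size P) c i * x ^+ (i - k).
have ab h : h \in H -> a h b = \sum_(k <= i < size P) c i * a h x ^+ (i - k).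
  by move=> hH; rewrite rmorph_sum; apply: eq_bigr => i _; rewrite rmorphM rmorphXn cinv.
have abk h : h \in H -> a h b * a h x ^+ k = - \sum_(i < k) c i * a h x ^+ i.
  move=> hH; rewrite ab // mulr_suml; apply/eqP; rewrite -addr_eq0 -[X in _ == X](cx h hH).
  rewrite -!(big_mkord xpredT (fun i => c i * a h x ^+ i)) [X in _ == X](big_cat_nat (n := k)) //=; last exact: ltnW.
  rewrite [X in X == _]addrC; apply/eqP; congr (_ + _); apply: eq_big_nat => i /andP [ki _].
  by rewrite -mulrA -exprD subnK.
have tail h : h \in H -> ~ O (a h x) -> O (a h b * a h x).
  move=> hH nx; have Ov : O (a h x)^-1 by case: (vrV vO (a h x)).
  have x0 : a h x != 0 by apply: contra_notN nx => /eqP ->; apply: vr0.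
  have -> : a h b * a h x = - \sum_(i < k) c i * (a h x)^-1 ^+ (k - i.+1).
    apply: (mulIf (expf_neq0 k x0)); rewrite mulrAC abk // !mulNr !mulr_suml; congr (- _).
    apply: eq_bigr => i _; rewrite -!mulrA; congr (_ * (_ * _)).
    have -> : a h x ^+ k = a h x ^+ (k - i.+1) * a h x ^+ i.+1.
      by rewrite -exprD subnK.
    by rewrite [RHS]mulrA -exprMn mulVf // expr1n mul1r exprSr.
  by apply: vrN => //; apply: vr_sum => // i _; apply: (vrM vO) => //; apply: vrX.
have Rx h : h \in H -> O (a h b) /\ O (a h b * a h x).
  move=> hH; have [hx|nx] := pselect (O (a h x)).
    have Ob : O (a h b).
      by rewrite ab //; apply: vr_sum => // i _; apply: (vrM vO) => //; apply: vrX.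
    by split => //; apply: (vrM vO).
  have Ov : O (a h x)^-1 by case: (vrV vO (a h x)).
  have x0 : a h x != 0 by apply: contra_notN nx => /eqP ->; apply: vr0.
  split; last exact: tail.
  by rewrite -[a h b](mulfK x0); apply: (vrM vO) => //; apply: tail.
exists b; split=> [h hH|h hH|]; [by have [] := Rx h hH|by rewrite rmorphM; have [] := Rx h hH|].
rewrite /b big_ltn // subnn expr0 mulr1; apply: vunitD => //.
rewrite big_nat; apply: nunit_sum => // i ki; rewrite mulrC; apply: nunitMl => //.
  exact: vrX.
exact: kmax.
Qed.

Lemma ginR_prod b : ginR b -> ginR (\prod_(z in Z) a z b).
Proof.
move=> Rb h hH; rewrite rmorph_prod; apply: vr_prod => // z /ZP [zH _].
by rewrite -aM; apply: Rb; rewrite groupM.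
Qed.
Lemma gstab_unit z x : z \in Z -> vunit O x -> vunit O (a z x).
Proof.
move=> /ZP [_ sz] /vunitE [x0 Ox]; apply/vunitE; rewrite fmorph_eq0 -fmorphV.
by split => //; apply: sz.
Qed.
Lemma vunit_prod b : vunit O b -> vunit O (\prod_(z in Z) a z b).
Proof.
move=> ub; apply: (big_ind (vunit O)); [exact: vunit1|exact: vunitM|].
by move=> z zZ; apply: gstab_unit.
Qed.
Lemma ginv_prod b : ginv Z (\prod_(z in Z) a z b).
Proof.
move=> h hZ; rewrite rmorph_prod [RHS](reindex_inj (mulIg h)) /=.
by apply: eq_big => [g|g gH]; rewrite ?groupMr ?aM.
Qed.

(** For one [h] outside [Z] take [x] in [O] with [a h x] not in [O]: the denominator given by
    [localize] must become a nonunit under [a h], or else [a h x] would be integral. A product over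
    [H] treats all [h] at once. *)
Lemma separator : exists e, [/\ ginR e, vunit O e &
  forall h, h \in H -> h \notin Z -> ~ vunit O (a h e)].
Proof.
have sep1 h : exists e, [/\ ginR e, vunit O e & h \in H -> h \notin Z -> ~ vunit O (a h e)].
  have [/andP [hH hZ]|no] := boolP ((h \in H) && (h \notin Z)); last first.
    exists 1; split; first by move=> g _; rewrite rmorph1; apply: vr1.
      exact: vunit1.
    by move=> hH hZ; move: no; rewrite hH hZ.
  have [x Ox nx] : exists2 x, O x & ~ O (a h x).
    apply: contrapT => no; move/negP: hZ; apply; apply/ZP; split => // x Ox.
    by apply: contrapT => nx; apply: no; exists x.
  have [b [Rb Rbx ub]] := localize Ox; exists b; split=> // _ _ /vunitE [b0 Ob].
  apply: nx; rewrite -[a h x](mulKf b0); apply: (vrM vO) => //.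
  by rewrite -rmorphM; apply: Rbx.
have /choice [e he] := sep1; exists (\prod_(h in H) e h); split.
- by move=> g gH; rewrite rmorph_prod; apply: vr_prod => // h hH; have [Re _ _] := he h; apply: Re.
- apply: (big_ind (vunit O)); [exact: vunit1|exact: vunitM|].
  by move=> h _; have [] := he h.
- move=> h hH hZ; rewrite rmorph_prod (bigD1 h) //= mulrC; apply: nunitMl => //.
    by apply: vr_prod => // g /andP [gH _]; have [Re _ _] := he g; apply: Re.
  by have [_ _] := he h; apply.
Qed.

(** The approximation is [Tr(f d) / Tr(f)], where the weight [f] is fixed by [Z], a unit of [O], and
    has highly divisible images under all [h] outside [Z]. *)
Lemma dens d : O d -> ginv Z d -> exists b, ginv H b /\ p%:R %|| d - b.
Proof.
move=> Od iZ; have [e0 [Re0 ue0 he0]] := separator; pose e := \prod_(z in Z) a z e0.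
have Re : ginR e := ginR_prod Re0.
have ue : vunit O e := vunit_prod ue0.
have ie : ginv Z e := @ginv_prod e0.
have he h : h \in H -> h \notin Z -> ~ vunit O (a h e).
  move=> hH hZ; rewrite rmorph_prod (bigD1 1%g) //= mulrC act1; apply: nunitMl => //.
    by apply: vr_prod => // z /andP [/ZP [zH _] _]; rewrite -aM; apply: Re0; rewrite groupM.
  exact: he0.
have [b0 [Rb0 Rb0d ub0]] := localize Od; pose b := \prod_(z in Z) a z b0.
have Rb : ginR b := ginR_prod Rb0.
have ub : vunit O b := vunit_prod ub0.
have ib : ginv Z b := @ginv_prod b0.
have Rbd : ginR (b * d).
  move=> h hH; rewrite /b (bigD1 1%g) //= act1 mulrAC rmorphM; apply: (vrM vO); first exact: Rb0d.
  by rewrite rmorph_prod; apply: vr_prod => // z /andP [/ZP [zH _] _]; rewrite -aM; apply: Rb0; rewrite groupM.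
pose z0 : N := #|Z|%:R; have z00 : z0 != 0 by apply: char0; apply: cardG_gt0.
have pz0 : (0 < p * #|Z|)%N by rewrite muln_gt0 prime_gt0 // cardG_gt0.
have [n hn] : exists n, forall h, h \in H -> h \notin Z -> p%:R * z0 %|| a h e ^+ n.
  have : forall h, exists n, h \in H -> h \notin Z -> p%:R * z0 %|| a h e ^+ n.
    move=> h; have [/andP [hH hZ]|no] := boolP ((h \in H) && (h \notin Z)); last first.
      by exists 0%N => hH hZ; move: no; rewrite hH hZ.
    by have [n hn] := arch_nat (he h hH hZ) pz0; exists n; rewrite -natrM.
  case/choice => n hn; exists (\max_h n h)%N => h hH hZ.
  apply: (dv_trans vO (hn h hH hZ)); apply: dvXle => //; first exact: Re.
  exact: leq_bigmax.
pose f := b * e ^+ n.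
have hf h : h \in H -> h \notin Z -> p%:R * z0 %|| a h (f * d) /\ p%:R * z0 %|| a h f.
  move=> hH hZ; have hh := hn h hH hZ; split.
    by rewrite /f mulrAC rmorphM rmorphXn; apply: dv_mulO => //; apply: Rbd.
  by rewrite rmorphM rmorphXn; apply: dv_mulO => //; apply: Rb.
have iff : ginv Z f by apply: ginvM => //; apply: ginvX.
pose S1 := \sum_(h in H) a h (f * d); pose S0 := \sum_(h in H) a h f.
have dS : p%:R * z0 %|| d * S0 - S1.
  rewrite mulr_sumr -sumrB; apply: dv_sum => // h hH.
  have [hZ|hZ] := boolP (h \in Z).
    by rewrite rmorphM [a h d]iZ // [_ * d]mulrC subrr; apply: dvx0.
  have [h1 h2] := hf h hH hZ; apply: dvB => //; exact: dv_mulO.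
have ZH : Z \subset H by apply/subsetP => z /ZP [].
have S0e : S0 %|| z0.
  have [r Or er] : p%:R * z0 %|| S0 - z0 * f.
    rewrite /S0 (bigID (mem Z)) /= (_ : \sum_(i in H | i \in Z) _ = z0 * f).
      rewrite addrAC subrr add0r; apply: dv_sum => // h /andP [hH hZ].
      by have [] := hf h hH hZ.
    rewrite (eq_bigl (mem Z)) => [|h /=]; last first.
      by rewrite andb_idl //; apply: (subsetP ZH).
    rewrite (eq_bigr (fun=> f)) => [|h hZ]; last exact: iff.
    by rewrite sumr_const mulr_natl.
  have {er} -> : S0 = z0 * (f + r * p%:R) by rewrite -[LHS](subrK (z0 * f)) er; ring.
  rewrite -[X in _ %|| X]mulr1; apply: dv_mull => //; apply: vunitD => //.
    by apply: vunitM => //; apply: vunitX.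
  exact: nunitMl.
have S00 : S0 != 0 by apply: dv_neq0 S0e z00.
exists (S1 / S0); split.
  by apply: ginvM; [|apply: ginvV]; apply: ginv_trace.
rewrite (_ : _ - _ = (d * S0 - S1) / S0); last by field.
apply: dv_divr => //; apply: dv_trans dS => //; exact: dv_mull.
Qed.
End Density.

Definition polyint (f : {poly N}) := forall i, O f`_i.
Lemma polyintM f g : polyint f -> polyint g -> polyint (f * g).
Proof. by move=> hf hg i; rewrite coefM; apply: vr_sum => // j _; apply: (vrM vO). Qed.
Lemma polyint_XsubC c : O c -> polyint ('X - c%:P).
Proof.
move=> Oc i; rewrite coefB coefX coefC; apply: (vrB vO); last first.
  by case: ifP => // _; apply: vr0.
by apply: vr_nat.
Qed.

Lemma subfd_ginv H : subfd (ginv H).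
Proof.
split; first by move=> g _; rewrite rmorph1.
  exact: ginvB.
by move=> x y ix iy; apply: ginvM => //; apply: ginvV.
Qed.

(** * Almost fixed elements and interpolation inside the decomposition group *)

Section Step.
Variable Gam : {group gT}.
Hypothesis stab : forall g, g \in Gam -> gstab g.
Variable th : N.
Hypothesis ith : ginv Gam th.
Hypothesis thp : th ^+ p %|| p%:R.
Hypothesis pth : p%:R %|| th ^+ p.
Hypothesis SPG : semiperf O p (ginv Gam).

Let p0 : p%:R != 0 :> N. Proof. exact: char0 (prime_gt0 pr). Qed.
Let th0 : th != 0.
Proof.
have h := dv_neq0 thp p0; apply: contraNneq h => ->.
by rewrite expr0n gtn_eqF ?prime_gt0.
Qed.
Let nuth : ~ vunit O th.
Proof. by apply: (@nunitX_inv _ _ vO p); apply: (nunit_dv vO pth np). Qed.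
Let Oth : O th. Proof. exact: nunitO. Qed.

Lemma gstab_dv g x y : g \in Gam -> x %|| y -> a g x %|| a g y.
Proof. by move=> gG [r Or ->]; exists (a g r); [apply: stab|rewrite rmorphM]. Qed.

(* Ax's approximation property, with loss [rho]. *)
Definition ax rho := forall x s, ginv Gam s -> s != 0 ->
  (forall g, g \in Gam -> s %|| a g x - x) ->
  exists c, ginv Gam c /\ s %|| rho * (x - c).

(** Average over the group; the loss is the denominator. *)
Lemma ax_card : ax #|Gam|%:R.
Proof.
move=> x s si s0 h; have G0 : #|Gam|%:R != 0 :> N by apply: char0; apply: cardG_gt0.
exists ((\sum_(g in Gam) a g x) / #|Gam|%:R); split.
  by apply: ginvM; [apply: ginv_trace|apply: ginvV; apply: ginv_nat].
rewrite mulrBr [_ * (_ / _)]mulrC divfK //.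
have -> : #|Gam|%:R * x = \sum_(g in Gam) x by rewrite sumr_const mulr_natl.
by rewrite -sumrB; apply: dv_sum => // g gG; apply: dvC => //; apply: h.
Qed.

Lemma ax_weaken r1 r2 : r1 %|| r2 -> ax r1 -> ax r2.
Proof.
move=> h hr x s si s0 hs; have [c [ic hc]] := hr x s si s0 hs.
by exists c; split => //; apply: (dv_trans vO hc); apply: dv_mulr.
Qed.

(* Apply [ax r] to the p-th power of the error term and extract a p-th root. *)
Lemma ax_step r s1 k : ginv Gam r -> ginv Gam s1 -> ginv Gam k ->
  r != 0 -> s1 != 0 -> k != 0 -> O r -> O k -> s1 %|| r ^+ p -> s1 %|| p%:R * r ->
  r * k ^+ p %|| s1 -> k ^+ p %|| p%:R -> ax r -> ax (r / k).
Proof.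
move=> ir is1 ik r0 s10 k0 Or Ok s1r s1p rk kp hr x s si s0 hs.
have [c [ic hc]] := hr x s si s0 hs.
pose x1 := r * (x - c) / s.
have Ox1 : O x1 by apply/dvE.
have hx1 g : g \in Gam -> r %|| a g x1 - x1.
  move=> gG; rewrite /x1 !rmorphM fmorphV rmorphB (ir g gG) (ic g gG) (si g gG).
  rewrite (_ : _ - _ = r * ((a g x - x) / s)); last by field.
  by rewrite -{1}[r]mulr1; apply: dv_mull => //; apply/dv1; apply/dvE => //; apply: hs.
have hx1p g : g \in Gam -> s1 %|| a g (x1 ^+ p) - x1 ^+ p.
  move=> gG; rewrite rmorphXn; have [e Oe ee] := hx1 g gG.
  have Oer : O (e * r) by apply: (vrM vO).
  have -> : a g x1 = x1 + e * r by rewrite -ee; ring.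
  have [q Oq ->] := vr_exprD vO pr Ox1 Oer.
  rewrite [(e * r) ^+ p]exprMn (_ : _ - _ = e ^+ p * r ^+ p + e * q * (p%:R * r)); last by ring.
  apply: dvD => //; apply: dv_mulO => //; first exact: vrX.
  exact: (vrM vO).
have [c1 [ic1 hc1]] := hr (x1 ^+ p) s1 is1 s10 hx1p.
have hk1 : k ^+ p %|| x1 ^+ p - c1.
  by apply: (dv_mul2l r0); apply: (dv_trans vO rk).
have Oc1 : O c1.
  have -> : c1 = x1 ^+ p - (x1 ^+ p - c1) by ring.
  apply: (vrB vO); first exact: vrX.
  by case: hk1 => q Oq ->; apply: (vrM vO) => //; apply: vrX.
have [d [id hd]] := SPG Oc1 ic1.
have Od : O d.
  apply: (vr_root vO (prime_gt0 pr)).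
  have -> : d ^+ p = c1 - (c1 - d ^+ p) by ring.
  apply: (vrB vO) => //; case: hd => q Oq ->; apply: (vrM vO) => //; exact: vr_nat.
have hk : k %|| x1 - d.
  apply: (dvX_inv vO (prime_gt0 pr)).
  apply: (dv_subr vO (z := x1 ^+ p - d ^+ p)).
    by apply: (dv_trans vO kp); apply: vr_exprB.
  have -> : x1 ^+ p - d ^+ p = (x1 ^+ p - c1) + (c1 - d ^+ p) by ring.
  by apply: dvD => //; apply: dv_trans hd.
exists (c + s * d / r); split.
  by apply: ginvD => //; apply: ginvM; [apply: ginvM|apply: ginvV].
have -> : r / k * (x - (c + s * d / r)) = s * ((x1 - d) / k).
  by rewrite /x1; field; rewrite r0 k0 s0.
by rewrite -{1}[s]mulr1; apply: dv_mull => //; apply/dv1; apply/dvE.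
Qed.

(** The loss [#|Gam|] divides a power of [th], and [ax_step] with [k = th] removes one factor [th]
    at a time. The condition [s1 %|| r ^+ p] needs an exponent of at least 2, so this descent ends
    at [th]. *)
Lemma ax_th : ax th.
Proof.
have p2 := prime_gt1 pr.
have [n hn] := arch_nat nuth (cardG_gt0 Gam).
have hax : ax (th ^+ n.+1).
  by apply: ax_weaken ax_card; apply: (dv_trans vO hn); apply: dvXle.
elim: n {hn} hax => [|n IH] hax; first by rewrite -[th]expr1.
apply: IH; apply: (@ax_weaken (th ^+ n.+2 / th)).
  by rewrite exprSr mulfK //; apply: dvxx.
apply: (@ax_step _ (th ^+ (n.+2 + p))) => //; try exact: ginvX; try by rewrite ?expf_neq0.
- exact: vrX.
- by rewrite -exprM; apply: dvXle => //; nia.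
- by rewrite addnC exprD; apply: dv_mulr.
- by rewrite -exprD; apply: dvxx.
Qed.

(** Below [th] the loss decreases by root extraction: if [y^p] has the value of [r], then
    [k = y^(p-1)] and [s1 = r^p] are admissible in [ax_step], and the new loss [r / k] has the value
    of [y]. *)
Lemma ax_small k : exists r, [/\ ginv Gam r, O r, r ^+ (p ^ k) %|| th, th %|| r ^+ (p ^ k) & ax r].
Proof.
have p2 := prime_gt1 pr; have p1 := prime_gt0 pr.
elim: k => [|k [r [ir Or rth thr axr]]].
  by exists th; rewrite expn0 expr1; split => //; try exact: dvxx; apply: ax_th.
have rt : r %|| th.
  by apply: (dv_trans vO _ rth); rewrite -{1}[r]expr1; apply: dvXle => //; rewrite expn_gt0 p1.
have r0 : r != 0 by apply: dv_neq0 rt th0.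
have rtp : r * th %|| p%:R.
  apply: (dv_trans vO _ thp); apply: (dv_trans vO (dv_mulr vO th rt)).
  by rewrite -expr2; apply: dvXle.
have rp : r ^+ p %|| p%:R by apply: dv_trans thp => //; apply: dvX.
have [y [iy Oy yr ry]] := semiperf_proot vO pr SPG p0 nuth ir Or rtp.
exists y; have y0 : y != 0.
  by have := dv_neq0 yr r0; apply: contraNneq => ->; rewrite expr0n gtn_eqF.
have kE : (y ^+ p.-1) ^+ p = (y ^+ p) ^+ p.-1 by rewrite -!exprM mulnC.
split => //.
- by rewrite expnS exprM; apply: (dv_trans vO _ rth); apply: dvX.
- by rewrite expnS exprM; apply: (dv_trans vO thr); apply: dvX.
apply: (@ax_weaken (r / y ^+ p.-1)).
  apply: (dv_mul2r (expf_neq0 p.-1 y0)); rewrite divfK ?expf_neq0 //.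
  by rewrite -exprS prednK.
apply: (@ax_step _ (r ^+ p)) => //; try exact: ginvX; try by rewrite ?expf_neq0.
- exact: vrX.
- exact: dvxx.
- by apply: (dv_trans vO rp); rewrite mulrC; apply: dv_Omul.
- rewrite kE -[X in _ %|| r ^+ X](prednK p1) exprS; apply: dv_mull => //; exact: dvX.
- rewrite kE; apply: (dv_trans vO (dvX vO p.-1 yr)); apply: dv_trans rp => //.
  by apply: dvXle => //; rewrite leq_pred.
Qed.

Variable H : {group gT}.
Hypothesis HG : H \subset Gam.
Hypothesis Hmax : forall M : {group gT}, H \subset M -> M \subset Gam -> M :=: H \/ M :=: Gam.

(* Otherwise every integral element of the fixed field of [H] is [c + r * y]
   with [c] fixed by [Gam]; iterate until [p] divides the error term. *)
Lemma ax_moved r : ginv Gam r -> r != 0 -> ~ vunit O r -> ax r ->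
  semiperf O p (ginv H) \/
  exists z, [/\ O z, ginv H z & exists2 g, g \in Gam & ~ r ^+ 2 %|| a g z - z].
Proof.
move=> ir r0 nr axr; apply: contrapT => /not_orP [nSP no]; apply: nSP.
have all2 x g : O x -> ginv H x -> g \in Gam -> r ^+ 2 %|| a g x - x.
  move=> Ox ix gG; apply: contrapT => h; apply: no; exists x; split => //.
  by exists g.
have GH x : ginv Gam x -> ginv H x by move=> ix h hH; apply: ix; apply: (subsetP HG).
have alln n : forall x, O x -> ginv H x -> exists c, ginv Gam c /\ r ^+ n %|| x - c.
  elim: n => [|n IH] x Ox ix.
    exists 0; rewrite subr0 expr0; split; last by apply/dv1.
    by move=> g _; rewrite rmorph0.
  have [c [ic hc]] := axr x (r ^+ 2) (ginvX 2 ir) (expf_neq0 2 r0) (fun g => all2 x g Ox ix).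
  have hc1 : r %|| x - c by apply: (dv_mul2l r0).
  have Oy : O ((x - c) / r) by apply/dvE.
  have [|c1 [ic1 hc2]] := IH _ Oy.
    by apply: ginvM; [apply: ginvB => //|apply: ginvV]; apply: GH.
  exists (c + r * c1); split; first by apply: ginvD => //; apply: ginvM.
  have -> : x - (c + r * c1) = r * ((x - c) / r - c1) by field.
  by rewrite exprS; apply: dv_mull.
move=> x Ox ix; have [n hn] := arch nr; have [c [ic hc]] := alln n x Ox ix.
have hpc := dv_trans vO hn hc.
have Oc : O c.
  rewrite -(subKr x c); apply: (vrB vO) => //.
  by case: hpc => q Oq ->; apply: (vrM vO) => //; apply: vr_nat.
have [y [iy hy]] := SPG Oc ic; exists y; split; first exact: GH.
by rewrite -(subrK c x) -addrA; apply: dvD.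
Qed.

Section Lagrange.
Variables (z r : N).
Hypothesis Oz : O z.
Hypothesis iz : ginv H z.
Hypothesis Or : O r.
Hypothesis rth : r ^+ (2 * p) * th %|| p%:R.
Hypothesis zH : forall g, g \in Gam -> r ^+ 2 %|| a g z - z -> g \in H.

Let C := undup [seq a g z | g <- enum Gam].
(** The conjugate of [x] belonging to the conjugate [w] of [z]. For [x] fixed by [H] the choice of
    [g] is immaterial, because the stabiliser of [z] lies in [H]; for [w] in [C] the default is
    never reached. *)
Let rep (x w : N) := a (odflt 1%g [pick g in Gam | a g z == w]) x.
Let CP w : reflect (exists2 g, g \in Gam & w = a g z) (w \in C).
Proof.
rewrite mem_undup; apply: (iffP mapP) => [[g]|[g gG ->]]; rewrite ?mem_enum.
  by exists g.
by exists g; rewrite ?mem_enum.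
Qed.
Let repE x g : ginv H x -> g \in Gam -> rep x (a g z) = a g x.
Proof.
move=> ix gG; rewrite /rep; case: pickP => [h /andP [hG /eqP e]|/(_ g)] /=; last first.
  by rewrite gG eqxx.
have hH : (h * g^-1)%g \in H.
  apply: zH; first by rewrite groupM ?groupV.
  by rewrite aM e actK subrr; apply: dvx0.
by rewrite -[h](mulgKV g) aM (ix _ hH).
Qed.
Let zC : z \in C. Proof. by apply/CP; exists 1%g => //; rewrite act1. Qed.
Let OC w : w \in C -> O w. Proof. by case/CP => g gG ->; apply: stab. Qed.

(** Lagrange interpolation at the points [w ^+ p] without the denominators. The coefficients stay
    integral and fixed by [Gam], at the price that the value at [z ^+ p] is [x * disc] instead of
    [x]. *)
Let lag x : {poly N} :=
  \sum_(w <- C) rep x w *: \prod_(w' <- C | w' != w) ('X - (w' ^+ p)%:P).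
Let disc := \prod_(w <- C | w != z) (z ^+ p - w ^+ p).

Let lag_int x : O x -> polyint (lag x).
Proof.
move=> Ox i; rewrite /lag !big_seq coef_sum; apply: vr_sum => // w /CP [g gG ew].
rewrite coefZ; apply: (vrM vO).
  rewrite /rep; case: pickP => [h /andP [hG _]|_] /=; apply: stab => //; exact: group1.
rewrite -big_filter big_seq; move: i.
apply: (big_ind polyint) => [i|f1 f2|w']; first by rewrite coef1; apply: vr_nat.
  exact: polyintM.
by rewrite mem_filter => /andP [_ /OC Ow]; apply: polyint_XsubC; apply: vrX.
Qed.

Let lag_inv x : ginv H x -> forall i, ginv Gam (lag x)`_i.
Proof.
move=> ix i g gG; rewrite -coef_map; congr (nth 0 (polyseq _) i).
have pC : perm_eq (map (a g) C) C.
  apply: uniq_perm; rewrite ?map_inj_uniq ?undup_uniq //; first exact: fmorph_inj.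
  move=> w; apply/mapP/CP => [[w' /CP [h hG ->] ->]|[h hG ->]].
    by exists (h * g)%g; rewrite ?groupM // aM.
  exists (a (h * g^-1)%g z); last by rewrite -aM mulgKV.
  by apply/CP; exists (h * g^-1)%g; rewrite ?groupM ?groupV.
rewrite /lag rmorph_sum /= -[RHS](perm_big _ pC) big_map /=.
rewrite !big_seq; apply: eq_bigr => w wC; rewrite map_polyZ; congr (_ *: _).
  by case/CP: wC => h hG ->; rewrite repE // -!aM repE // groupM.
rewrite rmorph_prod -[RHS](perm_big _ pC) big_map /=.
apply: eq_big => w'; first by rewrite (inj_eq (fmorph_inj (a g))).
by move=> _; rewrite map_polyXsubC rmorphXn.
Qed.

Let lag_eval x : ginv H x -> (lag x).[z ^+ p] = x * disc.
Proof.
move=> ix; rewrite /lag horner_sum (bigD1_seq z) ?undup_uniq //=.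
rewrite [X in _ + X]big1 ?addr0 => [|w wz]; last first.
  rewrite hornerZ horner_prod (big_rem z) //= eq_sym wz.
  by rewrite hornerXsubC subrr mul0r mulr0.
rewrite hornerZ horner_prod; congr (_ * _).
  by have := repE ix (group1 Gam); rewrite !act1.
by apply: eq_bigr => w _; rewrite hornerXsubC.
Qed.

(** Replacing each coefficient by [c i ^+ p], which is congruent to it modulo [p], turns the value
    at [z ^+ p] into a sum of [p]-th powers, hence into a [p]-th power modulo [p]. *)
Let lag_pow x : O x -> ginv H x ->
  exists y, [/\ ginv H y, O y & p%:R %|| x * disc - y ^+ p].
Proof.
move=> Ox ix.
have /choice [c hc] : forall i, exists c, ginv Gam c /\ p%:R %|| (lag x)`_i - c ^+ p.
  by move=> i; apply: SPG; [apply: lag_int|apply: lag_inv].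
have Oc i : O (c i).
  have [_ [q Oq e]] := hc i; apply: (vr_root vO (prime_gt0 pr)).
  rewrite -(subKr (lag x)`_i (c i ^+ p)) e; apply: (vrB vO); first exact: lag_int.
  by apply: (vrM vO) => //; apply: vr_nat.
have Of i : O (c i * z ^+ i) by apply: (vrM vO) => //; apply: vrX.
exists (\sum_(i < size (lag x)) c i * z ^+ i); split; last 1 first.
- rewrite -lag_eval // horner_coef.
  apply: (dv_subr vO (z := \sum_(i < size (lag x)) (c i * z ^+ i) ^+ p -
                            (\sum_(i < size (lag x)) c i * z ^+ i) ^+ p)); last first.
    by apply: dvC => //; apply: (vr_expr_sum vO _ pr Of).
  rewrite opprB addrA subrK -sumrB; apply: dv_sum => // i _.
  rewrite exprMn -exprM mulnC exprM -mulrBl mulrC; apply: dv_mulO => //.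
    by rewrite -exprM; apply: vrX.
  by have [] := hc i.
- apply: ginv_sum => i _; apply: ginvM; last exact: ginvX.
  by move=> h hH; have [ic _] := hc i; apply: ic; apply: (subsetP HG).
- exact: vr_sum.
Qed.

(** For [w != z] the difference [z - w] is not divisible by [r ^+ 2], hence divides it. So
    [(z - w)^p * th] divides [p], which gives [z^p - w^p] the value of [(z - w)^p]. There are at
    most [#|Gam|] factors. *)
Let disc_dv : disc %|| r ^+ (2 * p * #|Gam|).
Proof.
have h w' : w' \in C -> w' != z -> z ^+ p - w' ^+ p %|| r ^+ (2 * p).
  case/CP => g gG -> wz; set w := a g z in wz *.
  have Ow : O w by apply: stab.
  have zwr : z - w %|| r ^+ 2.
    apply: ndv => // hr; move/eqP: wz; apply; apply: iz; apply: zH => //.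
    exact: dvC.
  have zwp : (z - w) ^+ p %|| r ^+ (2 * p) by rewrite exprM; apply: dvX.
  apply: (dv_trans vO _ zwp).
  have [q Oq eq] := vr_exprB vO pr Oz Ow.
  have -> : z ^+ p - w ^+ p = (z - w) ^+ p - q * p%:R by rewrite -eq; ring.
  have [u Ou ->] : (z - w) ^+ p * th %|| p%:R by apply: dv_trans rth => //; apply: dv_mulr.
  rewrite (_ : _ - _ = (1 - q * u * th) * (z - w) ^+ p); last by ring.
  rewrite -{2}[(z - w) ^+ p]mul1r; apply: dv_mulr => //.
  apply: vunitD => //; first exact: vunit1.
  by apply: nunitN => //; apply: nunitMl => //; apply: (vrM vO).
rewrite /disc -big_filter big_seq.
apply: (dv_trans vO (y := \prod_(w <- [seq w <- C | w != z] | w \in [seq w <- C | w != z]) r ^+ (2 * p))).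
  by apply: dv_prod => // w; rewrite mem_filter => /andP [wz wC]; apply: h.
rewrite -big_seq big_const_seq count_predT iter_mulr_1 -exprM; apply: dvXle => //.
rewrite leq_mul2l; apply/orP; right; rewrite size_filter.
by rewrite (leq_trans (count_size _ _)) // (leq_trans (size_undup _)) // size_map cardE.
Qed.

(** Interpolating the constant 1 gives [y0] with [y0^p] of the value of [disc]; then [y / y0] is a
    root of [x] modulo [p / disc], that is modulo [(th / y0)^p]. For [semiperf_upgrade] the square
    of this modulus must be divisible by [p], whence the outer factor 2 in the exponent. *)
Lemma semiperf_of_moved : r ^+ (2 * (2 * p * #|Gam|)) * th %|| p%:R -> semiperf O p (ginv H).
Proof.
move=> rD; have p1 := prime_gt0 pr.
have D2 : disc ^+ 2 * th %|| p%:R.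
  by apply: (dv_trans vO _ rD); apply: dv_mulr => //; rewrite mulnC exprM; apply: dvX.
have D0 : disc != 0.
  by have := dv_neq0 D2 p0; rewrite mulf_eq0 expf_eq0 /= => /norP [].
have OD : O disc.
  rewrite /disc big_seq_cond; apply: vr_prod => // w /andP [/OC Ow _].
  by apply: (vrB vO); apply: vrX.
have [y0 [iy0 Oy0]] := lag_pow (vr1 vO) (fun g _ => rmorph1 _).
rewrite mul1r => hy0.
have Dy0 : disc %|| y0 ^+ p /\ y0 ^+ p %|| disc.
  case: D2 => u Ou eu; case: hy0 => q Oq eq.
  have ey : y0 ^+ p = (1 - q * u * disc * th) * disc.
    by rewrite -[LHS](subKr disc) eq eu; ring.
  have n1 : ~ vunit O (q * u * disc * th).
    by apply: nunitMl => //; do !apply: (vrM vO).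
  split; rewrite ey.
    by apply: dv_Omul; apply: (vrB vO); [exact: vr1|exact: nunitO].
  rewrite -[X in _ %|| X]mul1r; apply: dv_mulr => //.
  by apply: vunitD => //; [exact: vunit1|exact: nunitN].
have y00 : y0 != 0.
  by have := dv_neq0 (proj2 Dy0) D0; apply: contraNneq => ->; rewrite expr0n gtn_eqF.
have y0th : y0 ^+ 2 %|| th.
  apply: (dvX_inv vO p1); apply: dv_trans pth => //.
  apply: (dv_trans vO _ D2); rewrite -exprM mulnC exprM.
  apply: (dv_trans vO (dvX vO 2 (proj2 Dy0))).
  by rewrite mulrC; apply: dv_Omul.
have y0th1 : y0 %|| th.
  by apply: (dv_trans vO _ y0th); rewrite -{1}[y0]expr1; apply: dvXle.
have y0p0 : y0 ^+ p != 0 by rewrite expf_neq0.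
apply: (@semiperf_upgrade _ O vO p pr _ (subfd_ginv H) (th / y0)).
- apply: ginvM; last exact: ginvV.
  by move=> h hH; apply: ith; apply: (subsetP HG).
- by apply/dvE.
- by rewrite mulf_neq0 ?invr_eq0.
- apply: (dv_trans vO pth); rewrite -exprMn; apply: dvX => //.
  case: y0th => u Ou eu; exists u => //.
  by rewrite -[th / y0 * _]mulr1 {1}eu; field.
move=> x Ox ix; have [y [iy Oy hy]] := lag_pow Ox ix.
exists (y / y0); split; first by apply: ginvM => //; apply: ginvV.
have -> : x - (y / y0) ^+ p = (x * y0 ^+ p - y ^+ p) / y0 ^+ p.
  by rewrite expr_div_n; field.
apply: dv_divr => //; rewrite -exprMn divfK //; apply: (dv_trans vO thp).
have -> : x * y0 ^+ p - y ^+ p = (x * disc - y ^+ p) - x * (disc - y0 ^+ p) by ring.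
by apply: dvB => //; apply: dv_mulO.
Qed.
End Lagrange.

(** The elements of [Gam] moving [z] by a multiple of [r ^+ 2] form a group between [H] and [Gam].
    It is not [Gam] by the choice of [z], so it is [H], and interpolation applies. *)
Lemma semiperf_maximal : semiperf O p (ginv H).
Proof.
have p2 := prime_gt1 pr; have p1 := prime_gt0 pr; have G1 := cardG_gt0 Gam.
(* The exponent demanded by [semiperf_of_moved]. As [m <= p ^ m], already [r ^+ m] divides [th], and
   [th ^+ 2] divides [p]. *)
pose m := (2 * (2 * p * #|Gam|))%N.
have [r [ir Or rth thr axr]] := ax_small m.
have mk : (m <= p ^ m)%N by apply: ltnW; apply: ltn_expl.
have nr : ~ vunit O r.
  by move=> u; apply: nuth; apply: (dv_trans vO thr); apply: vunitX.
have r0 : r != 0.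
  have := dv_neq0 rth th0; apply: contraNneq => ->.
  by rewrite expr0n gtn_eqF ?expn_gt0 ?p1.
have small n : (n <= m)%N -> r ^+ n * th %|| p%:R.
  move=> nm; apply: (dv_trans vO _ thp); apply: (dv_trans vO (y := th ^+ 2)); last exact: dvXle.
  rewrite expr2; apply: dv_mulr => //; apply: (dv_trans vO _ rth); apply: dvXle => //.
  exact: leq_trans mk.
have [//|[z [Oz iz [g gG ng]]]] := ax_moved ir r0 nr axr.
pose M := [set h in Gam | `[< r ^+ 2 %|| a h z - z >]].
have gM : group_set M.
  apply/group_setP; split.
    by rewrite inE group1 /=; apply/asboolP; rewrite act1 subrr; apply: dvx0.
  move=> h k; rewrite !inE => /andP [hG /asboolP hh] /andP [kG /asboolP hk].
  rewrite groupM //=; apply/asboolP; rewrite aM.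
  have -> : a k (a h z) - z = a k (a h z - z) + (a k z - z) by rewrite rmorphB; ring.
  apply: dvD => //; have -> : r ^+ 2 = a k (r ^+ 2) by rewrite rmorphXn (ir k kG).
  exact: gstab_dv.
have [||MH|MG] := @Hmax (Group gM).
- apply/subsetP => h hH; rewrite inE (subsetP HG _ hH) /=; apply/asboolP.
  by rewrite iz // subrr; apply: dvx0.
- by apply/subsetP => h; rewrite inE => /andP [].
- apply: (@semiperf_of_moved z r) => //; try exact: small.
    by apply: small; rewrite /m; nia.
  by move=> h hG hh; rewrite -MH inE hG; apply/asboolP.
- by move: gG; rewrite -MG inE => /andP [_ /asboolP].
Qed.
End Step.

Variable th : N.
Hypothesis thp : th ^+ p %|| p%:R.
Hypothesis pth : p%:R %|| th ^+ p.

Lemma semiperf_stab (Gam H : {group gT}) : H \subset Gam ->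
  (forall g, g \in Gam -> gstab g) -> ginv Gam th ->
  semiperf O p (ginv Gam) -> semiperf O p (ginv H).
Proof.
have [n] := ubnP (#|Gam| - #|H|); elim: n Gam H => // n IH Gam H hn HG st ith SPG.
have [GH|GH] := boolP (Gam \subset H).
  by have /eqP <- : Gam :==: H by rewrite eqEsubset GH.
have [[M [HM MG]]|no] := pselect (exists M : {group gT}, H \proper M /\ M \proper Gam).
  have c1 := proper_card HM; have c2 := proper_card MG.
  have SPM : semiperf O p (ginv M).
    by apply: IH SPG => //; [lia|exact: proper_sub].
  apply: (IH M H) => //; [lia|exact: proper_sub| |].
    by move=> g gM; apply: st; apply: (subsetP (proper_sub MG)).
  by move=> g gM; apply: ith; apply: (subsetP (proper_sub MG)).
apply: (@semiperf_maximal Gam st th ith thp pth SPG H HG) => //.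
move=> M HM MG; apply: contrapT => /not_orP [h1 h2]; apply: no; exists M.
rewrite !properEneq HM MG !andbT; split; apply/eqP => e; [by apply: h1|exact: h2].
Qed.

(** Inside the decomposition groups this is [semiperf_stab]. The density lemma [dens] is used twice:
    for [G] to enter the fixed field of [Z G], and for [H] to move the root from the fixed field of
    [Z H] into that of [H]. *)
Theorem semiperf_galois (G H : {group gT}) : H \subset G -> ginv G th ->
  semiperf O p (ginv G) -> semiperf O p (ginv H).
Proof.
move=> HG ith SPG.
pose Z (K : {group gT}) := [set g in K | `[< gstab g >]].
have gZ (K : {group gT}) : group_set (Z K).
  apply/group_setP; split.
    by rewrite inE group1; apply/asboolP => x; rewrite act1.
  move=> h k; rewrite !inE => /andP [hK /asboolP sh] /andP [kK /asboolP sk].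
  by rewrite groupM //; apply/asboolP => x Ox; rewrite aM; apply: sk; apply: sh.
have ZP (K : {group gT}) h : h \in Group (gZ K) <-> h \in K /\ gstab h.
  by rewrite inE; split=> [/andP [hK /asboolP]|[-> ?]] //; apply/asboolP.
have SPZ : semiperf O p (ginv (Group (gZ G))).
  move=> x Ox ix; have [b [ib hb]] := dens (ZP G) Ox ix.
  have Ob : O b.
    rewrite -(subKr x b); apply: (vrB vO) => //.
    by case: hb => q Oq ->; apply: (vrM vO) => //; apply: vr_nat.
  have [y [iy hy]] := SPG b Ob ib; exists y; split; last first.
    by rewrite -(subrK b x) -addrA; apply: dvD.
  by move=> g /ZP [gG _]; apply: iy.
have SPZH : semiperf O p (ginv (Group (gZ H))).
  apply: semiperf_stab SPZ.
  - by apply/subsetP => g /ZP [gH sg]; apply/ZP; split => //; apply: (subsetP HG).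
  - by move=> g /ZP [].
  - by move=> g /ZP [gG _]; apply: ith.
move=> x Ox ix; have [|y [iy hy]] := SPZH x Ox; first by move=> g /ZP [gH _]; apply: ix.
have Oy : O y.
  apply: (vr_root vO (prime_gt0 pr)); rewrite -(subKr x (y ^+ p)); apply: (vrB vO) => //.
  by case: hy => q Oq ->; apply: (vrM vO) => //; apply: vr_nat.
have [b [ib hb]] := dens (ZP H) Oy iy; exists b; split => //.
rewrite -(subrK (y ^+ p) x) -addrA; apply: dvD => //.
have Ob : O b.
  rewrite -(subKr y b); apply: (vrB vO) => //.
  by case: hb => q Oq ->; apply: (vrM vO) => //; apply: vr_nat.
rewrite subrXX mulrC; apply: dv_mulO => //.
by apply: vr_sum => // i _; apply: (vrM vO); apply: vrX.
Qed.
End GaloisSemiperfect.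

(** * Extension of valuation rings *)

(** Zorn's lemma above a given [A0]. Adding [A0] to every set takes care of the empty chain, whose
    union becomes [A0]. *)
Lemma zorn_set (T : Type) (P : (T -> Prop) -> Prop) (A0 : T -> Prop) : P A0 ->
  (forall C : (T -> Prop) -> Prop, (exists A, C A) -> (forall A, C A -> P A) ->
     (forall A B, C A -> C B -> (forall x, A x -> B x) \/ (forall x, B x -> A x)) ->
     P (fun x => exists A, C A /\ A x)) ->
  exists A, [/\ P A, forall x, A0 x -> A x &
    forall B, P B -> (forall x, A x -> B x) -> forall x, B x -> A x].
Proof.
move=> P0 chain.
pose U (X : T -> Prop) := fun x => X x \/ A0 x.
have [F FP tot|A [PA maxA]] := @classical_sets.Zorn_bigcup T (fun X => P (U X)).
  pose C A := A = A0 \/ exists X, F X /\ A = U X.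
  rewrite (_ : U _ = (fun x => exists A, C A /\ A x)).
    apply: chain; first by exists A0; left.
      by move=> A [->|[X [FX ->]]] //; apply: FP.
    move=> A B [->|[X [FX ->]]] [->|[Y [FY ->]]]; try by [left|left; right|right; right].
    by have [h|h] := tot X Y FX FY; [left|right] => x [/h|]; [left|right|left|right].
  apply/funext => x; apply/propext; split=> [[[X FX Xx]|A0x]|[A [[->|[X [FX ->]]] Ax]]].
  - by exists (U X); split; [right; exists X|left].
  - by exists A0; split => //; left.
  - by right.
  - by case: Ax => [Xx|]; [left; exists X|right].
exists (U A); split => //; first by right.
move=> B PB AB x Bx; apply: contrapT => nx; apply: (maxA B).
  split=> [y Ay|BA]; first by apply: AB; left.
  by apply: nx; left; apply: BA.
by rewrite (_ : U B = B) //; apply/funext => y; apply/propext; split=> [[//|h]|]; [apply: AB; right|left].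
Qed.

Section RingExtension.
Variable N : fieldType.
Implicit Types (A R : N -> Prop) (x y u : N).

Record subrg A : Prop := Subrg {
  sr1 : A 1;
  srB : forall x y, A x -> A y -> A (x - y);
  srM : forall x y, A x -> A y -> A (x * y) }.

Definition adjoin A x y := exists2 q : {poly N}, (forall i, A q`_i) & y = q.[x].

Section Sub.
Variable A : N -> Prop.
Hypothesis sA : subrg A.
Lemma sr0 : A 0. Proof. by rewrite -(subrr 1); apply: (srB sA); apply: (sr1 sA). Qed.
Lemma srN x : A x -> A (- x).
Proof. by move=> Ax; rewrite -sub0r; apply: (srB sA) => //; apply: sr0. Qed.
Lemma srD x y : A x -> A y -> A (x + y).
Proof. by move=> Ax Ay; rewrite -[y]opprK; apply: (srB sA) => //; apply: srN. Qed.
Lemma srX x n : A x -> A (x ^+ n).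
Proof. by move=> Ax; elim: n => [|n IH]; rewrite ?expr0 ?exprS; [apply: (sr1 sA)|apply: (srM sA)]. Qed.
Lemma sr_sum (I : Type) (r : seq I) (P : pred I) (f : I -> N) :
  (forall i, P i -> A (f i)) -> A (\sum_(i <- r | P i) f i).
Proof. by move=> h; apply: (big_ind A) => //; [apply: sr0|apply: srD]. Qed.
Lemma sr_nat n : A n%:R.
Proof. by elim: n => [|n IH]; [apply: sr0|rewrite -natr1; apply: srD; last apply: (sr1 sA)]. Qed.

End Sub.

Section Adjoin.
Variable A : N -> Prop.
Hypothesis sA : subrg A.
Lemma subrg_adjoin x : subrg (adjoin A x).
Proof.
split.
- by exists 1; rewrite ?hornerE // => i; rewrite coef1; apply: (sr_nat sA).
- move=> _ _ [q Aq ->] [r Ar ->]; exists (q - r); last by rewrite hornerD hornerN.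
  by move=> i; rewrite coefB; apply: (srB sA).
- move=> _ _ [q Aq ->] [r Ar ->]; exists (q * r); last by rewrite hornerM.
  by move=> i; rewrite coefM; apply: (sr_sum sA) => j _; apply: (srM sA).
Qed.
Lemma adjoin_sub x y : A y -> adjoin A x y.
Proof.
move=> Ay; exists y%:P; last by rewrite hornerC.
by move=> i; rewrite coefC; case: ifP => // _; apply: (sr0 sA).
Qed.
Lemma adjoin_gen x : adjoin A x x.
Proof. by exists 'X; rewrite ?hornerX // => i; rewrite coefX; apply: (sr_nat sA). Qed.
Lemma adjoin_clear x y : x != 0 -> adjoin A x^-1 y -> exists n c, adjoin A x c /\ x ^+ n * y = c.
Proof.
move=> x0 [q Aq ->]; exists (size q), (\sum_(i < size q) q`_i * x ^+ (size q - i)).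
split.
  apply: (big_ind (adjoin A x)); [exact: sr0 (subrg_adjoin x)|exact: srD (subrg_adjoin x)|].
  move=> i _; apply: (srM (subrg_adjoin x)); first exact: adjoin_sub.
  by apply: (srX (subrg_adjoin x)); apply: adjoin_gen.
rewrite horner_coef mulr_sumr; apply: eq_bigr => i _.
have e : x ^+ size q = x ^+ (size q - i) * x ^+ i by rewrite -exprD subnK // ltnW.
rewrite mulrCA; congr (_ * _); rewrite {1}e -mulrA -exprMn mulfV //.
by rewrite expr1n mulr1.
Qed.
End Adjoin.

Section Maximal.
Variables (A : N -> Prop) (c : N).
Hypothesis sA : subrg A.
Hypothesis c0 : c != 0.
Hypothesis Ac : A c.
Hypothesis nA : ~ A c^-1.
Hypothesis maxA : forall B, subrg B -> ~ B c^-1 -> (forall x, A x -> B x) -> forall x, B x -> A x.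

Let max_adjoin x : A x \/ adjoin A x c^-1.
Proof.
have [h|h] := pselect (adjoin A x c^-1); [by right|left].
apply: (maxA (subrg_adjoin sA x) h); last exact: adjoin_gen.
by move=> y; apply: adjoin_sub.
Qed.

Let adj_id x y : A x -> adjoin A x y -> A y.
Proof.
move=> Ax [q Aq ->]; rewrite horner_coef; apply: sr_sum => // i _.
by apply: (srM sA) => //; apply: srX.
Qed.

(** So [c] lies in every maximal ideal. With [v = 1 - c * a], a relation for [c^-1] over [A[v^-1]]
    gives [v^n * c^-1] in [A]; as [v^n = 1 - c * b] with [b] in [A], also [c^-1] would be in [A]. *)
Let unit1 a : A a -> A (1 - c * a)^-1.
Proof.
move=> Aa; set v := 1 - c * a.
have Av : A v by apply: (srB sA); [apply: (sr1 sA)|apply: (srM sA)].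
have v0 : v != 0.
  apply: contra_notN nA; rewrite subr_eq0 => /eqP e.
  by rewrite -[c^-1]mulr1 e mulrA mulVf // mul1r.
have [//|h] := max_adjoin v^-1; exfalso; apply: nA.
have [n [d [hd e]]] := adjoin_clear sA v0 h; have Ad := adj_id Av hd.
have [b Ab eb] : exists2 b, A b & v ^+ n = 1 - c * b.
  elim: n {e} => [|n [b Ab eb]]; first by exists 0; [exact: sr0|rewrite mulr0 subr0].
  exists (a + b - c * a * b); last by rewrite exprS eb /v; ring.
  by apply: (srB sA); [apply: srD|do !apply: (srM sA)].
have -> : c^-1 = d + b by rewrite -e eb mulrBl mul1r mulrAC divff // mul1r subrK.
exact: srD.
Qed.

Let rep n x := exists q : {poly N}, [/\ forall i, A q`_i, (size q <= n.+1)%N & 1 = c * q.[x]].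

Let rep0 x : ~ rep 0 x.
Proof.
case=> q [Aq sq e]; apply: nA.
have -> : c^-1 = q`_0 by apply: (mulfI c0); rewrite mulfV // e [q]size1_polyC // hornerC coefC.
exact: Aq.
Qed.

(** As in Chevalley's extension theorem: in the relation for [x^-1] the constant term is absorbed
    into the unit [1 - c * r_0], so that [x ^+ m.+1] is a combination of lower powers of [x]; this
    eliminates the top term of the relation for [x]. *)
Let red n m x : x != 0 -> rep n.+1 x -> rep m.+1 x^-1 -> (m <= n)%N -> rep n x.
Proof.
move=> x0 [q [Aq sq eq1]] [r [Ar sr er]] mn.
pose v := (1 - c * r`_0)^-1; have Av : A v by apply: unit1.
pose h : {poly N} := \poly_(i < m.+1) (v * c * r`_(m.+1 - i)).
have v0 : 1 - c * r`_0 != 0.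
  apply: contra_notN nA; rewrite subr_eq0 => /eqP e.
  by rewrite -[c^-1]mulr1 e mulrA mulVf // mul1r.
have hx : h.[x] = x ^+ m.+1.
  rewrite horner_poly; apply: (mulfI v0).
  have -> : (1 - c * r`_0) * x ^+ m.+1 = c * (r.[x^-1] * x ^+ m.+1 - r`_0 * x ^+ m.+1).
    by rewrite mulrBr mulrA -er; ring.
  have -> : r.[x^-1] = r`_0 + \sum_(i < m.+1) r`_i.+1 * x^-1 ^+ i.+1.
    by rewrite (horner_coef_wide _ sr) big_ord_recl expr0 mulr1.
  rewrite [(r`_0 + _) * _]mulrDl addrAC subrr add0r.
  rewrite mulr_suml !mulr_sumr (reindex_inj rev_ord_inj) /=; apply: eq_bigr => i _.
  have im := ltn_ord i; have -> : (m.+1 - (m.+1 - i.+1))%N = i.+1 by lia.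
  have -> : x ^+ m.+1 = x ^+ (m.+1 - i.+1) * x ^+ i.+1 by rewrite -exprD; congr (_ ^+ _); lia.
  rewrite !mulrA divff // mul1r -!mulrA; congr (_ * (_ * _)).
  by rewrite mulrCA -exprMn mulVf // expr1n mulr1.
have Ah i : A h`_i.
  rewrite coef_poly; case: ifP => _; last exact: sr0.
  by do !apply: (srM sA).
exists (\poly_(i < n.+1) q`_i + q`_n.+1 *: ('X^(n - m) * h)); split.
- move=> i; rewrite coefD coefZ coefXnM coef_poly; apply: srD => //.
    by case: ifP => // _; apply: sr0.
  by apply: (srM sA) => //; case: ifP => // _; apply: sr0.
- rewrite (leq_trans (size_polyD _ _)) // geq_max size_poly /=.
  rewrite (leq_trans (size_scale_leq _ _)) // (leq_trans (size_polyMleq _ _)) //.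
  by rewrite size_polyXn; have : (size h <= m.+1)%N := size_poly _ _; lia.
- rewrite eq1 (horner_coef_wide _ sq) hornerD hornerZ hornerM hornerXn hx horner_poly.
  by rewrite big_ord_recr /= -exprD addnS subnK.
Qed.

Lemma maximal_vring : vring A.
Proof.
split; [exact: sr1|exact: srB|exact: srM|move=> x].
apply: contrapT => /not_orP [n1 n2].
have x0 : x != 0 by apply: contra_notN n1 => /eqP ->; apply: sr0.
have getrep y : ~ A y -> exists n, rep n y.
  move=> ny; have [//|[q Aq e]] := max_adjoin y; exists (size q), q; split => //.
  by rewrite -e mulfV.
have [n hn] := getrep _ n1; have [m hm] := getrep _ n2.
have [k] := ubnP (n + m); elim: k n m hn hm => // k IH [|n] [|m] hn hm lt; try by [apply: rep0 hn|apply: rep0 hm].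
have [mn|nm] := leqP m n; first by apply: (IH n m.+1 (red x0 hn hm mn) hm); lia.
apply: (IH n.+1 m hn) => //; last by lia.
apply: (@red m n) => //; [by rewrite invr_eq0|by rewrite invrK|exact: ltnW].
Qed.

(** If [x^-1] is not in [A], maximality puts [c^-1] into [A[x^-1]], and clearing denominators puts
    some [x^n * c^-1] into [A]. This is the benefit of maximality among the rings avoiding
    [c^-1]. *)
Lemma maximal_arch x : ~ vunit A x -> exists n, dv A c (x ^+ n).
Proof.
move=> nx; have vA := maximal_vring; have Ax := nunitO vA nx.
have [->|x0] := eqVneq x 0; first by exists 1%N; rewrite expr1; apply: dvx0.
have [h|h] := max_adjoin x^-1; first by case: nx; apply/vunitE.
have [n [d [hd e]]] := adjoin_clear sA x0 h; exists n, d; first exact: adj_id hd.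
by rewrite -e divfK.
Qed.
End Maximal.

Lemma vring_extension R c : subrg R -> c != 0 -> R c -> ~ R c^-1 ->
  exists A, [/\ vring A, forall x, R x -> A x, ~ A c^-1 &
    forall x, ~ vunit A x -> exists n, dv A c (x ^+ n)].
Proof.
move=> sR c0 Rc nR.
have [|C [A1 CA1] CP tot|A [[sA nA] RA maxA]] :=
    @zorn_set N (fun A => subrg A /\ ~ A c^-1) R; first by split.
  split; last by case=> A [/CP [_ nA]].
  have join x y : (exists A, C A /\ A x) -> (exists A, C A /\ A y) -> exists A, [/\ C A, A x & A y].
    move=> [A [CA Ax]] [B [CB By]]; have [h|h] := tot A B CA CB.
      by exists B; split => //; apply: h.
    by exists A; split => //; apply: h.
  split; first by exists A1; split => //; apply: sr1; have [] := CP _ CA1.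
    move=> x y hx hy; have [A [CA Ax Ay]] := join x y hx hy; exists A; split => //.
    by apply: srB => //; have [] := CP _ CA.
  move=> x y hx hy; have [A [CA Ax Ay]] := join x y hx hy; exists A; split => //.
  by apply: srM => //; have [] := CP _ CA.
have maxA' B : subrg B -> ~ B c^-1 -> (forall x, A x -> B x) -> forall x, B x -> A x.
  by move=> sB nB; apply: maxA.
exists A; split => //; first exact: (maximal_vring sA c0 (RA c Rc) nA maxA').
exact: (maximal_arch sA c0 (RA c Rc) nA maxA').
Qed.
End RingExtension.

(** * Minimal polynomials and splitting fields *)

Section MinimalPolynomials.
Variables (F K : fieldType) (f : {rmorphism F -> K}).

Lemma irreducible_divisor (q : {poly F}) : (1 < size q)%N ->
  exists2 r, r %| q & irreducible_poly r.
Proof.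
have [n] := ubnP (size q); elim: n q => // n IH q qn q1.
have [irr|red] := pselect (irreducible_poly q); first by exists q.
have [r r1 [rq nr]] : exists2 r : {poly F}, size r != 1%N & r %| q /\ ~~ (r %= q).
  apply: contrapT => no; apply: red; split => // r r1 rq.
  by apply: contrapT => /negP nr; apply: no; exists r.
have q0 : q != 0 by rewrite -size_poly_gt0 ltnW.
have r0 : r != 0 by apply: contraTneq rq => ->; rewrite dvd0p.
have lt : (size r < size q)%N by rewrite ltn_neqAle dvdp_size_eqp // nr dvdp_leq.
have [||s sr irs] := IH r; first exact: leq_trans lt _.
  by rewrite ltn_neqAle eq_sym r1 size_poly_gt0.
by exists s => //; apply: dvdp_trans sr rq.
Qed.

Lemma minimal_poly x (q : {poly F}) : q != 0 -> root (map_poly f q) x ->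
  exists m, [/\ irreducible_poly m, root (map_poly f m) x & m %| q].
Proof.
have [n] := ubnP (size q); elim: n q => // n IH q qn q0 qx.
have q1 : (1 < size q)%N.
  by rewrite -(size_map_poly f); apply: root_size_gt1 qx; rewrite map_poly_eq0.
have [r rq irr] := irreducible_divisor q1.
have [rx|nrx] := boolP (root (map_poly f r) x); first by exists r.
have e := divpK rq; have s0 : q %/ r != 0 by apply: contraNneq q0 => s0; rewrite -e s0 mul0r.
have r0 : r != 0 by rewrite -size_poly_gt0 ltnW //; case: irr.
have [||m [irm mx ms]] := IH (q %/ r) _ s0.
- by rewrite size_divp //; have := irr.1; move: qn q1 => /=; set s1 := size q; set s2 := size r; clearbody s1 s2; clear; lia.
- by have := qx; rewrite -[X in map_poly f X]e rmorphM rootM (negPf nrx) orbF.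
by exists m; split => //; rewrite -[X in _ %| X]e; apply: dvdp_mulr.
Qed.

Lemma irreducible_root x (m q : {poly F}) : irreducible_poly m -> root (map_poly f m) x ->
  root (map_poly f q) x = (m %| q).
Proof.
move=> irr mx; apply/idP/idP => [qx|mq]; last first.
  by rewrite -(divpK mq) rmorphM rootM mx orbT.
apply: contraLR qx => nd; have : coprimep m q by rewrite irreducible_poly_coprime.
by rewrite -(coprimep_map f) => /coprimep_root /(_ mx).
Qed.

Lemma irreducible_inv x (m q : {poly F}) : irreducible_poly m -> root (map_poly f m) x ->
  (map_poly f q).[x] != 0 -> exists g, (map_poly f g).[x] = (map_poly f q).[x]^-1.
Proof.
move=> irr mx qx; have : coprimep m q.
  by rewrite irreducible_poly_coprime // -(irreducible_root q irr mx).
case/Bezout_eq1_coprimepP => -[u v] /= e; exists v.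
apply: (mulIf qx); rewrite mulVf // -hornerM -rmorphM /=.
have -> : v * q = 1 - u * m by rewrite -e addrC addKr.
by rewrite rmorphB rmorph1 rmorphM !hornerE (eqP mx) mulr0 subr0.
Qed.

Lemma irreducible_separable (m : {poly F}) : (forall n, (0 < n)%N -> n%:R != 0 :> F) ->
  irreducible_poly m -> separable_poly m.
Proof.
move=> ch irr; rewrite unlock irreducible_poly_coprime //.
have m1 := irr.1; have m0 : m != 0 by rewrite -size_poly_gt0 ltnW.
apply/negP => /dvdp_leq; have lt := lt_size_deriv m0.
rewrite -size_poly_gt0 => h.
have d0 : (0 < size m^`())%N.
  rewrite size_poly_gt0; apply/eqP => /polyP /(_ (size m).-2).
  rewrite coef_deriv coef0 -mulr_natr => /eqP; rewrite mulf_eq0.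
  have -> : (size m).-2.+1 = (size m).-1 by case: (size m) m1 => [|[|k]].
  by rewrite -[m`_ _]/(lead_coef m) lead_coef_eq0 (negPf m0) /= (negPf (ch _ _)) //; case: (size m) m1 => [|[|k]].
by have := h d0; rewrite leqNgt lt.
Qed.
End MinimalPolynomials.

Lemma splitting_ext (F : fieldType) (q : {poly F}) : q != 0 ->
  exists (E : fieldExtType F) (rs : seq E),
    map_poly (in_alg E) q %= \prod_(z <- rs) ('X - z%:P).
Proof.
have [n] := ubnP (size q); elim: n F q => // n IH F q qn q0.
have [q1|q1] := leqP (size q) 1.
  exists F^o, [::]; rewrite big_nil -size_poly_eq1 size_map_poly eqn_leq q1.
  by rewrite size_poly_gt0.
have [r rq irr] := irreducible_divisor q1.
have [E1 _ [x rx _]] := irredp_FAdjoin irr.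
have /factor_theorem [s es] : root (map_poly (in_alg E1) q) x.
  by rewrite -(divpK rq) rmorphM rootM rx orbT.
have sz : size q = size (s * ('X - x%:P)) by rewrite -es size_map_poly.
have s0 : s != 0.
  by apply: contraNneq q0 => s0; rewrite -size_poly_eq0 sz s0 mul0r size_poly0.
have [|E [rs ers]] := IH E1 s _ s0.
  by move: qn; rewrite sz size_mul ?polyXsubC_eq0 // size_XsubC addn2.
(* [E] extends [E1], which extends [F]; [baseFieldType] regards it as an extension of [F]. *)
exists (baseFieldType E), (in_alg E x :: rs).
have -> : map_poly (in_alg (baseFieldType E)) q =
    map_poly (in_alg E) (map_poly (in_alg E1) q).
  rewrite -map_poly_comp; apply: eq_map_poly => y /=.
  exact: baseField_scaleE.
by rewrite es rmorphM /= map_polyXsubC mulrC big_cons; apply: eqp_mull.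
Qed.

Lemma splitting_field (F : fieldType) (q : {poly F}) : q != 0 ->
  exists N : splittingFieldType F, splittingFieldFor 1 (map_poly (in_alg N) q) {:N}.
Proof.
case/splitting_ext => E [rs ers].
pose M := subvs_of <<1 & rs>>%AS; pose toE := linfun (vsval : M -> E).
pose zs : seq M := [seq vsproj <<1 & rs>>%AS z | z <- rs].
have ezs : map toE zs = rs.
  by rewrite -map_comp map_id_in // => z zr; rewrite /= lfunE /= vsprojK ?seqv_sub_adjoin.
have ers' : map_poly (in_alg E) q %= \prod_(z <- map toE zs) ('X - z%:P) by rewrite ezs.
have sp : splittingFieldFor 1 (map_poly (in_alg M) q) {:M}.
  exists zs.
    rewrite -(eqp_map toE) -map_poly_comp.
    rewrite (_ : map_poly _ q = map_poly (in_alg E) q); last first.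
      by apply: eq_map_poly => y /=; apply: rmorph_alg.
    rewrite (eqp_trans ers') // big_map rmorph_prod.
    rewrite (eq_bigr (fun z => map_poly toE ('X - z%:P))) ?eqpxx // => z _.
    by rewrite rmorphB /= map_polyX map_polyC.
  apply/vspaceP => u; rewrite memvf.
  have : val u \in (toE @: <<1 & zs>>)%VS by rewrite aimg_adjoin_seq aimg1 ezs (valP u).
  by case/memv_imgP => t tz; rewrite lfunE => /val_inj ->.
have ax : splitting_field_axiom M.
  by exists (map_poly (in_alg M) q) => //; apply: alg_polyOver.
pose N : splittingFieldType F := HB.pack M (FieldExt_isSplittingField.Build F M ax).
by exists N.
Qed.

(** * Mixed characteristic *)

Section Coarsening.
Variables (L : fieldType) (O : L -> Prop).
Hypothesis vO : vring O.
Variable p : nat.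
Hypothesis pr : prime p.
Hypothesis p0 : p%:R != 0 :> L.
Hypothesis np : ~ vunit O p%:R.

(* The valuation ring whose maximal ideal is the radical of [p]. *)
Definition coarse x := forall n, O (p%:R * x ^+ n).

Lemma coarse_sub x : O x -> coarse x.
Proof. by move=> Ox n; apply: (vrM vO); [apply: vr_nat|apply: vrX]. Qed.

Lemma vring_coarse : vring coarse.
Proof.
split.
- by apply: coarse_sub; apply: vr1.
- have sc x y : dv O x y -> coarse x -> coarse (x - y).
    move=> [r Or ->] cx n; rewrite -[X in X - _]mul1r -mulrBl exprMn mulrCA.
    by apply: (vrM vO) => //; apply: vrX => //; apply: (vrB vO) => //; apply: vr1.
  move=> x y cx cy; have [xy|yx] := dv_total vO x y; first exact: sc.
  move=> n; rewrite -opprB exprNn mulrCA; apply: (vrM vO); last exact: sc.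
  by apply: vrX => //; apply: vrN => //; apply: vr1.
- move=> x y cx cy n; apply: (@vr_root _ _ vO 2) => //.
  have -> : (p%:R * (x * y) ^+ n) ^+ 2 = (p%:R * x ^+ (n * 2)) * (p%:R * y ^+ (n * 2)).
    by rewrite !exprMn !exprM; ring.
  by apply: (vrM vO).
- by move=> x; have [Ox|Ox] := vrV vO x; [left|right]; apply: coarse_sub.
Qed.
Let vC := vring_coarse.

Lemma coarse_arch_dv x : ~ vunit coarse x -> exists n, dv O p%:R (x ^+ n).
Proof.
move=> nx; have [->|x0] := eqVneq x 0; first by exists 1%N; rewrite expr1; apply: dvx0.
have /existsNP [n hn] : ~ coarse x^-1 by move=> h; apply: nx; apply/vunitE.
exists n; apply/dvE => //.
have [//|h] := vrV vO (x ^+ n / p%:R); case: hn.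
by rewrite invf_div -exprVn in h.
Qed.
Lemma coarse_nunitO x : ~ vunit coarse x -> O x.
Proof.
move=> /[dup] nx /coarse_arch_dv [[|n] [r Or e]].
  case: np; exists r => //; by rewrite -e expr0.
by apply: (@vr_root _ _ vO n.+1) => //; rewrite e; apply: (vrM vO) => //; apply: vr_nat.
Qed.
Lemma coarse_dv x y : dv O x y -> dv coarse x y.
Proof. by move=> [r Or ->]; exists r => //; apply: coarse_sub. Qed.
Lemma coarse_arch x : ~ vunit coarse x -> exists n, dv coarse p%:R (x ^+ n).
Proof. by move/coarse_arch_dv => [n hn]; exists n; apply: coarse_dv. Qed.
Lemma coarse_np : ~ vunit coarse p%:R.
Proof.
move/vunitE => [_] /(_ 2); rewrite exprVn expr2 invfM mulrA mulfV // mul1r => h.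
by apply: np; apply/vunitE.
Qed.

Variable th : L.
Hypothesis thp : dv O (th ^+ p) p%:R.
Hypothesis pth : dv O p%:R (th ^+ p).
Let p1 := prime_gt0 pr.
Let p2 := prime_gt1 pr.
Let th0 : th != 0.
Proof. by have := dv_neq0 thp p0; apply: contraNneq => ->; rewrite expr0n gtn_eqF. Qed.
Let nth : ~ vunit O th.
Proof. by apply: (@nunitX_inv _ _ vO p); apply: (nunit_dv vO pth np). Qed.
Let cnth : ~ vunit coarse th.
Proof.
by apply: (@nunitX_inv _ _ vC p); apply: (nunit_dv vC (coarse_dv pth) coarse_np).
Qed.
Let Oth : O th. Proof. exact: nunitO. Qed.

(** An [x] in the coarser ring need not be in [O], but [t^p * x] is, where [t^p] has the value of
    [th], since it is a nonunit of the coarser ring. Dividing by [t^p] leaves a root modulo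
    [p / t^p], which has the value of [(t^(p-1))^p]; this is enough for [semiperf_upgrade]. *)
Lemma semiperf_to_coarse (P : L -> Prop) : subfd P -> P th ->
  semiperf O p P -> semiperf coarse p P.
Proof.
move=> sP Pth SP.
have thth : dv O (th * th) p%:R.
  apply: (dv_trans vO _ thp); rewrite -expr2 -(subnK p2) exprD; apply: dv_Omul.
  exact: vrX.
have [t [Pt Ot tth tht]] := semiperf_proot vO pr SP p0 nth Pth Oth thth.
have t0 : t != 0.
  by have := dv_neq0 tth th0; apply: contraNneq => ->; rewrite expr0n gtn_eqF.
have cnt : ~ vunit coarse t.
  by apply: (@nunitX_inv _ _ vC p); apply: (nunit_dv vC (coarse_dv tht) cnth).
have tE n : t ^+ p ^+ n = t ^+ n ^+ p by rewrite -!exprM mulnC.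
have pE : th ^+ p = th * th ^+ p.-1 by rewrite -exprS prednK.
apply: (@semiperf_upgrade _ _ vC p pr _ sP (t ^+ p.-1)).
- exact: sfX.
- by apply: coarse_sub; apply: vrX.
- by rewrite expf_neq0.
- apply: coarse_dv; rewrite -tE; apply: (dv_trans vO pth).
  apply: (@dv_trans _ _ vO (th ^+ p.-1 * th ^+ p.-1)); last by apply: (dvM vO); apply: dvX.
  rewrite -exprD -(subnK (_ : p <= p.-1 + p.-1)%N); last by move: p2; clear; lia.
  by rewrite exprD; apply: dv_Omul; apply: vrX.
move=> x cx Px.
have Ox1 : O (t ^+ p * x).
  apply: coarse_nunitO; rewrite mulrC; apply: nunitMl => //.
  exact: nunitX.
have [y [Py hy]] := SP _ Ox1 (sfM sP (sfX sP p Pt) Px).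
exists (y / t); split; first exact: (sfdiv sP).
have -> : x - (y / t) ^+ p = (t ^+ p * x - y ^+ p) / t ^+ p.
  by rewrite expr_div_n; field; rewrite expf_neq0.
apply: dv_divr; first by rewrite expf_neq0.
apply: coarse_dv; apply: (dv_trans vO _ hy); apply: (dv_trans vO _ thp).
rewrite pE mulrC -tE; apply: dvM => //; exact: dvX.
Qed.

(** Two approximations in the coarser ring leave an error [p * th * c] with [c] in that ring. As
    [th] is a nonunit there, [th * c] lies in [O]. *)
Lemma semiperf_of_coarse : semiperf coarse p (fun=> True) -> semiperf O p (fun=> True).
Proof.
move=> SP x Ox _; have cx := coarse_sub Ox.
have [y [_ hy]] := SP x cx I; have cy := semiperf_int vC pr cx hy.
case: hy => r cr er; case: thp => u Ou eu.
have cur : coarse (r * u) by apply: (vrM vC) => //; apply: coarse_sub.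
have [z [_ hz]] := SP _ cur I; have cz := semiperf_int vC pr cur hz.
case: hz => s cs es; exists (y + th * z); split => //.
have ctz : coarse (th * z) by apply: (vrM vC) => //; apply: coarse_sub.
have [q cq ->] := vr_exprD vC pr cy ctz.
have -> : x - (y ^+ p + (th * z) ^+ p + p%:R * (th * z) * q) =
    ((th ^+ p.-1 * s - z * q) * th) * p%:R.
  have ex : x = y ^+ p + r * p%:R by rewrite -er; ring.
  have eru : r * u = z ^+ p + s * p%:R by rewrite -es; ring.
  have -> : x = y ^+ p + (r * u) * th ^+ p by rewrite ex eu; ring.
  by rewrite eru exprMn -[in LHS](prednK p1) !exprS !prednK //; ring.
apply: dv_Omul; apply: coarse_nunitO; apply: nunitMl => //.
apply: (vrB vC); apply: (vrM vC) => //.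
by apply: coarse_sub; apply: vrX.
Qed.
End Coarsening.

Section MixedCharacteristic.
Variables (F L : fieldType) (i : {rmorphism F -> L}) (O : L -> Prop).
Hypothesis vO : vring O.
Hypothesis algL : algebraic_ext i.
Variable p : nat.
Hypothesis pr : prime p.
Hypothesis p0 : p%:R != 0 :> L.
Hypothesis np : ~ vunit O p%:R.
Variable th : F.
Hypothesis thp : dv O (i th ^+ p) p%:R.
Hypothesis pth : dv O p%:R (i th ^+ p).
Hypothesis SPF : forall x : F, O (i x) -> exists y : F, dv O p%:R (i x - i y ^+ p).

Let O1 := coarse O p.
Let vO1 : vring O1 := vring_coarse vO p.
Let thp1 := coarse_dv vO p thp : dv O1 (i th ^+ p) p%:R.
Let pth1 := coarse_dv vO p pth : dv O1 p%:R (i th ^+ p).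
Let np1 : ~ vunit O1 p%:R := coarse_np p0 np.
Let p1 := prime_gt0 pr.

Let imF (y : L) := exists x, y = i x.
Let subfd_imF : subfd imF := subfd_image i.
Let SPF1 (x : F) : O1 (i x) -> exists y : F, dv O1 p%:R (i x - i y ^+ p).
Proof.
have SP1 : semiperf O1 p imF.
  apply: (semiperf_to_coarse vO pr p0 np thp pth subfd_imF); first by exists th.
  by move=> u Ou [z ez]; rewrite ez in Ou *; have [//|y hy] := @SPF z; exists (i y); split => //; exists y.
by move=> Ox; have [|_ [[y ->] hy]] := SP1 _ Ox; [exists x|exists y].
Qed.

Let charF n : (0 < n)%N -> n%:R != 0 :> F.
Proof.
move=> n0; rewrite -(fmorph_eq0 i) rmorph_nat.
exact: (char0 vO pr p0 np).
Qed.
Let pF0 : p%:R != 0 :> F. Proof. exact: charF. Qed.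

Section Splitting.
Variables (x : L) (m : {poly F}) (N : fieldType) (j : {rmorphism F -> N}) (z : N).
Hypothesis irr : irreducible_poly m.
Hypothesis mx : root (map_poly i m) x.
Hypothesis mz : root (map_poly j m) z.

(** The values of one polynomial at [x] and at [z] correspond under the isomorphism of [F(x)] in [L]
    with [F(z)] in [N]; no embedding of [L] is needed. *)
Let ev (q : {poly F}) : L := (map_poly i q).[x].
Let evN (q : {poly F}) : N := (map_poly j q).[z].
Let evE q : (ev q == 0) = (evN q == 0).
Proof. exact: etrans (irreducible_root q irr mx) (esym (irreducible_root q irr mz)). Qed.
Let evB q r : ev (q - r) = ev q - ev r. Proof. by rewrite /ev rmorphB hornerD hornerN. Qed.
Let evM q r : ev (q * r) = ev q * ev r. Proof. by rewrite /ev rmorphM hornerM. Qed.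
Let evX q n : ev (q ^+ n) = ev q ^+ n. Proof. by rewrite /ev rmorphXn horner_exp. Qed.
Let evC c : ev c%:P = i c. Proof. by rewrite /ev map_polyC hornerC. Qed.
Let evNB q r : evN (q - r) = evN q - evN r. Proof. by rewrite /evN rmorphB hornerD hornerN. Qed.
Let evNM q r : evN (q * r) = evN q * evN r. Proof. by rewrite /evN rmorphM hornerM. Qed.
Let evNX q n : evN (q ^+ n) = evN q ^+ n. Proof. by rewrite /evN rmorphXn horner_exp. Qed.
Let evNC c : evN c%:P = j c. Proof. by rewrite /evN map_polyC hornerC. Qed.
Let ev_eq q r : ev q = ev r <-> evN q = evN r.
Proof.
by split=> /eqP; rewrite -subr_eq0 -?evB -?evNB ?evE -?evE => /eqP e; apply/eqP;
  rewrite -subr_eq0 -?evB -?evNB ?evE -?evE e.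
Qed.

Let R y := exists2 q, y = evN q & O1 (ev q).
Let pP : {poly F} := p%:R%:P.
Let pN0 : p%:R != 0 :> N.
Proof. by rewrite -(rmorph_nat j) fmorph_eq0. Qed.
Let evp : ev pP = p%:R. Proof. by rewrite evC rmorph_nat. Qed.
Let evNp : evN pP = p%:R. Proof. by rewrite evNC rmorph_nat. Qed.

(** Extend the copy of [O1] in [F(z)] to a ring avoiding [p^-1]. No further element of [F(z)]
    becomes integral: if [ev q] is not in [O1], some power of its inverse is divisible by [p], so
    [evN q] in [A] would put [p^-1] into [A]. *)
Lemma mixed_splitting : exists2 A : N -> Prop, [/\ vring A, ~ vunit A p%:R &
    forall y, ~ vunit A y -> exists n, dv A p%:R (y ^+ n)] &
  forall q, A (evN q) <-> O1 (ev q).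
Proof.
have sR : subrg R.
  split.
  - by exists 1; rewrite ?/evN ?/ev rmorph1 hornerC //; apply: vr1.
  - by move=> _ _ [q -> Oq] [r -> Or]; exists (q - r); rewrite ?evNB // evB; apply: (vrB vO1).
  - by move=> _ _ [q -> Oq] [r -> Or]; exists (q * r); rewrite ?evNM // evM; apply: (vrM vO1).
have Rp : R p%:R by exists pP; rewrite ?evNp // evp; apply: (vr_nat vO1).
have nR : ~ R p%:R^-1.
  case=> q e Oq; apply: np1; apply/vunitE; split => //.
  have : evN (q * pP) = evN 1.
    by rewrite evNM -e evNp mulVf // /evN rmorph1 hornerC.
  move/ev_eq; rewrite evM evp {2}/ev rmorph1 hornerC => e1.
  by have -> : p%:R^-1 = ev q by apply: (mulIf p0); rewrite mulVf // e1.
have [A [vA RA nA arA]] := vring_extension sR pN0 Rp nR.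
exists A; first by split => // /vunitE [].
move=> q; split=> [Aq|Oq]; last by apply: RA; exists q.
apply: contrapT => nq; apply: nA.
have q0 : ev q != 0 by apply: contra_notN nq => /eqP ->; apply: vr0.
have [|n [r Or e]] := @coarse_arch _ O vO p p0 (ev q)^-1.
  by move/vunitE => [_]; rewrite invrK.
have pq0 : ev (pP * q ^+ n) != 0 by rewrite evM evp evX mulf_neq0 ?expf_neq0.
have [g eg] := irreducible_inv irr mx pq0.
have Ag : A (evN g).
  apply: RA; exists g => //; rewrite /ev eg -/(ev _) evM evp evX invfM -exprVn e.
  by rewrite mulrCA mulVf // mulr1.
have eN : evN (pP * q ^+ n * g) = evN 1.
  by apply/ev_eq; rewrite [in LHS]evM {2}/ev eg -/(ev _) mulfV // /ev rmorph1 hornerC.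
have -> : p%:R^-1 = evN q ^+ n * evN g.
  apply: (mulfI pN0); rewrite mulfV // mulrA -evNp -evNX -!evNM eN /evN rmorph1.
  by rewrite hornerC.
by apply: (vrM vA) => //; apply: vrX.
Qed.

Variables (gT : finGroupType) (a : gT -> {rmorphism N -> N}) (G H : {group gT}).
Hypothesis aM : forall g h y, a (g * h)%g y = a h (a g y).
Hypothesis HG : H \subset G.
Hypothesis invG : forall y, ginv a G y -> exists c, y = j c.
Hypothesis ainvG : forall c, ginv a G (j c).
Hypothesis invH : forall y, ginv a H y -> exists q, y = (map_poly j q).[z].
Hypothesis Hz : ginv a H z.

Lemma mixed_semiperf_gen : O1 x -> exists y, dv O1 p%:R (x - y ^+ p).
Proof.
move=> O1x; have [A [vA npA arA] AP] := mixed_splitting.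
have evx : evN 'X = z by rewrite /evN map_polyX hornerX.
have evLx : ev 'X = x by rewrite /ev map_polyX hornerX.
have dvP q r : ev q != 0 -> dv A (evN q) (evN r) <-> dv O1 (ev q) (ev r).
  move=> q0; have [g eg] := irreducible_inv irr mx q0.
  have eN : evN g = (evN q)^-1.
    have : evN (g * q) = evN 1.
      apply/ev_eq; rewrite evM; have -> : ev g = (ev q)^-1 by [].
      by rewrite mulVf // /ev rmorph1 hornerC.
    rewrite evNM {3}/evN rmorph1 hornerC => e1; have qN0 : evN q != 0 by rewrite -evE.
    by rewrite -[LHS](mulfK qN0) e1 mul1r.
  have e1 : evN r / evN q = evN (r * g) by rewrite evNM eN.
  have e2 : ev r / ev q = ev (r * g) by rewrite evM; congr (_ * _); rewrite /ev eg.
  have qN0 : evN q != 0 by rewrite -evE.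
  by split=> h; apply/dvE => //; rewrite ?e1 ?e2; [apply/AP; rewrite -e1|apply/AP; rewrite -e2]; apply/dvE.
have dvPp r : dv A p%:R (evN r) <-> dv O1 p%:R (ev r).
  by rewrite -evNp -evp; apply: dvP; rewrite evp.
have SPA : semiperf A p (ginv a H).
  apply: (@semiperf_galois _ _ a aM A vA p pr pN0 npA arA (evN th%:P) _ _ G H) => //.
  - rewrite -evNX -evNp; apply/dvP; last by rewrite evX evC evp.
    by rewrite evX evC; apply: (dv_neq0 thp).
  - by rewrite -evNX; apply/dvPp; rewrite evX evC.
  - by rewrite evNC.
  - move=> y Ay /invG [c ey]; move: Ay; rewrite ey -evNC => /AP.
    rewrite evC => /SPF1 [d hd]; exists (evN d%:P); split; first by rewrite evNC.
    by rewrite -evNX -evNB; apply/dvPp; rewrite evB evX !evC.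
have [|_ [/invH [q ->] hq]] := SPA z _ Hz; first by rewrite -evx; apply/AP; rewrite evLx.
exists (ev q); rewrite -evLx -evX -evB; apply/dvPp.
by rewrite evNB evNX evx.
Qed.
End Splitting.

Lemma mixed_semiperf_coarse x : O1 x -> exists y, dv O1 p%:R (x - y ^+ p).
Proof.
move=> Ox; have [q [q0 qx]] := algL x.
have [m [irr mx _]] := minimal_poly q0 qx.
have m0 : m != 0 by rewrite -size_poly_gt0 ltnW //; case: irr.
have [N spN] := splitting_field m0.
have [z mz] : exists z : N, root (map_poly (in_alg N) m) z.
  have [zs ez _] := spN; case: zs ez => [|z zs] ez.
    by move: ez; rewrite big_nil -size_poly_eq1 size_map_poly; have := irr.1; case: (size m) => [|[|k]].
  by exists z; rewrite (eqp_root ez) big_cons rootM root_XsubC eqxx.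
have galN : galois 1 {:N}.
  apply/splitting_galoisField; exists (map_poly (in_alg N) m); split => //.
    exact: alg_polyOver.
  by rewrite separable_map; apply: irreducible_separable.
pose a (g : gal_of {:N}) : {rmorphism N -> N} := g.
apply: (@mixed_semiperf_gen x m N (in_alg N) z irr mx mz _ a
  'Gal({:N} / 1)%G 'Gal({:N} / <<1; z>>)%G) => //.
- by move=> g h y; apply: galM; apply: memvf.
- by apply: galS; apply: sub1v.
- move=> y iy; have : y \in fixedField 'Gal({:N} / 1)%g by apply/fixedFieldP; rewrite ?memvf.
  by rewrite (galois_fixedField galN) => /vlineP [c ->]; exists c.
- by move=> c g _; apply: rmorph_alg.
- move=> y iy; have : y \in fixedField 'Gal({:N} / <<1; z>>)%g by apply/fixedFieldP; rewrite ?memvf.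
  rewrite (galois_fixedField (galoisS _ galN)) ?subv_adjoin ?subvf ?sub1v //.
  by case/Fadjoin_polyP => r /polyOver1P [r' ->] ->; exists r'.
- by move=> g gH; apply: (fixed_gal _ gH); rewrite ?subvf ?memv_adjoin.
Qed.

Theorem mixed_semiperf x : O x -> exists y, dv O p%:R (x - y ^+ p).
Proof.
move=> Ox; have [|y [_ hy]] := @semiperf_of_coarse _ _ vO _ pr p0 np _ thp pth _ x Ox I.
  by move=> t Ot _; have [y hy] := mixed_semiperf_coarse Ot; exists y.
by exists y.
Qed.
End MixedCharacteristic.

(** * Density of p-th powers in characteristic p *)

Section Frobenius.
Variables (K : fieldType) (p : nat).
Hypothesis chK : p \in [pchar K].

Lemma frobB (x y : K) : (x - y) ^+ p = x ^+ p - y ^+ p.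
Proof. by rewrite -!(pFrobenius_autE chK) rmorphB. Qed.
Lemma frob_sum (I : Type) (r : seq I) (P : pred I) (f : I -> K) :
  (\sum_(i <- r | P i) f i) ^+ p = \sum_(i <- r | P i) f i ^+ p.
Proof.
rewrite -(pFrobenius_autE chK) rmorph_sum; by apply: eq_bigr => i _; apply: pFrobenius_autE.
Qed.
Lemma frobnB k (x y : K) : (x - y) ^+ (p ^ k) = x ^+ (p ^ k) - y ^+ (p ^ k).
Proof. by elim: k => [|k IH]; rewrite ?expr1 // expnSr !exprM IH frobB. Qed.
End Frobenius.

(** * Degrees of iterated p-th powers *)

Section StableDegree.
Variables (F K : fieldType) (f : {rmorphism F -> K}) (p : nat).

(** The matrix [A] writes the powers of [s ^+ p] in terms of those of [s]. By [indep] it is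
    injective, hence invertible, so [s] is a combination of powers of [s ^+ p]. *)
Lemma stable_degree (s : K) (m : {poly F}) d : size m = d.+1 -> root (map_poly f m) s ->
  (forall g : {poly F}, g != 0 -> (size g <= d)%N -> ~~ root (map_poly f g) (s ^+ p)) ->
  exists q : {poly F}, s = (map_poly f q).[s ^+ p].
Proof.
move=> sm ms indep; have m0 : m != 0 by rewrite -size_poly_gt0 sm.
have szr (g : {poly F}) : (size (g %% m)%R <= d)%N by rewrite -ltnS -sm ltn_modp.
have evr (g : {poly F}) : (map_poly f (g %% m)).[s] = (map_poly f g).[s].
  by rewrite [in RHS](divp_eq g m) rmorphD rmorphM !hornerE (eqP ms) mulr0 add0r.
pose A : 'M[F]_d := \matrix_(j < d) poly_rV ('X^(p * j) %% m).
have evA (v : 'rV[F]_d) : (map_poly f (rVpoly (v *m A))).[s] = (map_poly f (rVpoly v)).[s ^+ p].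
  have -> : rVpoly v = \sum_(j < d) v 0 j *: 'X^j.
    by rewrite /rVpoly poly_def; apply: eq_bigr => j _; rewrite insubT //= => lt; congr (v 0 _ *: _); apply: val_inj.
  rewrite mulmx_sum_row !(linear_sum, rmorph_sum, horner_sum) /=; apply: eq_bigr => j _.
  rewrite linearZ /= !map_polyZ !hornerZ rowK poly_rV_K // evr.
  by rewrite !map_polyXn !hornerXn exprM.
have uA : A \in unitmx.
  rewrite -row_free_unit; apply/row_freeP; apply: contrapT => no.
  have : ~~ row_free A by apply/negP => /row_freeP.
  rewrite -kermx_eq0 => /rowV0Pn [v /sub_kermxP vA v0].
  have rv0 : rVpoly v != 0.
    by apply: contraNneq v0 => e; rewrite -[v]rVpolyK e linear0.
  have /negP := indep _ rv0 (size_poly _ _); apply; rewrite /root -evA vA.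
  by rewrite linear0 rmorph0 horner0.
exists (rVpoly (poly_rV ('X %% m) *m invmx A)).
by rewrite -evA mulmxKV // poly_rV_K // evr map_polyX hornerX.
Qed.

(** Choose [k] such that [l ^+ (p ^ k)] satisfies a relation of least size among all these powers;
    one more [p]-th power cannot lower it. *)
Lemma insep_stable (l : K) : algebraic_ext f ->
  exists k (q : {poly F}), l ^+ (p ^ k) = (map_poly f q).[(l ^+ (p ^ k)) ^+ p].
Proof.
move=> alg; pose Q n := `[< exists k (g : {poly F}),
  [/\ g != 0, (size g <= n)%N & root (map_poly f g) (l ^+ (p ^ k))] >].
have exQ : exists n, Q n.
  have [g [g0 gl]] := alg l; exists (size g); apply/asboolP; exists 0%N, g.
  by rewrite expn0 expr1.
case: (ex_minnP exQ) => n /asboolP [k [g [g0 gn gk]]] minn; exists k.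
have sg : size g = n.
  by apply/eqP; rewrite eqn_leq gn; apply: minn; apply/asboolP; exists k, g.
have n0 : (0 < n)%N by rewrite -sg size_poly_gt0.
apply: (@stable_degree _ g n.-1 _ gk); first by rewrite prednK.
move=> h h0 hs; apply/negP => hr.
suff: Q (size h) by move/minn; rewrite leqNgt -[X in (_ < X)%N](prednK n0) ltnS hs.
by apply/asboolP; exists k.+1, h; split => //; rewrite expnSr exprM.
Qed.
End StableDegree.

Section Cofinal.
Variables (F L : fieldType) (i : {rmorphism F -> L}) (O : L -> Prop).
Hypothesis vO : vring O.
Hypothesis algL : algebraic_ext i.

Lemma clear_denominators (g : nat -> F) n : exists2 c : F, c != 0 &
  forall j, (j < n)%N -> O (i (c * g j)).
Proof.
elim: n => [|n [c c0 hc]]; first by exists 1; rewrite ?oner_eq0.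
have [Oc|nO] := pselect (O (i (c * g n))).
  by exists c => // j; rewrite ltnS leq_eqVlt => /predU1P [->|/hc].
have g0 : c * g n != 0 by apply: contra_notN nO => /eqP ->; rewrite rmorph0; apply: vr0.
have OV : O (i (c * g n))^-1 by have [] := vrV vO (i (c * g n)).
exists (c / (c * g n)); first by rewrite mulf_neq0 ?invr_eq0.
move=> j; rewrite ltnS leq_eqVlt => /predU1P [->|/hc Oj].
  by rewrite mulrAC mulfV // rmorph1; apply: vr1.
by rewrite mulrAC fmorph_div; apply: (vrM vO).
Qed.

(** For integral [t], the constant term of its minimal polynomial is nonzero and, with denominators
    cleared, a multiple of [t]. *)
Lemma cofinal (t : L) : t != 0 -> exists2 f : F, f != 0 & dv O t (i f).
Proof.
move=> t0; have [Ot|nO] := pselect (O t); last first.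
  exists 1; rewrite ?oner_eq0 // rmorph1; apply/vunitE; split => //.
  by have [] := vrV vO t.
have [q [q0 qt]] := algL t; have [m [irr mt _]] := minimal_poly q0 qt.
have m00 : m`_0 != 0.
  apply/negP => m00; have := irr.2 'X; rewrite size_polyX => /(_ isT).
  have -> : 'X %| m by rewrite -['X]subr0 -polyC0 dvdp_XsubCl /root horner_coef0.
  move/(_ isT) => /eqpP [[a b] /= /andP [a0 b0] e].
  have : root (map_poly i (b *: m)) t by rewrite map_polyZ rootZ // fmorph_eq0.
  by rewrite -e map_polyZ rootZ ?fmorph_eq0 // map_polyX /root hornerX (negPf t0).
have [c c0 hc] := clear_denominators (fun j => m`_j) (size m).
exists (c * m`_0); first by rewrite mulf_neq0.
have : i c * (map_poly i m).[t] = 0 by rewrite (eqP mt) mulr0.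
rewrite horner_coef size_map_poly.
have m1 := irr.1; case: (size m) m1 hc => // n _ hc; rewrite big_ord_recl mulrDr => /eqP.
rewrite addr_eq0 coef_map expr0 mulr1 -rmorphM => /eqP ->; apply: dvN => //.
rewrite mulr_sumr; apply: dv_sum => // j _; rewrite /= /bump /= add1n coef_map exprS.
have -> : i c * (i m`_j.+1 * (t * t ^+ j)) = i (c * m`_j.+1) * t ^+ j * t.
  by rewrite rmorphM; ring.
by apply: dv_Omul; apply: (vrM vO); [apply: hc; rewrite ltnS|apply: vrX].
Qed.
End Cofinal.

Section Near.
Variables (K : fieldType) (O : K -> Prop).
Hypothesis vO : vring O.
(* [near true t x] means v x >= v t, and [near false t x] means v x > v t. *)
Definition near (b : bool) t x := if b then dv O t x else ~ dv O x t.
Implicit Types t x y c : K.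

Lemma near0 b t : t != 0 -> near b t 0.
Proof. by case: b => t0 /=; [apply: dvx0|move/dv0x/eqP; apply/negP]. Qed.
Lemma nearD b t x y : near b t x -> near b t y -> near b t (x + y).
Proof.
case: b => /=; first exact: dvD.
by move=> nx ny h; case: (dv_total vO x y) => xy; [apply: nx|apply: ny];
  apply: (dv_trans vO _ h); apply: dvD => //; apply: dvxx.
Qed.
Lemma nearN b t x : near b t x -> near b t (- x).
Proof.
case: b => /=; first exact: dvN.
by move=> nx [r Or e]; apply: nx; exists (- r); [apply: vrN|rewrite e mulrN mulNr].
Qed.
Lemma near_sum b t (I : Type) (r : seq I) (P : pred I) (f : I -> K) : t != 0 ->
  (forall i, P i -> near b t (f i)) -> near b t (\sum_(i <- r | P i) f i).
Proof. by move=> t0 h; apply: (big_ind (near b t)) => //; [apply: near0|move=> x y; apply: nearD]. Qed.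
Lemma near_mul b t x c : c != 0 -> near b t x -> near b (t * c) (x * c).
Proof.
by case: b => c0 /=; [apply: dv_mulr|move=> nx h; apply: nx; apply: dv_mul2r h].
Qed.
Lemma near_dv b s t x : dv O s t -> near b t x -> near b s x.
Proof.
case: b => /= st; first exact: dv_trans.
by move=> nx xs; apply: nx; apply: dv_trans st.
Qed.
Lemma near_root b n t x : (0 < n)%N -> near b (t ^+ n) (x ^+ n) -> near b t x.
Proof.
by case: b => n0 /=; [apply: dvX_inv|move=> nx h; apply: nx; apply: dvX].
Qed.
Lemma near_pow b n t x : (0 < n)%N -> near b t x -> near b (t ^+ n) (x ^+ n).
Proof.
by case: b => n0 /=; [apply: dvX|move=> nx h; apply: nx; apply: dvX_inv h].
Qed.
End Near.

Section PerfectDense.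
Variables (F L : fieldType) (i : {rmorphism F -> L}) (O : L -> Prop).
Hypothesis vO : vring O.
Hypothesis algL : algebraic_ext i.
Variables (p : nat) (b : bool).
Hypothesis chL : p \in [pchar L].
Local Notation near := (near O b).
Hypothesis denseF : forall a t : F, t != 0 -> exists e : F, near (i t) (i a - i e ^+ p).

Let p1 : (0 < p)%N. Proof. exact: prime_gt0 (pcharf_prime chL). Qed.
Let denseF' (a : F) (t : L) : t != 0 -> exists e : F, near t (i a - i e ^+ p).
Proof.
move=> t0; have [f f0 tf] := cofinal vO algL t0; have [e he] := denseF a f0.
by exists e; apply: near_dv he.
Qed.

Section Stable.
Variables (s : L) (q : {poly F}).
Hypothesis sq : s = (map_poly i q).[s ^+ p].
Let E y := exists g : {poly F}, y = (map_poly i g).[s].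

(** As [s] is a polynomial in [s ^+ p], so is [u]; it remains to approximate the coefficients by
    [p]-th powers. *)
Let approx1 u t : E u -> t != 0 -> exists2 y, E y & near t (u - y ^+ p).
Proof.
case=> g -> t0; pose h := g \Po q.
have -> : (map_poly i g).[s] = (map_poly i h).[s ^+ p].
  by rewrite map_comp_poly horner_comp -sq.
have /choice [e he] : forall j, exists e : F, near t ((i h`_j - i e ^+ p) * (s ^+ p) ^+ j).
  move=> j; have [->|s0] := eqVneq ((s ^+ p) ^+ j) 0.
    by exists 0; rewrite mulr0; apply: near0.
  have [|e he] := @denseF' h`_j (t / (s ^+ p) ^+ j); first by rewrite mulf_neq0 ?invr_eq0.
  by exists e; rewrite -[t](divfK s0); apply: near_mul.
exists (\sum_(j < size h) i (e j) * s ^+ j).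
  exists (\poly_(j < size h) e j); rewrite (@horner_coef_wide _ (size h)); last first.
    by rewrite size_map_poly size_poly.
  by apply: eq_bigr => j _; rewrite coef_map coef_poly ltn_ord.
rewrite (frob_sum chL) horner_coef size_map_poly -sumrB; apply: near_sum => // j _.
have -> : (i (e j) * s ^+ j) ^+ p = i (e j) ^+ p * (s ^+ p) ^+ j.
  by rewrite exprMn -!exprM mulnC.
by rewrite coef_map -mulrBl; apply: he.
Qed.

Let approxn k : forall u t, E u -> t != 0 -> exists2 y, E y & near t (u - y ^+ (p ^ k)).
Proof.
elim: k => [|k IH] u t Eu t0; first by exists u => //; rewrite expr1 subrr; apply: near0.
have [y Ey hy] := approx1 Eu t0.
have [t' t'0 tt'] : exists2 t', t' != 0 & dv O t (t' ^+ p).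
  have [Ot|nO] := pselect (O t).
    by exists t => //; rewrite -(prednK p1) exprSr; apply: dv_Omul; apply: vrX.
  by exists 1; rewrite ?oner_eq0 // expr1n; apply/vunitE; split => //; case: (vrV vO t).
have [z Ez hz] := IH y t' Ey t'0; exists z => //.
rewrite -(subrK (y ^+ p) u) -addrA; apply: nearD => //.
rewrite expnSr exprM -(frobB chL); apply: (near_dv vO tt'); exact: near_pow.
Qed.

(** Approximate [s] by [y ^+ (p ^ k)] with [y] in [F[s]]; the error is the [p ^ k]-th power of
    [l - y]. *)
Lemma stable_approx l k : s = l ^+ (p ^ k) -> forall t, t != 0 ->
  exists g : {poly F}, near t (l - (map_poly i g).[s]).
Proof.
move=> sl t t0.
have [||y [g ey] hy] := @approxn k s (t ^+ (p ^ k)); last first.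
- exists g; apply: (near_root vO (n := p ^ k)); first by rewrite expn_gt0 p1.
  by rewrite (frobnB chL) -sl -ey.
- by rewrite expf_neq0.
- by exists 'X; rewrite map_polyX hornerX.
Qed.

Lemma stable_approx_pow l k : s = l ^+ (p ^ k) -> forall t, t != 0 ->
  exists y, near t (l - y ^+ p).
Proof.
move=> sl t t0; have [g hg] := stable_approx sl t0.
have [|y _ hy] := @approx1 (map_poly i g).[s] t _ t0; first by exists g.
by exists y; rewrite -(subrK (map_poly i g).[s] l) -addrA; apply: nearD.
Qed.
End Stable.

Theorem perfect_dense (l t : L) : t != 0 -> exists y, near t (l - y ^+ p).
Proof.
by have [k [q sq]] := insep_stable p l algL; apply: (stable_approx_pow sq).
Qed.
End PerfectDense.

(** * Valuations, subfields and completions *)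

Section SubfieldType.
Variables (K : fieldType) (P : K -> Prop) (sP : subfd P).

Definition sfpred of subfd P : K -> bool := fun x => `[< P x >].
Fact sfpred_closed : divring_closed (sfpred sP).
Proof.
split; rewrite /sfpred; first by apply/asboolP; apply: sf1.
  by move=> x y /asboolP Px /asboolP Py; apply/asboolP; apply: sfB.
by move=> x y /asboolP Px /asboolP Py; apply/asboolP; apply: sfdiv.
Qed.
HB.instance Definition _ := GRing.isDivringClosed.Build K (sfpred sP) sfpred_closed.
(** (DRvr) and deep ramification quantify over field types. This type lets them be applied to a
    closure inside a completion and to the separable elements of a field. *)
Record sftype := SFType { sfval : K; sfvalP : sfval \in sfpred sP }.
HB.instance Definition _ := [isSub for sfval].
HB.instance Definition _ := [Choice of sftype by <:].
HB.instance Definition _ := [SubChoice_isSubUnitRing of sftype by <:].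
HB.instance Definition _ := [SubNzRing_isSubComNzRing of sftype by <:].
HB.instance Definition _ := [SubComUnitRing_isSubIntegralDomain of sftype by <:].
HB.instance Definition _ := [SubIntegralDomain_isSubField of sftype by <:].

Definition sfemb : {rmorphism sftype -> K} := val.
Lemma sfembP (x : sftype) : P (sfemb x). Proof. exact/asboolP/(valP x). Qed.
Lemma sfemb_ex x : P x -> exists y, sfemb y = x.
Proof. by move/asboolP => Px; exists (SFType Px). Qed.

Variables (F : fieldType) (f : {rmorphism F -> K}).
Hypothesis fP : forall x, P (f x).
Definition sflift_fun x := SFType (introT (asboolP _) (fP x) : f x \in sfpred sP).
Fact sflift_additive : zmod_morphism sflift_fun.
Proof. by move=> x y; apply: val_inj; rewrite /= rmorphB. Qed.
Fact sflift_multiplicative : monoid_morphism sflift_fun.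
Proof. by split=> [|x y]; apply: val_inj; rewrite /= ?rmorph1 ?rmorphM. Qed.
HB.instance Definition _ := GRing.isZmodMorphism.Build F sftype sflift_fun sflift_additive.
HB.instance Definition _ := GRing.isMonoidMorphism.Build F sftype sflift_fun sflift_multiplicative.
Definition sflift : {rmorphism F -> sftype} := sflift_fun.
Lemma sfliftE x : sfemb (sflift x) = f x. Proof. by []. Qed.
End SubfieldType.

Lemma dv_min (K : fieldType) (O : K -> Prop) (f : nat -> K) n : vring O -> (0 < n)%N ->
  exists2 l, (l < n)%N & forall j, (j < n)%N -> dv O (f l) (f j).
Proof.
move=> vO; elim: n => // -[_ _|n IH _]; first by exists 0%N => // -[|//] _; apply: dvxx.
have [//|l ln hl] := IH; have [h|h] := dv_total vO (f l) (f n.+1).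
  exists l; first exact: leq_trans ln _.
  by move=> j; rewrite ltnS leq_eqVlt => /predU1P [->|/hl].
exists n.+1 => // j; rewrite ltnS leq_eqVlt => /predU1P [->|/hl hj]; first exact: dvxx.
exact: dv_trans hj.
Qed.

Section Bridge.
Variables (F : fieldType) (G : zmodType) (le : G -> G -> Prop) (v : F -> option G).
Hypothesis oag : is_oag le.
Hypothesis val : is_valuation le v.
Local Notation O := (in_vring le v).

Let lexx x : le x x. Proof. by case: oag. Qed.
Let le_trans y x z : le x y -> le y z -> le x z. Proof. by case: oag => _ h _ _ _; apply: h. Qed.
Let le_anti x y : le x y -> le y x -> x = y. Proof. by case: oag => _ _ h _ _; apply: h. Qed.
Let le_tot x y : le x y \/ le y x. Proof. by case: oag. Qed.
Let leD z x y : le x y -> le (x + z) (y + z). Proof. by case: oag => _ _ _ _ h; apply: h. Qed.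
Let vN x : v x = None <-> x = 0. Proof. by case: val. Qed.
Let vM x y : v (x * y) = addO (v x) (v y). Proof. by case: val. Qed.

Lemma val_Some x : x != 0 -> exists g, v x = Some g.
Proof. by case e : (v x) => [g|]; [exists g|move/vN: e => ->; rewrite eqxx]. Qed.
Lemma val1 : v 1 = Some 0.
Proof.
have [g eg] := val_Some (oner_neq0 F); have := vM 1 1.
rewrite mulr1 eg /= => -[e]; congr Some.
by apply: (addrI g); rewrite addr0.
Qed.
Let v_opp x : v (- x) = v x.
Proof.
have : addO (v (-1)) (v (-1)) = Some 0 by rewrite -vM mulrNN mulr1 val1.
have -> : v (- x) = addO (v (-1)) (v x) by rewrite -vM mulN1r.
case: (v (-1)) => [g|] //= -[eg].
have -> : g = 0.
  have [h|h] := le_tot 0 g; have := leD g h; rewrite add0r eg => h'; exact: le_anti.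
by case: (v x) => //= h; rewrite add0r.
Qed.
Lemma leO_total a b : leO le a b \/ leO le b a.
Proof. by case: a b => [a|] [b|] //=; auto. Qed.
Lemma leO_trans a b c : leO le a b -> leO le b c -> leO le a c.
Proof. by case: a b c => [a|] [b|] [c|] //=; apply: le_trans. Qed.
Lemma leO_anti a b : leO le a b -> leO le b a -> a = b.
Proof. by case: a b => [a|] [b|] //= h1 h2; congr Some; apply: le_anti. Qed.
Lemma leOxx a : leO le a a. Proof. by case: a => //=. Qed.
Lemma ltO_nle a b : ltO le a b <-> ~ leO le b a.
Proof.
split=> [[ab ne] ba|nba]; first by apply: ne; apply: leO_anti.
have [ab|//] := leO_total a b; split => // e; apply: nba; rewrite e; exact: leOxx.
Qed.

Lemma vring_val : vring O.
Proof.
split; rewrite /in_vring.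
- by rewrite val1; apply: leOxx.
- move=> x y Ox Oy; have [_ _ um] := val.
  have [h|h] := um x (- y); apply: leO_trans h => //; by rewrite v_opp.
- move=> x y; rewrite vM; case: (v x) (v y) => [g|] [h|] //= h1 h2.
  by apply: (le_trans h2); rewrite -{1}[h]add0r; apply: leD.
- move=> x; have [->|x0] := eqVneq x 0; first by left; rewrite (proj2 (vN 0)).
  have [g eg] := val_Some x0; have := vM x x^-1; rewrite mulfV // val1 eg.
  case: (v x^-1) => //= h [e]; have [h0|h0] := le_tot 0 g; [by left|right].
  by have := leD h h0; rewrite add0r -e.
Qed.

Lemma le_dv x y : leO le (v x) (v y) <-> dv O x y.
Proof.
have [->|x0] := eqVneq x 0.
  rewrite (proj2 (vN 0)) //; split=> [|/dv0x ->]; last by rewrite (proj2 (vN 0)).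
  case e : (v y) => //= _; move/vN: e => ->; apply: dvx0; exact: vring_val.
have e : v y = addO (v (y / x)) (v x) by rewrite -vM divfK.
rewrite dvE // /in_vring e.
have [g ->] := val_Some x0; case: (v (y / x)) => //= h; split=> hh.
  by have := leD (- g) hh; rewrite subrr addrK.
by have := leD g hh; rewrite add0r.
Qed.
Lemma lt_dv x y : ltO le (v x) (v y) <-> ~ dv O y x.
Proof. by rewrite ltO_nle le_dv. Qed.
Lemma eq_dv x y : v x = v y <-> dv O x y /\ dv O y x.
Proof.
by rewrite -!le_dv; split=> [->|[]]; [split; apply: leOxx|apply: leO_anti].
Qed.
Lemma res_char_dv p : res_char le v p <-> prime p /\ ~ vunit O p%:R.
Proof. by rewrite /res_char -val1 lt_dv. Qed.
Lemma valX x n g : v x = Some g -> v (x ^+ n) = Some (g *+ n).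
Proof.
move=> e; elim: n => [|n IH]; first by rewrite expr0 val1 mulr0n.
by rewrite exprS vM e IH /= mulrS.
Qed.

Lemma DRvp_dv : DRvp le v <-> forall p, res_char le v p ->
  ~ (p%:R != 0 :> F /\ forall x, x != 0 -> ~ vunit O x -> dv O p%:R x).
Proof.
split=> h p rp; have := h p rp; move=> nh H; apply: nh.
  case: H => p0 H; have [g eg] := val_Some p0; exists g; split => //.
  have [pr ltp] := rp; rewrite -eg; split => // d [x [x0 ex]]; rewrite -ex -val1 => /lt_dv nx.
  have := H x; rewrite -le_dv eg ex; apply => //; exact/eqP.
have [g [eg [lg H']]] := H; split; first by apply/eqP => /vN; rewrite eg.
move=> x x0 nx; have [d ed] := val_Some x0; apply/le_dv; rewrite eg ed; apply: H'.
  by exists x; split => //; apply/eqP.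
by rewrite -ed -val1; apply/lt_dv.
Qed.

Lemma DRst_dv : DRst le v <-> forall p, res_char le v p ->
  forall x, x != 0 -> exists2 y, dv O x (y ^+ p) & dv O (y ^+ p) x.
Proof.
split=> h p rp.
  move=> x x0; have [g eg] := val_Some x0.
  have [|d [[y [_ ed]] egd]] := h p rp g; first by exists x; split => //; apply/eqP.
  by exists y; apply/le_dv; rewrite (valX p ed) -egd eg; apply: leOxx.
move=> g [x [/eqP x0 eg]]; have [y xy yx] := h p rp x x0.
have p0 : (0 < p)%N by case: rp => /prime_gt0.
have y0 : y != 0 by have := dv_neq0 yx x0; apply: contraNneq => ->; rewrite expr0n gtn_eqF.
have [d ed] := val_Some y0; exists d; split; first by exists y; split => //; apply/eqP.
by have /eq_dv : dv O x (y ^+ p) /\ dv O (y ^+ p) x by []; rewrite eg (valX p ed) => -[].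
Qed.
End Bridge.

Section ExtensionBridge.
Variables (F : fieldType) (G : zmodType) (le : G -> G -> Prop) (v : F -> option G).
Variables (L : fieldType) (i : {rmorphism F -> L}).
Variables (H : zmodType) (leH : H -> H -> Prop) (w : L -> option H).
Hypothesis oag : is_oag le.
Hypothesis val : is_valuation le v.
Hypothesis oagH : is_oag leH.
Hypothesis valw : is_valuation leH w.
Hypothesis ext : extends_val i le v leH w.
Local Notation OL := (in_vring leH w).

Lemma ext_vring : in_vring le v = (fun x => OL (i x)).
Proof. by apply/funext => x; apply/propext; rewrite ext. Qed.
Lemma ext_dv x y : dv (in_vring le v) x y <-> dv OL (i x) (i y).
Proof. by rewrite ext_vring dv_preim //; apply: vring_val. Qed.
Lemma ext_res_char p : res_char leH w p <-> res_char le v p.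
Proof.
rewrite !res_char_dv //; split=> -[pr np]; split => // h; apply: np.
  by move/ext_dv: h; rewrite rmorph_nat rmorph1.
by apply/ext_dv; rewrite rmorph_nat rmorph1.
Qed.

Lemma DRvp_ext : DRvp le v -> DRvp leH w.
Proof.
move=> /(DRvp_dv oag val) h; apply/(DRvp_dv oagH valw) => p /ext_res_char rp [p0 hp].
apply: (h p rp); split; first by rewrite -(fmorph_eq0 i) rmorph_nat.
move=> x x0 nx; apply/ext_dv; rewrite rmorph_nat; apply: hp; first by rewrite fmorph_eq0.
by move=> u; apply: nx; apply/ext_dv; rewrite rmorph1.
Qed.

(** Otherwise the smallest positive value, that of [p], would be [p] times a positive value. *)
Lemma DRst_DRvp : DRst le v -> DRvp le v.
Proof.
move=> /(DRst_dv oag val) h; apply/(DRvp_dv oag val) => p rp [p0 hp].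
have vO := vring_val oag val; have /(res_char_dv oag val) [pr np] := rp.
have [y py yp] := h p rp _ p0.
have ny : ~ vunit (in_vring le v) y.
  by apply: (@nunitX_inv _ _ vO p); apply: nunit_dv np.
have y0 : y != 0.
  by have := dv_neq0 yp p0; apply: contraNneq => ->; rewrite expr0n gtn_eqF // prime_gt0.
have Oy := nunitO vO ny; have := dv_trans vO yp (hp y y0 ny).
have p2 := prime_gt1 pr; rewrite -(subnK p2) addn2 exprS -[X in dv _ _ X]mulr1.
move/(dv_mul2l y0) => u; apply: ny; apply: (dv_trans vO _ u).
by rewrite exprSr; apply: dv_Omul; apply: vrX.
Qed.

Hypothesis algL : algebraic_ext i.

(** In a polynomial relation for [y] two terms share the least value; comparing them gives the value
    of a power of [y] in terms of coefficients. *)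
Lemma value_torsion (y : L) : y != 0 ->
  exists n (f : F), [/\ (0 < n)%N, f != 0, dv OL (y ^+ n) (i f) & dv OL (i f) (y ^+ n)].
Proof.
move=> y0; have vO := vring_val oagH valw; have [q [q0 qy]] := algL y.
pose t j := i q`_j * y ^+ j.
have [|l ln hl] := @dv_min _ OL t (size q) vO; first by rewrite size_poly_gt0.
have tl0 : t l != 0.
  have : t (size q).-1 != 0.
    by rewrite mulf_neq0 ?expf_neq0 // fmorph_eq0 -[q`_ _]/(lead_coef q) lead_coef_eq0.
  by apply: dv_neq0; apply: hl; rewrite prednK // size_poly_gt0.
have [||j [jn jl hj]] := dv_sum_two vO ln hl; first exact: dvxx.
  have -> : \sum_(j < size q) t j = 0.
    have := eqP qy; rewrite horner_coef size_map_poly => e; rewrite -[RHS]e.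
    by apply: eq_bigr => j _; rewrite coef_map.
  by move/dv0x/eqP; apply/negP.
have {hl}hj' := hl j jn; have tj0 : t j != 0 by apply: dv_neq0 hj tl0.
have key a b : (a < b)%N -> t a != 0 -> t b != 0 -> dv OL (t a) (t b) -> dv OL (t b) (t a) ->
    exists n (f : F), [/\ (0 < n)%N, f != 0, dv OL (y ^+ n) (i f) & dv OL (i f) (y ^+ n)].
  move=> ab ta tb dab dba; exists (b - a)%N, (q`_a / q`_b).
  have qa : i q`_a != 0 by move: ta; rewrite mulf_eq0 => /norP [].
  have qb : i q`_b != 0 by move: tb; rewrite mulf_eq0 => /norP [].
  have ya : y ^+ a != 0 by rewrite expf_neq0.
  have eb : t b = y ^+ (b - a) * (i q`_b * y ^+ a).
    by rewrite mulrCA -exprD subnK // ltnW.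
  have ea : t a = (i q`_a / i q`_b) * (i q`_b * y ^+ a) by rewrite /t; field.
  have c0 : i q`_b * y ^+ a != 0 by rewrite mulf_neq0.
  rewrite subn_gt0 ab fmorph_div; split => //.
  - by rewrite mulf_neq0 ?invr_eq0 // -(fmorph_eq0 i).
  - by apply: (dv_mul2r c0); rewrite -ea -eb.
  - by apply: (dv_mul2r c0); rewrite -ea -eb.
have [lt|gt|e] := ltngtP j l; [exact: (key j l)|exact: (key l j)|].
by rewrite e eqxx in jl.
Qed.

(** Some [y^n] has the value of [g^p] with [g] in [F]. If [p] divides [n], cancel it and use
    induction; otherwise a Bezout relation between [n] and [p] makes the value of [y] divisible by
    [p]. *)
Lemma DRst_ext : DRst le v -> DRst leH w.
Proof.
move=> /(DRst_dv oag val) h; apply/(DRst_dv oagH valw) => p /ext_res_char rp y y0.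
have vO := vring_val oagH valw; have pr : prime p by case: rp.
have p1 := prime_gt0 pr.
have [n [f [n0 f0 yf fy]]] := value_torsion y0.
have [m] := ubnP n; elim: m n f n0 f0 yf fy => // m IH n f n0 f0 yf fy nm.
have [g fg gf] := h p rp f f0.
have {}yf : dv OL (y ^+ n) (i g ^+ p).
  by apply: (dv_trans vO yf); rewrite -rmorphXn; apply/ext_dv.
have {}fy : dv OL (i g ^+ p) (y ^+ n).
  by apply: (dv_trans vO _ fy); rewrite -rmorphXn; apply/ext_dv.
have g0 : g != 0.
  by have := dv_neq0 gf f0; apply: contraNneq => ->; rewrite expr0n gtn_eqF.
have [/dvdnP [k ek]|npn] := boolP (p %| n)%N.
  have k0 : (0 < k)%N by case: (k) ek n0 => // ->.
  apply: (IH k g) => //.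
  - by apply: (dvX_inv vO p1); rewrite -exprM -ek.
  - by apply: (dvX_inv vO p1); rewrite -exprM -ek.
  - by move: nm (prime_gt1 pr) k0; rewrite ek; clear; nia.
have cop : gcdn n p = 1%N by apply/eqP; rewrite -/(coprime n p) coprime_sym prime_coprime.
case: (egcdnP p n0) => a b eab _; rewrite cop in eab.
have yb0 : (y ^+ b) ^+ p != 0 by rewrite !expf_neq0.
have e1 : (i g ^+ a / y ^+ b) ^+ p * (y ^+ b) ^+ p = (i g ^+ p) ^+ a.
  by rewrite -exprMn divfK ?expf_neq0 // -!exprM mulnC.
have e2 : y * (y ^+ b) ^+ p = (y ^+ n) ^+ a by rewrite -!exprM mulnC [(n * a)%N]mulnC eab addn1 exprS mulnC.
exists (i g ^+ a / y ^+ b).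
  by apply: (dv_mul2r yb0); rewrite e1 e2; apply: dvX.
by apply: (dv_mul2r yb0); rewrite e1 e2; apply: dvX.
Qed.
End ExtensionBridge.

(** * Completions, and (DRvr) for algebraic extensions *)

Section CompletionTransfer.
Variables (F : fieldType) (G : zmodType) (le : G -> G -> Prop) (v : F -> option G).
Variables (L : fieldType) (i : {rmorphism F -> L}).
Variables (H : zmodType) (leH : H -> H -> Prop) (w : L -> option H).
Hypothesis oag : is_oag le.
Hypothesis val : is_valuation le v.
Hypothesis oagH : is_oag leH.
Hypothesis valw : is_valuation leH w.
Hypothesis ext : extends_val i le v leH w.
Hypothesis algL : algebraic_ext i.
Variables (K : fieldType) (iota : {rmorphism L -> K}) (wK : K -> option H).
Hypothesis comp : is_completion leH w iota wK.
Local Notation OL := (in_vring leH w).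
Local Notation OF := (in_vring le v).
Local Notation OK := (in_vring leH wK).
Local Notation nearK := (near OK false).

Let valK : is_valuation leH wK. Proof. by case: comp. Qed.
Let vOL : vring OL := vring_val oagH valw.
Let vOK : vring OK := vring_val oagH valK.
Let wE x : wK (iota x) = w x. Proof. by case: comp. Qed.

Lemma compl_dv x y : dv OL x y <-> dv OK (iota x) (iota y).
Proof. by rewrite -(le_dv oagH valw) -(le_dv oagH valK) !wE. Qed.
Lemma compl_vring x : OK (iota x) <-> OL x.
Proof. by rewrite /in_vring wE. Qed.
Lemma compl_vgroup t : t != 0 -> exists2 y, y != 0 & wK t = w y.
Proof.
move=> t0; have [_ _ vals _ _] := comp; have [y ey] := vals t; exists y => //.
apply: contra_neqN t0 => /eqP y0; have [h _ _] := valK; apply/h.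
by rewrite ey y0; have [h' _ _] := valw; apply/h'.
Qed.
Lemma compl_approx a t : t != 0 -> exists x : L, nearK t (a - iota x).
Proof.
move=> t0; have [_ _ _ app _] := comp; have [y y0 ey] := compl_vgroup t0.
have [g eg] := val_Some valw y0; have [|x hx] := app a g.
  by exists y; split => //; apply/eqP.
by exists x; apply/(lt_dv oagH valK); rewrite ey eg.
Qed.

Let c : {rmorphism F -> K} := iota \o i.
Let c_dv x y : dv OF x y <-> dv OK (c x) (c y).
Proof. by rewrite (ext_dv oagH valw ext) compl_dv. Qed.
Let cofinalK t : t != 0 -> exists2 f : F, f != 0 & dv OK t (c f).
Proof.
move=> t0; have [y y0 ey] := compl_vgroup t0; have [f f0 yf] := cofinal vOL algL y0.
exists f => //; apply: (dv_trans vOK (y := iota y)); last exact/compl_dv.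
by apply/(le_dv oagH valK); rewrite ey wE; apply: leOxx.
Qed.

(** The topological closure of [F] in the completion of [L]. It turns out to be a completion of [F],
    to which (DRvr) of [F] applies. *)
Definition closure (a : K) := forall t, t != 0 -> exists x : F, nearK t (a - c x).

Lemma subfd_closure : subfd closure.
Proof.
have cM a b : closure a -> closure b -> closure (a * b).
  move=> ca cb t t0; have [x hx] : exists x : F, nearK t ((a - c x) * b).
    have [->|b0] := eqVneq b 0; first by exists 0; rewrite mulr0; apply: near0.
    have [|x hx] := ca (t / b); first by rewrite mulf_neq0 ?invr_eq0.
    by exists x; rewrite -[t](divfK b0); apply: near_mul.
  have [y hy] : exists y : F, nearK t ((b - c y) * c x).
    have [->|x0] := eqVneq (c x) 0; first by exists 0; rewrite mulr0; apply: near0.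
    have [|y hy] := cb (t / c x); first by rewrite mulf_neq0 ?invr_eq0.
    by exists y; rewrite -[t](divfK x0); apply: near_mul.
  exists (x * y); rewrite rmorphM.
  have -> : a * b - c x * c y = (a - c x) * b + (b - c y) * c x by ring.
  exact: nearD.
have cV b : closure b -> closure b^-1.
  move=> cb t t0; have [->|b0] := eqVneq b 0.
    by exists 0; rewrite rmorph0 invr0 subr0; apply: near0.
  (* The approximation [y] must be closer to [b] than the size of [b], so that both have the same
     value, and closer than [t * b * b], because [1/b - 1/y] has denominator [b * y]. *)
  have [s s0 [sb stb]] : exists2 s, s != 0 & dv OK b s /\ dv OK (t * b * b) s.
    have [h|h] := dv_total vOK b (t * b * b).
      by exists (t * b * b); rewrite ?mulf_neq0 //; split => //; apply: dvxx.
    by exists b => //; split => //; apply: dvxx.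
  have [y hy] := cb s s0.
  have yb : dv OK (c y) b.
    apply: contrapT => nb; apply: (near_dv vOK sb hy).
    have nb' : nearK b (c y) by move=> h; apply: nb; apply: h.
    by case: (nearD vOK (near_dv vOK sb hy) nb'); rewrite subrK; apply: dvxx.
  have y0 : c y != 0 by apply: dv_neq0 yb b0.
  exists y^-1; rewrite fmorphV.
  have -> : b^-1 - (c y)^-1 = - (b - c y) / (b * c y) by field; rewrite b0 y0.
  have by0 : b * c y != 0 by rewrite mulf_neq0.
  rewrite -[t](mulfK by0); apply: near_mul; rewrite ?invr_eq0 //.
  apply: (@near_dv _ _ vOK _ _ s).
    by apply: (dv_trans vOK _ stb); rewrite -mulrA; apply: dv_mull => //; apply: dv_mull.
  exact: nearN.
split.
- by move=> t t0; exists 1; rewrite rmorph1 subrr; apply: near0.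
- move=> a b ca cb t t0; have [x hx] := ca t t0; have [y hy] := cb t t0; exists (x - y).
  rewrite rmorphB (_ : _ - _ = (a - c x) + - (b - c y)); last by ring.
  by apply: nearD => //; apply: nearN.
- by move=> a b ca cb; apply: cM => //; apply: cV.
Qed.

Let closure_im x : closure (c x).
Proof. by move=> t t0; exists x; rewrite subrr; apply: near0. Qed.

Local Notation C := (sftype subfd_closure).
Local Notation emb := (sfemb subfd_closure).
Let jC : {rmorphism F -> C} := sflift subfd_closure closure_im.
Let jCE x : emb (jC x) = c x. Proof. by []. Qed.

Let same_val (a : K) (x : F) := dv OK a (c x) /\ dv OK (c x) a.
Let same_ex (a : C) : exists x, same_val (emb a) x.
Proof.
have [->|a0] := eqVneq a 0; first by exists 0; rewrite /same_val !rmorph0; split; apply: dvx0.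
have ea0 : emb a != 0 by rewrite fmorph_eq0.
have [x hx] := sfembP a _ ea0; exists x; split.
  by rewrite -(subKr (emb a) (c x)); apply: dvB; rewrite ?dvxx //; [apply: dvxx|apply: ndv].
apply: contrapT => nx; have nx' : nearK (emb a) (c x) by [].
by case: (nearD vOK hx nx'); rewrite subrK; apply: dvxx.
Qed.

(** Each element of the closure has the value of some element of [F], which gives the valuation
    values in [G] rather than [H]. *)
Let vC (a : C) : option G := v (projT1 (cid (same_ex a))).
Let vCE a x : same_val (emb a) x -> vC a = v x.
Proof.
rewrite /vC; case: cid => y /= [ay ya] [ax xa]; apply/(eq_dv oag val).
by split; apply/c_dv; [apply: dv_trans ax|apply: dv_trans ay].
Qed.
Let vC_dv a b : leO le (vC a) (vC b) <-> dv OK (emb a) (emb b).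
Proof.
have [x [ax xa]] := same_ex a; have [y [by_ yb]] := same_ex b.
rewrite (vCE (conj ax xa)) (vCE (conj by_ yb)) (le_dv oag val) c_dv.
split=> h.
  by apply: (dv_trans vOK ax); apply: (dv_trans vOK h).
by apply: (dv_trans vOK xa); apply: (dv_trans vOK h).
Qed.
Let vC_lt a b : ltO le (vC a) (vC b) <-> ~ dv OK (emb b) (emb a).
Proof. by rewrite (ltO_nle oag) vC_dv. Qed.
Let vCj x : vC (jC x) = v x.
Proof. by apply: vCE; rewrite /same_val jCE; split; apply: dvxx. Qed.

Let vC_vgroup g : in_vgroup vC g -> exists2 x, x != 0 & v x = Some g.
Proof.
case=> a [/eqP a0 ea]; have [x sx] := same_ex a; exists x; last by rewrite -(vCE sx).
apply/eqP => x0; have [h _ _] := val; have := proj2 (h x) x0.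
by rewrite -(vCE sx) ea.
Qed.

(** Completeness comes from [K]: the Cauchy condition transfers because the values of [F] are
    cofinal among those of [K], and the limit stays in the closure. *)
Lemma completion_closure : is_completion le v jC vC.
Proof.
split.
- split.
  + move=> a; have [x sx] := same_ex a; rewrite (vCE sx); have [h _ _] := val.
    rewrite h; split=> [x0|a0].
      have [_] := sx; rewrite x0 rmorph0 => /dv0x /eqP.
      by rewrite fmorph_eq0 => /eqP.
    have [sx1 _] := sx; move: sx1; rewrite a0 rmorph0 => /dv0x /eqP.
    by rewrite fmorph_eq0 => /eqP.
  + move=> a b; have [x sx] := same_ex a; have [y sy] := same_ex b.
    have [_ h _] := val; rewrite (vCE sx) (vCE sy) -h; apply: vCE.
    rewrite rmorphM /same_val rmorphM; case: sx sy => [h1 h2] [h3 h4].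
    by split; apply: dvM.
  + move=> a b; rewrite !vC_dv rmorphD; have [h|h] := dv_total vOK (emb a) (emb b).
      by left; apply: dvD => //; apply: dvxx.
    by right; apply: dvD => //; apply: dvxx.
- exact: vCj.
- by move=> a; have [x sx] := same_ex a; exists x; apply: vCE.
- move=> a g [y [/eqP y0 ey]]; have [|x hx] := sfembP a _ (_ : c y != 0).
    by rewrite fmorph_eq0.
  by exists x; rewrite -ey -vCj; apply/vC_lt; rewrite rmorphB !jCE.
- move=> Fl [FT Fne Fsub Fcap] cauchy; have [_ _ _ _ cplK] := comp.
  have [||a ha] := cplK (fun A => Fl (fun x => A (emb x))).
  + split => //.
    * by move=> A /Fne [x Ax]; exists (emb x).
    * by move=> A B FA AB; apply: (Fsub _ _ FA) => x; apply: AB.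
    * by move=> A B FA FB; apply: Fcap.
  + move=> g [t [/eqP t0 et]]; have [f f0 tf] := cofinalK t0.
    have [g' eg'] := val_Some val f0.
    have [|A [FA hA]] := cauchy g'.
      exists (jC f); split; last by rewrite vCj.
      by apply/eqP; rewrite fmorph_eq0.
    exists (fun y => exists2 x, A x & y = emb x); split.
      by apply: (Fsub _ _ FA) => x Ax; exists x.
    move=> _ _ [x Ax ->] [y Ay ->]; rewrite -et; apply/(lt_dv oagH valK).
    have := hA x y Ax Ay; rewrite -eg' -vCj => /vC_lt; rewrite rmorphB jCE => h h'.
    by apply: h; apply: dv_trans tf.
  have conv t : t != 0 -> exists A, Fl A /\ forall x, A x -> nearK t (emb x - a).
    move=> t0; have [g eg] := val_Some valK t0.
    have [|A [FA hA]] := ha g; first by exists t; split => //; apply/eqP.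
    exists (fun x => A (emb x)); split => // x Ax.
    by apply/(lt_dv oagH valK); rewrite eg; apply: hA.
  have ca : closure a.
    move=> t t0; have [A [FA hA]] := conv t t0; have [x Ax] := Fne _ FA.
    have [y hy] := sfembP x t t0; exists y.
    rewrite (_ : _ - _ = (emb x - c y) + - (emb x - a)); last by ring.
    by apply: nearD => //; apply: nearN => //; apply: hA.
  have [b eb] := sfemb_ex subfd_closure ca; exists b => g /vC_vgroup [f f0 ef].
  have [|A [FA hA]] := conv (c f); first by rewrite fmorph_eq0.
  exists A; split => // x Ax; rewrite -ef -vCj; apply/vC_lt.
  by rewrite rmorphB eb jCE; apply: hA.
Qed.

Lemma DRvr_closure p : DRvr le v -> res_char le v p -> forall a, closure a -> OK a ->
  exists b, [/\ closure b, OK b & dv OK p%:R (b ^+ p - a)].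
Proof.
move=> dr rp a ca Oa; have [a' ea] := sfemb_ex subfd_closure ca.
have rV x : in_vring le vC x <-> OK (emb x).
  rewrite /in_vring -[Some 0](val1 val) -vCj vC_dv jCE rmorph1.
  exact: dv1.
have Oa' : in_vring le vC a' by apply/rV; rewrite ea.
have [b [Ob hb]] := dr p rp _ _ _ completion_closure a' Oa'.
exists (emb b); split; [exact: sfembP|exact/rV|].
by move/vC_dv: hb; rewrite rmorph_nat rmorphB rmorphXn ea.
Qed.

Variable p : nat.
Hypothesis rp : res_char leH w p.
Hypothesis drF : DRvr le v.
Let pr : prime p. Proof. by case: rp. Qed.
Let p1 : (0 < p)%N := prime_gt0 pr.
Let npL : ~ vunit OL p%:R. Proof. by have [] := proj1 (res_char_dv oagH valw p) rp. Qed.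
Let rpF : res_char le v p. Proof. exact/(ext_res_char oag val oagH valw ext). Qed.

Let cloF (x : F) : OL (i x) ->
  exists b, [/\ closure b, OK b & dv OK p%:R (b ^+ p - c x)].
Proof.
by move=> Ox; apply: (DRvr_closure drF rpF (closure_im x)); apply/compl_vring.
Qed.

Lemma semiperf_base (x : F) : p%:R != 0 :> L -> OL (i x) ->
  exists y : F, dv OL p%:R (i x - i y ^+ p).
Proof.
move=> p0 Ox; have [b [cb Ob hb]] := cloF Ox.
have pK0 : p%:R != 0 :> K by rewrite -(rmorph_nat iota) fmorph_eq0.
have [y hy] := cb _ pK0; exists y; apply/compl_dv.
rewrite rmorph_nat rmorphB rmorphXn; have hy' := ndv vOK hy.
have Oy : OK (c y).
  rewrite -(subKr b (c y)); apply: (vrB vOK) => //.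
  by case: hy' => r Or ->; apply: (vrM vOK) => //; apply: vr_nat.
have -> : iota (i x) - iota (i y) ^+ p = (b ^+ p - c y ^+ p) - (b ^+ p - c x).
  by rewrite /c /=; ring.
apply: dvB => //; rewrite subrXX mulrC; apply: dv_mulO => //.
by apply: vr_sum => // j _; apply: (vrM vOK); apply: vrX.
Qed.

(** Here [p = 0], so (DRvr) yields exact [p]-th roots in the closure of [F]. A nonintegral [a] is
    [a^p] times a power of the integral [a^-1]. *)
Lemma dense_base (chL : p \in [pchar L]) (a t : F) : t != 0 ->
  exists e : F, near OL false (i t) (i a - i e ^+ p).
Proof.
have chK : p \in [pchar K] by rewrite (fmorph_pchar iota).
have base (x s : F) : OL (i x) -> s != 0 -> exists e : F, near OL false (i s) (i x - i e ^+ p).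
  move=> Ox s0; have [b [cb Ob hb]] := cloF Ox.
  have eb : b ^+ p = c x.
    by move: hb; rewrite (pcharf0 chK) => /dv0x /eqP; rewrite subr_eq0 => /eqP.
  have cs0 : c s != 0 by rewrite fmorph_eq0.
  have [u u0 hu] : exists2 u, u != 0 & dv OK (c s) (u ^+ p).
    have [Os|nO] := pselect (OK (c s)).
      by exists (c s) => //; rewrite -(prednK p1) exprSr; apply: dv_Omul; apply: vrX.
    exists 1; rewrite ?oner_eq0 // expr1n; apply/vunitE; split => //.
    by case: (vrV vOK (c s)).
  have [y hy] := cb u u0; exists y => /compl_dv.
  rewrite rmorphB rmorphXn -[iota (i x)]/(c x) -eb -[iota (i y)]/(c y) -(frobB chK) => h.
  by apply: (near_dv vOK hu (near_pow vOK p1 hy)).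
move=> t0; have [Oa|nOa] := pselect (OL (i a)); first exact: base.
have a0 : a != 0 by apply: contra_notN nOa => /eqP ->; rewrite rmorph0; apply: vr0.
have iap0 : i a ^+ p != 0 by rewrite expf_neq0 // fmorph_eq0.
have Oa : OL (i (a^-1 ^+ p.-1)).
  by rewrite rmorphXn fmorphV; apply: vrX => //; case: (vrV vOL (i a)).
have [|e he] := base _ (t / a ^+ p) Oa; first by rewrite mulf_neq0 // invr_eq0 expf_neq0.
exists (a * e).
have -> : i t = i (t / a ^+ p) * i a ^+ p by rewrite fmorph_div rmorphXn divfK.
have -> : i a - i (a * e) ^+ p = (i (a^-1 ^+ p.-1) - i e ^+ p) * i a ^+ p.
  rewrite mulrBl rmorphM exprMn [i e ^+ p * _]mulrC; congr (_ - _).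
  rewrite -{2}(prednK p1) exprSr mulrA -rmorphXn -rmorphM -exprMn mulVf //.
  by rewrite expr1n rmorph1 mul1r.
exact: near_mul.
Qed.

(** The approximate roots of [x] form a Cauchy filter, because [(y - z)^p = y^p - z^p]; its limit is
    an exact root. *)
Lemma DRvr_equal (chL : p \in [pchar L]) x : OK x -> exists2 y, OK y & y ^+ p = x.
Proof.
move=> Ox; have chK : p \in [pchar K] by rewrite (fmorph_pchar iota).
have dense t : t != 0 -> exists y, nearK t (y ^+ p - x).
  move=> t0; have [l hl] := compl_approx x t0; have [s s0 es] := compl_vgroup t0.
  have [y hy] := perfect_dense vOL algL chL (dense_base chL) l s0.
  exists (iota y); rewrite -opprB; apply: nearN => //.
  rewrite -(subrK (iota l) x) -addrA; apply: nearD => //.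
  rewrite -rmorphXn -rmorphB; apply: (@near_dv _ _ vOK _ _ (iota s)).
    by apply/(le_dv oagH valK); rewrite es wE; apply: leOxx.
  by move=> /compl_dv.
have [_ _ _ _ cpl] := comp.
pose Fl (A : K -> Prop) := exists2 t, t != 0 & forall y, nearK t (y ^+ p - x) -> A y.
have [||a ha] := cpl Fl.
- split.
  + by exists 1; rewrite ?oner_eq0.
  + by move=> A [t t0 hA]; have [y hy] := dense t t0; exists y; apply: hA.
  + by move=> A B [t t0 hA] AB; exists t => // y /hA /AB.
  + move=> A B [t t0 hA] [s s0 hB]; have [ts|st] := dv_total vOK t s.
      by exists s => // y hy; split; [apply: hA; apply: near_dv hy|apply: hB].
    by exists t => // y hy; split; [apply: hA|apply: hB; apply: near_dv hy].
- move=> g [t [/eqP t0 et]]; exists (fun y => nearK (t ^+ p) (y ^+ p - x)); split.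
    by exists (t ^+ p); rewrite ?expf_neq0.
  move=> y z hy hz; rewrite -et; apply/(lt_dv oagH valK).
  apply: (near_root vOK p1 (b := false)); rewrite (frobB chK).
  rewrite (_ : _ - _ = (y ^+ p - x) + - (z ^+ p - x)); last by ring.
  by apply: nearD => //; apply: nearN.
have ea : a ^+ p = x.
  apply/eqP; rewrite -subr_eq0; apply/negPn/negP => t0; set t := a ^+ p - x in t0.
  have [u u0 hu] : exists2 u, u != 0 & dv OK t (u ^+ p).
    have [Os|nO] := pselect (OK t).
      by exists t => //; rewrite -(prednK p1) exprSr; apply: dv_Omul; apply: vrX.
    exists 1; rewrite ?oner_eq0 // expr1n; apply/vunitE; split => //.
    by case: (vrV vOK t).
  have [g eg] := val_Some valK u0.
  have [|A [[s s0 hA] hAa]] := ha g; first by exists u; split => //; apply/eqP.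
  have [r r0 [rs rt]] : exists2 r, r != 0 & dv OK s r /\ dv OK t r.
    have [h|h] := dv_total vOK s t; [exists t|exists s] => //; split => //; exact: dvxx.
  have [y hy] := dense r r0.
  have hya : nearK u (y - a).
    by apply/(lt_dv oagH valK); rewrite eg; apply: hAa; apply: hA; apply: near_dv hy.
  have : nearK t ((y ^+ p - x) + - (y - a) ^+ p).
    apply: nearD => //; first exact: near_dv hy.
    by apply: nearN => //; apply: (near_dv vOK hu); apply: near_pow.
  rewrite (frobB chK) (_ : _ + _ = t); last by rewrite /t; ring.
  by apply; apply: dvxx.
by exists a => //; apply: (vr_root vOK p1); rewrite ea.
Qed.

Lemma DRvr_at : DRvp le v -> forall x, OK x -> exists y, OK y /\ dv OK p%:R (y ^+ p - x).
Proof.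
move=> vp x Ox; have [p0|p0] := eqVneq (p%:R : L) 0.
  have chL : p \in [pchar L] by rewrite inE pr p0 eqxx.
  have [y Oy e] := DRvr_equal chL Ox; exists y; split => //.
  by rewrite e subrr; apply: dvx0.
have pF0 : p%:R != 0 :> F by rewrite -(fmorph_eq0 i) rmorph_nat.
have vOF : vring OF := vring_val oag val.
have SPF : semiperf OF p (fun=> True).
  move=> z Oz _; have [|y hy] := @semiperf_base z p0; first by apply/ext.
  by exists y; split => //; apply/(ext_dv oagH valw ext); rewrite rmorph_nat rmorphB rmorphXn.
(* (DRvp) gives [d] of value strictly between 0 and that of [p]. Then [d] and [p / d] both have the
   values of [p]-th powers by [semiperf_proot], each playing the part of [th] for the other, and the
   product of the roots is the element whose [p]-th power has the value of [p]. *)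
have [d d0 [nd npd]] : exists2 d : F, d != 0 & ~ vunit OF d /\ ~ dv OF p%:R d.
  apply: contrapT => no; apply: (proj1 (DRvp_dv oag val) vp p rpF); split => // z z0 nz.
  by apply: contrapT => h; apply: no; exists z.
have Od := nunitO vOF nd; have dp := ndv vOF npd.
have npd' : ~ vunit OF (p%:R / d).
  by move/vunitE => [_]; rewrite invf_div => /dvE h; apply: npd; apply: h.
have [|y1 [_ _ y1d dy1]] := semiperf_proot vOF pr SPF pF0 npd' I Od.
  by rewrite mulrC divfK //; apply: dvxx.
have [|y2 [_ _ y2d dy2]] := semiperf_proot vOF pr SPF pF0 nd I (nunitO vOF npd').
  by rewrite divfK //; apply: dvxx.
have ep : p%:R = d * (p%:R / d) by rewrite mulrC divfK.
have pK0 : p%:R != 0 :> K by rewrite -(rmorph_nat iota) fmorph_eq0.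
have [l hl] := compl_approx x pK0.
have hl' := ndv vOK hl.
have Ol : OL l.
  apply/compl_vring; rewrite -(subKr x (iota l)); apply: (vrB vOK) => //.
  by case: hl' => r Or ->; apply: (vrM vOK) => //; apply: vr_nat.
have [|||y hy] := @mixed_semiperf _ _ i OL vOL algL p pr p0 npL (y1 * y2) _ _ _ l Ol.
- rewrite -rmorphXn -(rmorph_nat i); apply/(ext_dv oagH valw ext).
  by rewrite exprMn ep; apply: dvM.
- rewrite -rmorphXn -(rmorph_nat i); apply/(ext_dv oagH valw ext).
  by rewrite exprMn ep; apply: dvM.
- by move=> z Oz; apply: semiperf_base.
have hy' : dv OK p%:R (iota l - iota y ^+ p).
  by rewrite -rmorphXn -rmorphB -(rmorph_nat iota); apply/compl_dv.
have hxy : dv OK p%:R (x - iota y ^+ p).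
  by rewrite -(subrK (iota l) x) -addrA; apply: dvD.
exists (iota y); split; last exact: dvC.
exact: (semiperf_int vOK pr Ox hxy).
Qed.
End CompletionTransfer.

Lemma DRvr_ext (F : fieldType) (G : zmodType) (le : G -> G -> Prop)
  (v : F -> option G) (L : fieldType) (i : {rmorphism F -> L})
  (H : zmodType) (leH : H -> H -> Prop) (w : L -> option H) :
  is_oag le -> is_valuation le v -> is_oag leH -> is_valuation leH w ->
  algebraic_ext i -> extends_val i le v leH w ->
  DRvr le v -> DRvp le v -> DRvr leH w.
Proof.
move=> oag val oagH valw alg ext dr vp p rp K iota wK comp x Ox.
have [valK _ _ _ _] := comp.
have [y [Oy hy]] := DRvr_at oag val oagH valw ext alg comp rp dr vp Ox.
by exists y; split => //; apply/(le_dv oagH valK).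
Qed.

(** * Taylor expansions over a purely inseparable extension of degree p *)

Section PolynomialsOver.
Variables (K : fieldType) (A : K -> Prop).
Hypothesis sA : subrg A.
Implicit Types (g h : {poly K}) (x c : K).

Definition polyin g := forall i, A g`_i.

Lemma polyinC c : A c -> polyin c%:P.
Proof. by move=> Ac i; rewrite coefC; case: ifP => // _; apply: sr0. Qed.
Lemma polyinD g h : polyin g -> polyin h -> polyin (g + h).
Proof. by move=> hg hh i; rewrite coefD; apply: srD. Qed.
Lemma polyinB g h : polyin g -> polyin h -> polyin (g - h).
Proof. by move=> hg hh i; rewrite coefB; apply: (srB sA). Qed.
Lemma polyinM g h : polyin g -> polyin h -> polyin (g * h).
Proof. by move=> hg hh i; rewrite coefM; apply: sr_sum => // j _; apply: (srM sA). Qed.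
Lemma polyinZ c g : A c -> polyin g -> polyin (c *: g).
Proof. by move=> Ac hg i; rewrite coefZ; apply: (srM sA). Qed.
Lemma polyinXn n : polyin 'X^n.
Proof. by move=> i; rewrite coefXn; apply: (sr_nat sA). Qed.
Lemma polyin_sum (I : Type) (r : seq I) (Q : pred I) (f : I -> {poly K}) :
  (forall i, Q i -> polyin (f i)) -> polyin (\sum_(i <- r | Q i) f i).
Proof.
move=> h; apply: (big_ind polyin) => //; last by move=> ? ?; apply: polyinD.
by move=> i; rewrite coef0; apply: sr0.
Qed.
Lemma polyin_exp g n : polyin g -> polyin (g ^+ n).
Proof.
by move=> hg; elim: n => [|n IH]; rewrite ?expr0 ?exprS; [apply: polyinC (sr1 sA)|apply: polyinM].
Qed.
Lemma polyin_comp g h : polyin g -> polyin h -> polyin (g \Po h).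
Proof.
move=> hg hh; rewrite comp_polyE; apply: polyin_sum => i _.
by apply: polyinZ => //; apply: polyin_exp.
Qed.
Lemma polyin_deriv g : polyin g -> polyin g^`().
Proof.
by move=> hg i; rewrite coef_deriv -mulr_natr; apply: (srM sA) => //; apply: (sr_nat sA).
Qed.
Lemma polyin_horner g x : polyin g -> A x -> A g.[x].
Proof.
move=> hg Ax; rewrite horner_coef; apply: sr_sum => // i _.
by apply: (srM sA) => //; apply: srX.
Qed.
Lemma polyin_shift g c : polyin g -> A c -> polyin (g \Po ('X + c%:P)).
Proof.
move=> hg Ac; apply: polyin_comp => //; apply: polyinD; last exact: polyinC.
by rewrite -['X]expr1; apply: polyinXn.
Qed.

Lemma polyin_edivp h g : h \is monic -> polyin h -> polyin g ->
  exists q r, [/\ polyin q, polyin r, g = q * h + r & (size r < size h)%N].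
Proof.
move=> mh hh; have h0 : (0 < size h)%N by rewrite size_poly_gt0 monic_neq0.
have [n] := ubnP (size g); elim: n g => // n IH g gn hg.
have [lt|ge] := ltnP (size g) (size h).
  exists 0, g; split => //; last by rewrite mul0r add0r.
  by move=> i; rewrite coef0; apply: sr0.
pose m := lead_coef g *: 'X^(size g - size h).
have hm : polyin m by apply: polyinZ; [apply: hg|apply: polyinXn].
have g0 : (0 < size g)%N by apply: leq_trans ge.
have lt : (size (g - m * h)%R < size g)%N.
  rewrite -(prednK g0) ltnS; apply/leq_sizeP => j; rewrite leq_eqVlt => /predU1P [<-|jg].
    rewrite coefB /m -scalerAl coefZ coefXnM.
    have -> : ((size g).-1 < size g - size h)%N = false by apply/negbTE; rewrite -leqNgt; lia.
    have -> : ((size g).-1 - (size g - size h))%N = (size h).-1 by lia.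
    by rewrite -[h`_ _]/(lead_coef h) (eqP mh) mulr1 subrr.
  have jg' : (size g <= j)%N by lia.
  have jh : (size h <= j - (size g - size h))%N by lia.
  rewrite coefB (nth_default _ jg') /m -scalerAl coefZ coefXnM.
  case: ifP => _; first by rewrite mulr0 subr0.
  by rewrite (nth_default _ jh) mulr0 subr0.
have [||q [r [hq hr e sr]]] := IH (g - m * h).
- exact: leq_trans lt _.
- by apply: polyinB => //; apply: polyinM.
exists (q + m), r; split => //; first exact: polyinD.
by rewrite -(subrK (m * h) g) e; ring.
Qed.
End PolynomialsOver.

Lemma subrg_subfd (K : fieldType) (P : K -> Prop) : subfd P -> subrg P.
Proof. by move=> sP; split; [apply: sf1|apply: sfB|apply: sfM]. Qed.
Lemma subrg_vring (K : fieldType) (O : K -> Prop) : vring O -> subrg O.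
Proof. by move=> vO; split; [apply: vr1|apply: vrB|apply: vrM]. Qed.
Lemma subrgI (K : fieldType) (A B : K -> Prop) : subrg A -> subrg B ->
  subrg (fun x => A x /\ B x).
Proof.
move=> sA sB; split; first by split; apply: sr1.
  by move=> x y [Ax Bx] [Ay By]; split; apply: srB.
by move=> x y [Ax Bx] [Ay By]; split; apply: srM.
Qed.

Lemma coef0_shift (K : fieldType) (g : {poly K}) c : (g \Po ('X + c%:P))`_0 = g.[c].
Proof. by rewrite -horner_coef0 horner_comp !hornerE. Qed.
Lemma coef1_shift (K : fieldType) (g : {poly K}) c : (g \Po ('X + c%:P))`_1 = g^`().[c].
Proof.
have := coef_deriv (g \Po ('X + c%:P)) 0; rewrite mulr1n => <-.
by rewrite deriv_comp derivD derivX derivC addr0 mulr1 coef0_shift.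
Qed.
Lemma horner_shift (K : fieldType) (g : {poly K}) c x : (g \Po ('X + c%:P)).[x - c] = g.[x].
Proof. by rewrite horner_comp !hornerE subrK. Qed.
Lemma size_shift (K : fieldType) (g : {poly K}) c : size (g \Po ('X + c%:P)) = size g.
Proof. by rewrite -[c]opprK polyCN size_comp_poly2 // size_XsubC. Qed.

Lemma vunit_natr (K : fieldType) (O : K -> Prop) p d : vring O -> p \in [pchar K] ->
  (0 < d < p)%N -> vunit O d%:R.
Proof.
move=> vO chK /andP [d0 dp]; have pr := pcharf_prime chK.
have cop : gcdn d p = 1%N.
  apply/eqP; rewrite -/(coprime d p) coprime_sym prime_coprime //.
  by apply/negP => /(dvdn_leq d0); rewrite leqNgt dp.
case: (egcdnP p d0) => a b e _; exists a%:R; first exact: vr_nat.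
by rewrite -natrM e cop natrD natrM (pcharf0 chK) mulr0 add0r.
Qed.

Section Residue.
Variables (K : fieldType) (O P : K -> Prop).
Hypothesis vO : vring O.
Hypothesis sP : subfd P.
Variable p : nat.
Hypothesis chK : p \in [pchar K].
Let A x := O x /\ P x.
Let sA : subrg A := subrgI (subrg_vring vO) (subrg_subfd sP).
Let sO : subrg O := subrg_vring vO.
Let pr := pcharf_prime chK.
Variable y : K.
Hypothesis Oy : O y.
Hypothesis Pyp : P (y ^+ p).

(** Drop the terms above the last unit coefficient, whose coefficients are nonunits, and divide by
    that coefficient. *)
Let top_unit (g : {poly K}) l : polyin A g -> vunit O g`_l -> ~ vunit O g.[y] ->
  exists h, [/\ h \is monic, polyin A h, ~ vunit O h.[y] & (size h <= size g)%N].
Proof.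
move=> Ag ul ng.
have exQ : exists l, `[< vunit O g`_l >] by exists l; apply/asboolP.
have ubQ j : `[< vunit O g`_j >] -> (j <= size g)%N.
  move/asboolP/vunitE => [g0 _]; rewrite leqNgt; apply: contra g0 => lt.
  by rewrite nth_default // ltnW.
case: (ex_maxnP exQ ubQ) => k /asboolP /vunitE [k0 Ok] kmax.
have ksz : (k < size g)%N by rewrite ltnNge; apply: contraNN k0 => ge; rewrite nth_default.
have Ak : A (g`_k)^-1 by split => //; apply: sfV => //; case: (Ag k).
exists ((g`_k)^-1 *: take_poly k.+1 g).
have sz : size (take_poly k.+1 g) = k.+1.
  apply/eqP; rewrite eqn_leq size_take_poly /=; apply: contraNltn k0.
  by move=> /leq_sizeP /(_ k (leqnn k)); rewrite coef_take_poly ltnS leqnn => ->.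
have ki0 : (g`_k)^-1 != 0 by rewrite invr_eq0.
split.
- apply/monicP; rewrite lead_coefZ lead_coefE sz /= coef_take_poly ltnS leqnn.
  by rewrite mulVf.
- apply: polyinZ => // j; rewrite coef_take_poly; case: ifP => // _; exact: sr0.
- rewrite hornerZ; apply: nunitMl => //.
  have -> : take_poly k.+1 g = g - drop_poly k.+1 g * 'X^(k.+1).
    by apply/eqP; rewrite eq_sym subr_eq poly_take_drop.
  rewrite hornerD hornerN; apply: nunitB => //.
  rewrite hornerM horner_coef mulr_suml; apply: nunit_sum => // j _.
  rewrite coef_drop_poly -mulrA mulrC; apply: nunitMl => //.
    by apply: (vrM vO); [|rewrite hornerXn]; apply: vrX.
  by move=> u; have := kmax (j + k.+1)%N (introT (asboolP _) u); lia.
- by rewrite size_scale // sz.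
Qed.

(* The residue of [y] has degree 1 or [p] over the residue field of [P]:
   shifted by [y], a monic [h] of minimal degree with [h y] a nonunit has a
   unit coefficient in degree 1, and it divides [X^p - y^p], which becomes [X^p]. *)
Lemma residue_degree (g : {poly K}) l : polyin A g -> (size g <= p)%N ->
  vunit O g`_l -> ~ vunit O g.[y] -> exists2 c, A c & ~ vunit O (y - c).
Proof.
move=> Ag gp ul ng; have [h0 [mh0 Ah0 nh0 sh0]] := top_unit Ag ul ng.
pose Q n := `[< exists h, [/\ h \is monic, polyin A h, ~ vunit O h.[y] & size h = n] >].
have exQ : exists n, Q n by exists (size h0); apply/asboolP; exists h0.
case: (ex_minnP exQ) => n /asboolP [h [mh Ah nh sh]] minn.
have hp : (size h <= p)%N.
  rewrite sh; apply: leq_trans gp; apply: leq_trans sh0.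
  by apply: minn; apply/asboolP; exists h0.
have low (r : {poly K}) j : polyin A r -> (size r < size h)%N -> ~ vunit O r.[y] -> ~ vunit O r`_j.
  move=> Ar rh nr uj; have [h1 [mh1 Ah1 nh1 sh1]] := top_unit Ar uj nr.
  have := minn (size h1); rewrite leqNgt -sh (leq_ltn_trans sh1 rh) => H.
  by have := H (introT (asboolP _) (ex_intro _ h1 (And4 mh1 Ah1 nh1 erefl))).
have h1 : (1 < size h)%N.
  rewrite ltnNge; apply/negP => /size1_polyC eh; have := nh; rewrite eh hornerC.
  have := monicP mh; rewrite {1}eh lead_coefC => ->; apply; exact: vunit1.
have hd : (0 < (size h).-1 < p)%N by lia.
have udh : vunit O h^`().[y].
  apply: contrapT => nd.
  have := low h^`() (size h).-2 (polyin_deriv sA Ah) _ nd; apply.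
    by apply: lt_size_deriv; apply: monic_neq0.
  rewrite coef_deriv; have -> : (size h).-2.+1 = (size h).-1 by lia.
  by rewrite -[h`_ _]/(lead_coef h) (monicP mh); apply: (vunit_natr vO chK).
have [|q [r [Aq Ar e sr]]] := @polyin_edivp _ A sA h ('X^p - (y ^+ p)%:P) mh Ah.
  apply: polyinB => //; first exact: polyinXn.
  by apply: polyinC => //; split => //; apply: vrX.
have nr : ~ vunit O r.[y].
  have -> : r.[y] = - (q.[y] * h.[y]).
    apply/eqP; rewrite -addr_eq0 addrC -hornerM -hornerD -e.
    by rewrite !hornerE subrr.
  apply: nunitN => //; apply: nunitMl => //; apply: (polyin_horner sO) => // j.
  by case: (Aq j).
have nri j := low r j Ar sr nr.
pose sft := 'X + y%:P : {poly K}.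
have Osft : polyin O sft by apply: polyinD => //; [rewrite -['X]expr1; apply: polyinXn|apply: polyinC].
have OA (f : {poly K}) : polyin A f -> polyin O f by move=> Af j; case: (Af j).
have nrs j : ~ vunit O (r \Po sft)`_j.
  rewrite comp_polyE coef_sum; apply: nunit_sum => // k _; rewrite coefZ mulrC.
  by apply: nunitMl => //; apply: polyin_exp.
have es : 'X^p = (q \Po sft) * (h \Po sft) + (r \Po sft).
  rewrite -comp_polyM -comp_polyD -e comp_polyB comp_polyC comp_Xn_poly.
  have chP : p \in [pchar {poly K}].
    by rewrite inE pr -polyC_natr (pcharf0 chK) polyC0 eqxx.
  by rewrite /sft exprDn_pchar ?pnatE // -polyC_exp addrK.
have q0 : q != 0.
  apply: contraTneq sr => q0; have := e; rewrite q0 mul0r add0r => <-.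
  by rewrite size_XnsubC ?prime_gt0 // -leqNgt; lia.
have sq : (size q + (size h).-1 = p.+1)%N.
  have : size (q * h) = p.+1.
    have -> : q * h = ('X^p - (y ^+ p)%:P) - r by rewrite e addrK.
    rewrite size_polyDl ?size_XnsubC ?prime_gt0 // size_polyN.
    by apply: leq_trans sr _; lia.
  by rewrite (size_mul q0 (monic_neq0 mh)) -(prednK (ltnW h1)) addnS.
have sqs : size (q \Po sft) = size q by apply: size_shift.
pose qs := q \Po sft; pose hs := h \Po sft.
have Oqs : polyin O qs by apply: polyin_comp => //; apply: OA.
have Ohs : polyin O hs by apply: polyin_comp => //; apply: OA.
have nhs0 : ~ vunit O hs`_0 by rewrite coef0_shift.
have uhs1 : vunit O hs`_1 by rewrite coef1_shift.
(* Let [s] be the lowest degree of a unit coefficient of [qs]. As [hs] has a nonunit in degree 0 and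
   a unit in degree 1, the product has a unit in degree [s + 1], which must be the degree [p] of
   ['X^p]. So [q] has degree at least [p - 1], and [h] is linear. *)
have exU : exists s, `[< vunit O qs`_s >].
  apply: contrapT => no; have : ~ vunit O (qs * hs + (r \Po sft))`_p.
    rewrite coefD coefM; apply: nunitD => //; apply: nunit_sum => // j _; rewrite mulrC.
    by apply: nunitMl => // u; apply: no; exists (nat_of_ord j); apply/asboolP.
  by apply; rewrite -es coefXn eqxx; apply: vunit1.
case: (ex_minnP exU) => s /asboolP us smin.
have us1 : vunit O (qs * hs + (r \Po sft))`_s.+1.
  rewrite coefD; apply: vunitD => //; rewrite coefM.
  rewrite (bigD1 (Ordinal (ltnW (ltnSn s.+1)))) //=; rewrite subSnn.
  apply: vunitD => //; first exact: vunitM.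
  apply: nunit_sum => // j js; have [lt|ge] := ltnP j s.
    rewrite mulrC; apply: nunitMl => // u.
    by have := smin j (introT (asboolP _) u); rewrite leqNgt lt.
  have -> : nat_of_ord j = s.+1.
    apply/eqP; rewrite eqn_leq -ltnS ltn_ord /= ltn_neqAle ge andbT eq_sym.
    by apply: contraNneq js => ejs; apply/eqP/val_inj.
  by rewrite subnn; apply: nunitMl.
have sp : s.+1 = p.
  apply/eqP; apply: contrapT => ne; move: us1; rewrite -es coefXn.
  by move/negbTE: (introN idP ne) => ->; apply: nunit0.
have ssz : (s < size q)%N.
  rewrite -sqs ltnNge; apply/negP => ge; move: us; rewrite nth_default //.
  exact: nunit0.
have sh2 : size h = 2%N by lia.
exists (- h`_0); first by apply: srN.
rewrite opprK; have -> : y + h`_0 = h.[y]; last exact: nh.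
rewrite horner_coef sh2 !big_ord_recl big_ord0 /= addr0 expr0 mulr1 expr1.
have := monicP mh; rewrite lead_coefE sh2 /= => ->; by rewrite mul1r addrC.
Qed.
End Residue.

Section ApproximateRoot.
Variables (K : fieldType) (O P : K -> Prop).
Hypothesis vO : vring O.
Hypothesis sP : subfd P.
Variable p : nat.
Hypothesis p0 : (0 < p)%N.
Let A x := O x /\ P x.
Let sA : subrg A := subrgI (subrg_vring vO) (subrg_subfd sP).
Let M x := P x /\ ~ vunit O x.
Variables (z : K) (g : {poly K}).
Hypothesis nz : ~ vunit O z.
Hypothesis Pzp : P (z ^+ p).
Hypothesis Ag : polyin A g.
Hypothesis ng0 : ~ vunit O g`_0.
Hypothesis ug1 : vunit O g`_1.

Let Oz : O z := nunitO vO nz.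
Let M_A x : M x -> A x. Proof. by case=> Px nx; split => //; apply: nunitO. Qed.
Let MD x y : M x -> M y -> M (x + y).
Proof. by move=> [Px nx] [Py ny]; split; [apply: sfD|apply: nunitD]. Qed.
Let M0 : M 0. Proof. by split; [apply: sf0|apply: nunit0]. Qed.
Let MM x y : A x -> M y -> M (x * y).
Proof. by move=> [Ox Px] [Py ny]; split; [apply: sfM|apply: nunitMl]. Qed.

(* Modulo [g.[z] O], the powers [z ^+ j] for [j >= k] are combinations of the
   smaller powers with nonunit coefficients; [k] descends from [p] to [1]. *)
Let J k x := exists (f : {poly K}) a,
  [/\ forall i, M f`_i, (size f <= k)%N, O a & x = f.[z] + g.[z] * a].

Let JD k x y : J k x -> J k y -> J k (x + y).
Proof.
move=> [f [a [Mf sf Oa ->]]] [f' [a' [Mf' sf' Oa' ->]]]; exists (f + f'), (a + a'); split.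
- by move=> i; rewrite coefD; apply: MD.
- by rewrite (leq_trans (size_polyD _ _)) // geq_max sf.
- exact: vrD.
- by rewrite hornerD; ring.
Qed.
Let JM k c x : A c -> J k x -> J k (c * x).
Proof.
move=> Ac [f [a [Mf sf Oa ->]]]; exists (c *: f), (c * a); split.
- by move=> i; rewrite coefZ; apply: MM.
- exact: leq_trans (size_scale_leq _ _) sf.
- by apply: (vrM vO) => //; case: Ac.
- by rewrite hornerZ; ring.
Qed.
Let Jmono k c j : M c -> (j < k)%N -> J k (c * z ^+ j).
Proof.
move=> Mc jk; exists (c *: 'X^j), 0; split.
- move=> i; rewrite coefZ coefXn; case: eqP => _; rewrite ?mulr1 ?mulr0 //.
- by rewrite (leq_trans (size_scale_leq _ _)) // size_polyXn.
- exact: vr0.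
- by rewrite hornerZ hornerXn mulr0 addr0.
Qed.
Let Jg k a : O a -> J k (g.[z] * a).
Proof.
move=> Oa; exists 0, a; split => //; first by move=> i; rewrite coef0.
  by rewrite size_poly0.
by rewrite horner0 add0r.
Qed.

Let Jp j : (p <= j)%N -> J p (z ^+ j).
Proof.
move=> pj; rewrite (divn_eq j p) exprD mulnC exprM; apply: Jmono; last by rewrite ltn_mod.
split; first exact: sfX.
by apply: nunitX => //; [rewrite divn_gt0|apply: nunitX].
Qed.

Let Jsplit k x : J k.+1 x -> exists c b, [/\ M c, J k b & x = c * z ^+ k + b].
Proof.
move=> [f [a [Mf sf Oa ->]]].
exists f`_k, ((\poly_(i < k) f`_i).[z] + g.[z] * a); split => //.
  exists (\poly_(i < k) f`_i), a; split => //; try exact: size_poly.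
  by move=> i; rewrite coef_poly; case: ifP.
by rewrite (horner_coef_wide _ sf) big_ord_recr horner_poly /=; ring.
Qed.

Let Jstep k : (0 < k)%N -> (forall j, (k < j)%N -> J k.+1 (z ^+ j)) -> J k (z ^+ k).
Proof.
move=> k0 IH.
have [c [b [Mc Jb eT]]] : exists c b, [/\ M c, J k b &
    \sum_(2 <= j < size g) g`_j * z ^+ (k.-1 + j) = c * z ^+ k + b].
  apply: Jsplit; rewrite big_nat; apply: (big_ind (J k.+1)); [|exact: JD|].
    by have := @Jmono k.+1 0 0 M0 isT; rewrite mul0r.
  by move=> j /andP [j2 _]; apply: JM => //; apply: IH; lia.
pose u := g`_1 + c.
have uu : vunit O u by apply: vunitD => //; case: Mc.
have /vunitE [u0 Ou] := uu.
have Au : A u^-1 by split => //; apply: sfV => //; apply: sfD => //; [case: (Ag 1)|case: Mc].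
have sz : (1 < size g)%N.
  rewrite ltnNge; apply/negP => le1; have /vunitE [/negP] := ug1.
  by rewrite nth_default.
have e : g.[z] * z ^+ k.-1 = g`_0 * z ^+ k.-1 + (u * z ^+ k + b).
  rewrite /u mulrDl -addrA -eT horner_coef mulr_suml.
  rewrite -(big_mkord xpredT (fun j => g`_j * z ^+ j * z ^+ k.-1)) big_ltn ?(ltnW sz) //.
  rewrite big_ltn // expr0 mulr1 expr1 -mulrA -exprS (prednK k0); congr (_ + (_ + _)).
  by apply: eq_bigr => j _; rewrite -mulrA -exprD addnC.
have -> : z ^+ k = u^-1 * (g.[z] * z ^+ k.-1 + ((- g`_0) * z ^+ k.-1 + (-1) * b)).
  by rewrite e; field.
apply: JM => //; apply: JD; first by apply: Jg; apply: vrX.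
apply: JD.
  apply: Jmono; last by rewrite prednK.
  by split; [apply: sfN => //; case: (Ag 0)|apply: nunitN].
by apply: JM => //; apply: (srN sA); apply: (sr1 sA).
Qed.

Let Jall n : (n < p)%N -> forall j, (p - n <= j)%N -> J (p - n) (z ^+ j).
Proof.
elim: n => [|n IH] np j; first by rewrite subn0; apply: Jp.
have IH' := IH (ltnW np); set k := (p - n.+1)%N.
have ek : (p - n)%N = k.+1 by rewrite /k; lia.
rewrite ek in IH'; have Jk : J k (z ^+ k) by apply: Jstep => //; rewrite /k subn_gt0.
rewrite leq_eqVlt => /predU1P [<-|kj] //.
have [c [b [Mc Jb ->]]] := Jsplit (IH' j kj); apply: JD => //.
by apply: JM => //; apply: M_A.
Qed.

(** A substitute for Newton's method without completeness: at [k = 1] the element [z] itself is a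
    constant from [P] plus a multiple of [g.[z]]. *)
Lemma approximate_root : exists2 e, A e & dv O g.[z] (z - e).
Proof.
have e1 : (p - p.-1)%N = 1%N by lia.
have h1 : (p.-1 < p)%N by rewrite prednK.
have h2 : (p - p.-1 <= 1)%N by rewrite e1.
have [f [a [Mf sf Oa e]]] := Jall h1 h2.
rewrite e1 in sf; exists f`_0; first exact: M_A.
have ef : f.[z] = f`_0 by rewrite {1}[f]size1_polyC // hornerC.
exists a => //; apply/eqP; rewrite subr_eq addrC [a * _]mulrC -ef -e; exact/eqP.
Qed.
End ApproximateRoot.

Section Taylor.
Variables (K : fieldType) (O P : K -> Prop).
Hypothesis vO : vring O.
Hypothesis sP : subfd P.
Variable p : nat.
Hypothesis chK : p \in [pchar K].
Variable b : K.
Hypothesis Pbp : P (b ^+ p).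
Let pr := pcharf_prime chK.
Let p1 := prime_gt0 pr.
Let sA : subrg (fun x => O x /\ P x) := subrgI (subrg_vring vO) (subrg_subfd sP).
Local Notation "x %|| y" := (dv O x y) (at level 70).

Let value_pow y n (k : K) : (0 < n < p)%N -> y != 0 -> P (y ^+ p) -> P k ->
  y ^+ n %|| k -> k %|| y ^+ n -> exists2 k', P k' & y %|| k' /\ k' %|| y.
Proof.
move=> /andP [n0 np] y0 Pyp Pk yk ky.
have cop : gcdn n p = 1%N.
  apply/eqP; rewrite -/(coprime n p) coprime_sym prime_coprime //.
  by apply/negP => /(dvdn_leq n0); rewrite leqNgt np.
case: (egcdnP p n0) => a c e _; rewrite cop in e.
have e1 : y * (y ^+ p) ^+ c = (y ^+ n) ^+ a by rewrite -!exprM mulnC [(n * a)%N]mulnC e addn1 exprS mulnC.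
have yc0 : (y ^+ p) ^+ c != 0 by rewrite !expf_neq0.
exists (k ^+ a / (y ^+ p) ^+ c); first by apply: (sfdiv sP); apply: sfX.
by split; apply: (dv_mul2r yc0); rewrite divfK // e1; apply: dvX.
Qed.

(* For all centres [c] close enough to [b], no cancellation occurs between the
   Taylor terms of [g] at [c]. *)
Lemma taylor_terms (g : {poly K}) : polyin P g -> (size g <= p)%N ->
  exists2 c0, P c0 & forall c, P c -> b - c0 %|| b - c ->
    forall l, g.[b] %|| (g \Po ('X + c%:P))`_l * (b - c) ^+ l.
Proof.
have sP' := subrg_subfd sP.
move=> Pg; have [n] := ubnP (size g); elim: n g Pg => // n IH g Pg gn gp.
have [g1|g1] := leqP (size g) 1.
  exists 0; first exact: sf0.
  move=> c _ _ l; rewrite {2}[g]size1_polyC // comp_polyC coefC.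
  case: eqP => [->|_]; last by rewrite mul0r; apply: dvx0.
  by rewrite expr0 mulr1 [X in X.[b]]size1_polyC // hornerC; apply: dvxx.
have g0 : g != 0 by rewrite -size_poly_gt0 ltnW.
have dlt := lt_size_deriv g0.
(* The derivative controls the terms of positive degree: its Taylor coefficient of degree [l - 1] is
   [l] times that of [g] in degree [l], and [l] is a unit for [0 < l < p]. *)
have [||c1 Pc1 hc1] := IH g^`() (polyin_deriv sP' Pg).
- exact: leq_trans dlt _.
- exact: ltnW (leq_trans dlt gp).
have terms c l : P c -> b - c1 %|| b - c -> (0 < l)%N ->
    g^`().[b] * (b - c) %|| (g \Po ('X + c%:P))`_l * (b - c) ^+ l.
  move=> Pc bc l0; have [lp|pl] := ltnP l p; last first.
    rewrite nth_default ?mul0r; first exact: dvx0.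
    by rewrite size_shift (leq_trans gp).
  have := hc1 c Pc bc l.-1.
  have -> : (g^`() \Po ('X + c%:P))`_l.-1 = (g \Po ('X + c%:P))`_l *+ l.
    rewrite -[X in _ *+ X](prednK l0) -[X in _`_X *+ _](prednK l0) -coef_deriv.
    by rewrite deriv_comp derivD derivX derivC addr0 mulr1.
  move=> h; rewrite -[X in _ ^+ X](prednK l0) exprSr mulrA; apply: dv_mulr => //.
  have ul : vunit O l%:R by apply: (vunit_natr vO chK); rewrite l0 lp.
  have /vunitE [l00 Ol] := ul.
  have -> : forall u v : K, u * v = l%:R^-1 * (u *+ l * v) by move=> u v; rewrite -mulr_natr; field.
  exact: dv_mulO.
(* Then all terms of positive degree are multiples of [g.[b]], and so is the constant term, which is
   [g.[b]] minus their sum. *)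
suff [c0 Pc0 [bc0 gc0]] : exists2 c0, P c0 & b - c1 %|| b - c0 /\ g.[b] %|| g^`().[b] * (b - c0).
  exists c0 => // c Pc bc l.
  have pos l' : (0 < l')%N -> g.[b] %|| (g \Po ('X + c%:P))`_l' * (b - c) ^+ l'.
    move=> l0; apply: (dv_trans vO gc0); apply: (dv_trans vO (dv_mull vO _ bc)).
    by apply: terms => //; apply: (dv_trans vO bc0).
  case: l => [|l]; last exact: pos.
  have e : g.[b] = \sum_(j < size g) (g \Po ('X + c%:P))`_j * (b - c) ^+ j.
    by rewrite -[LHS](horner_shift g c) horner_coef size_shift.
  have -> : (g \Po ('X + c%:P))`_0 * (b - c) ^+ 0 =
      g.[b] - \sum_(1 <= j < size g) (g \Po ('X + c%:P))`_j * (b - c) ^+ j.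
    rewrite e -(big_mkord xpredT (fun j => (g \Po ('X + c%:P))`_j * (b - c) ^+ j)).
    by rewrite big_ltn ?addrK // ltnW.
  apply: dvB => //; first exact: dvxx.
  by rewrite big_nat; apply: dv_sum => // j /andP [j1 _]; apply: pos.
(* In the bad case [e] has smaller value than [g.[b]], so the Taylor terms of least value cancel.
   This forces [b - c1] to be close, after scaling, to an element of [P], and the centre can be
   improved. *)
have [ok|bad] := pselect (g.[b] %|| g^`().[b] * (b - c1)).
  by exists c1 => //; split => //; apply: dvxx.
set y0 := b - c1 in bad *; set e := g^`().[b] * y0 in bad.
have eg : e %|| g.[b] := ndv vO bad.
have e0 : e != 0 by apply: contra_notN bad => /eqP ->; apply: dvx0.
have y00 : y0 != 0 by move: e0; rewrite mulf_eq0 => /norP [].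
have d0 : g^`().[b] != 0 by move: e0; rewrite mulf_eq0 => /norP [].
pose gc := g \Po ('X + c1%:P); pose t j := gc`_j * y0 ^+ j.
have Pgc : polyin P gc by apply: polyin_shift.
have sgc : size gc = size g by apply: size_shift.
have sumt : \sum_(j < size g) t j = g.[b].
  by rewrite -(horner_shift g c1) horner_coef sgc.
have et j : (0 < j)%N -> e %|| t j.
  by move=> j0; apply: terms => //; apply: dvxx.
have et0 j : (j < size g)%N -> e %|| t j.
  case: j => [_|j _]; last exact: et.
  have -> : t 0%N = g.[b] - \sum_(1 <= j < size g) t j.
    by rewrite -sumt -(big_mkord xpredT t) big_ltn ?addrK // ltnW.
  by apply: dvB => //; rewrite big_nat; apply: dv_sum => // j /andP [j1 _]; apply: et.
(* [e] is the sum of the [t j *+ j], so a term of positive degree attains its value. *)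
have [l [l0 lg tle]] : exists l, [/\ (0 < l)%N, (l < size g)%N & t l %|| e].
  apply: contrapT => no.
  have : ~ vunit O (e / e); last by rewrite divff //; apply; apply: vunit1.
  have {1}-> : e = \sum_(1 <= j < size g) t j *+ j.
    rewrite /e -(horner_shift g^`() c1).
    have -> : g^`() \Po ('X + c1%:P) = gc^`().
      by rewrite /gc deriv_comp derivD derivX derivC addr0 mulr1.
    have gc0 : gc != 0 by rewrite -size_poly_gt0 sgc ltnW.
    have sd : (size gc^`() <= (size g).-1)%N.
      by rewrite -ltnS (prednK (ltnW g1)) -sgc; apply: lt_size_deriv.
    rewrite (horner_coef_wide _ sd) mulr_suml -(prednK (ltnW g1)) big_add1 /= big_mkord.
    apply: eq_bigr => j _; rewrite coef_deriv /t -/y0 exprSr.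
    by rewrite mulrA mulrnAl mulrnAl.
  rewrite mulr_suml big_nat; apply: nunit_sum => // j /andP [j1 jg].
  rewrite -mulr_natl -mulrA; apply: nunitMl => //; first exact: vr_nat.
  move=> u; apply: no; exists j; split => //.
  by move/dv_mulr: u => /(_ vO e); rewrite divfK // mul1r.
have [|j [jg jl tje]] := dv_sum_two vO lg et0 tle; first by rewrite sumt.
have Py0p : P (y0 ^+ p) by rewrite (frobB chK); apply: (sfB sP) => //; apply: sfX.
(* Two terms of least value express the value of [y0 ^+ n], with [0 < n < p], by elements of [P].
   Since [y0 ^+ p] lies in [P], so does an element of the value of [y0]. *)
have [k Pk [yk ky]] : exists2 k, P k & y0 %|| k /\ k %|| y0.
  have key a c : (a < c < size g)%N -> e %|| t a -> t a %|| e -> e %|| t c -> t c %|| e ->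
      exists2 k, P k & y0 %|| k /\ k %|| y0.
    move=> /andP [ac cg] h1 h2 h3 h4.
    have ta0 : t a != 0 by apply: dv_neq0 h2 e0.
    have tc0 : t c != 0 by apply: dv_neq0 h4 e0.
    have gc0 : gc`_c != 0 by move: tc0; rewrite mulf_eq0 => /norP [].
    have ya0 : y0 ^+ a != 0 by rewrite expf_neq0.
    have eb : t c = y0 ^+ (c - a) * (gc`_c * y0 ^+ a).
      by rewrite mulrCA -exprD subnK // ltnW.
    have ea : t a = (gc`_a / gc`_c) * (gc`_c * y0 ^+ a) by rewrite /t; field.
    have m0 : gc`_c * y0 ^+ a != 0 by rewrite mulf_neq0.
    apply: (@value_pow y0 (c - a) (gc`_a / gc`_c)) => //.
    - by rewrite subn_gt0 ac /= (leq_ltn_trans (leq_subr _ _)) // (leq_trans cg).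
    - by apply: (sfdiv sP).
    - by apply: (dv_mul2r m0); rewrite -ea -eb; apply: dv_trans h1.
    - by apply: (dv_mul2r m0); rewrite -ea -eb; apply: dv_trans h3.
  have [lt|gt|ejl] := ltngtP j l.
  - by apply: (key j l); rewrite ?lt ?lg //; apply: et0.
  - by apply: (key l j); rewrite ?gt ?jg //; apply: et0.
  - by rewrite ejl eqxx in jl.
have k0 : k != 0 by apply: dv_neq0 ky y00.
pose y := y0 / k; have yO : O y by apply/dvE.
have uy : vunit O y by apply/vunitE; rewrite mulf_neq0 ?invr_eq0 // invf_div; split => //; apply/dvE.
have ey : y0 = k * y by rewrite /y mulrC divfK.
pose q := gc`_l * k ^+ l.
have tkq j' : t j' = gc`_j' * k ^+ j' * y ^+ j' by rewrite /t ey exprMn mulrA.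
have ut n' : vunit O (y ^+ n') by apply: vunitX.
have dv_unit a c : vunit O c -> a * c %|| a.
  by move=> uc; rewrite -[X in _ %|| X]mulr1; apply: dv_mull.
have qe : q %|| e.
  by apply: (dv_trans vO _ tle); rewrite tkq mulrC; apply: dv_Omul; apply: vrX.
have eq_ : e %|| q.
  by apply: (dv_trans vO (et0 l lg)); rewrite tkq; apply: dv_unit.
have q0 : q != 0 by apply: dv_neq0 qe e0.
(* The expansion at [c1], rescaled so that the variable becomes the unit [y] and a dominant
   coefficient becomes 1. Its value at [y] is a nonunit, so by [residue_degree] the residue of [y]
   comes from [P]. *)
pose gg : {poly K} := \poly_(j < size g) (gc`_j * k ^+ j / q).
have gg_ev x : gg.[x] = gc.[k * x] / q.
  rewrite horner_poly horner_coef sgc mulr_suml; apply: eq_bigr => j' _.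
  by rewrite exprMn; ring.
have Agg : polyin (fun x => O x /\ P x) gg.
  move=> j'; rewrite coef_poly; case: ifP => [j'g|_]; last exact: (sr0 sA).
  split; last by apply: (sfdiv sP) => //; apply: sfM => //; apply: sfX.
  apply/dvE => //; apply: (dv_trans vO qe); apply: (dv_trans vO (et0 j' j'g)).
  by rewrite tkq; apply: dv_unit.
have ggy : gg.[y] = g.[b] / q by rewrite gg_ev -ey -(horner_shift g c1).
have nggy : ~ vunit O gg.[y].
  rewrite ggy => u; apply: bad; apply: (dv_trans vO _ qe).
  by move/dv_mulr: u => /(_ vO q); rewrite divfK // mul1r.
have Pyp : P (y ^+ p) by rewrite expr_div_n; apply: (sfdiv sP) => //; apply: sfX.
have sgg : (size gg <= p)%N by apply: leq_trans (size_poly _ _) gp.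
have ul : vunit O gg`_l by rewrite coef_poly lg divff //; apply: vunit1.
have [c2 [Oc2 Pc2] nc2] := residue_degree vO sP chK yO Pyp Agg sgg ul nggy.
pose z := y - c2; pose g2 := gg \Po ('X + c2%:P).
have g2z : g2.[z] = gg.[y] by rewrite horner_shift.
have ugd : vunit O gg^`().[y].
  have -> : gg^`().[y] = g^`().[b] * k / q.
    have -> : gg = (q^-1) *: (gc \Po (k *: 'X)).
      apply/polyP => j'; rewrite coefZ coef_poly.
      have -> : (gc \Po (k *: 'X))`_j' = gc`_j' * k ^+ j'.
        rewrite comp_polyE coef_sum (eq_bigr (fun i : 'I_(size gc) => gc`_i * k ^+ i * (j' == i)%:R)).
          have [lt|ge] := ltnP j' (size gc).
            rewrite (bigD1 (Ordinal lt)) //= eqxx mulr1 big1 ?addr0 // => i ij.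
            by rewrite -val_eqE /= in ij; rewrite eq_sym (negPf ij) mulr0.
          rewrite big1 ?nth_default ?mul0r // => i _.
          by rewrite gtn_eqF ?mulr0 // (leq_trans (ltn_ord i)).
        by move=> i _; rewrite coefZ exprZn coefZ coefXn mulrA.
      case: ltnP => [_|ge]; first by rewrite mulrC.
      by rewrite nth_default ?mul0r ?mulr0 // sgc.
    have hk : (k *: 'X).[y] = y0 by rewrite hornerZ hornerX -ey.
    have -> : g^`().[b] = gc^`().[y0].
      by rewrite /gc deriv_comp derivD derivX derivC addr0 mulr1 horner_shift.
    rewrite derivZ deriv_comp derivZ derivX hornerZ hornerM horner_comp hk hornerZ hornerC.
    by rewrite mulr1 mulrC.
  apply: (dv_mul2r q0); rewrite divfK // mul1r; apply: (dv_trans vO _ eq_).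
  by rewrite /e ey mulrA [_ * y]mulrC; apply: dv_Omul.
have g2'z : g2^`().[z] = gg^`().[y].
  by rewrite /g2 deriv_comp derivD derivX derivC addr0 mulr1 horner_shift.
have Ag2 : polyin (fun x => O x /\ P x) g2 by apply: polyin_shift.
have Oz : O z := nunitO vO nc2.
have Og2 : polyin O g2 by move=> j'; case: (Ag2 j').
have ng20 : ~ vunit O g2`_0.
  have -> : g2`_0 = g2.[z] - (\sum_(1 <= j' < size g2) g2`_j' * z ^+ j'.-1) * z.
    have [s0|s0] := posnP (size g2).
      have -> : g2 = 0 by apply/eqP; rewrite -size_poly_eq0 s0.
      by rewrite size_poly0 big_geq // coef0 horner0 mul0r subr0.
    rewrite horner_coef -(big_mkord xpredT (fun j' => g2`_j' * z ^+ j')) big_ltn //.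
    rewrite expr0 mulr1 mulr_suml -addrA -sumrB big_nat big1 ?addr0 // => j' /andP [j1 _].
    by rewrite -mulrA -exprSr prednK // subrr.
  apply: nunitB => //; first by rewrite g2z.
  by apply: nunitMl => //; apply: vr_sum => // j' _; apply: (vrM vO) => //; apply: vrX.
have ug21 : vunit O g2`_1.
  have -> : g2`_1 = g2^`().[z] - (\sum_(1 <= j' < size g2^`()) g2^`()`_j' * z ^+ j'.-1) * z.
    have [s0|s0] := posnP (size g2^`()).
      have g20 : g2^`() = 0 by apply/eqP; rewrite -size_poly_eq0 s0.
      have /vunitE [/negP] := ugd; rewrite -g2'z g20 horner0 eqxx.
      by case.
    rewrite horner_coef -(big_mkord xpredT (fun j' => g2^`()`_j' * z ^+ j')) big_ltn //.
    rewrite expr0 mulr1 mulr_suml -addrA -sumrB big_nat big1 ?addr0.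
      by rewrite coef_deriv.
    by move=> j' /andP [j1 _]; rewrite -mulrA -exprSr prednK // subrr.
  apply: vunitD => //; first by rewrite g2'z.
  apply: nunitN => //; apply: nunitMl => //; apply: vr_sum => // j' _.
  apply: (vrM vO); last exact: vrX.
  exact: (polyin_deriv (subrg_vring vO) Og2).
have Pzp : P (z ^+ p) by rewrite (frobB chK); apply: (sfB sP) => //; apply: sfX.
(* The remaining distance [k * (z - e1)] is a multiple of [k * g.[b] / q]. As [q] has the value of
   [e], multiplying by the derivative at [b] gives a multiple of [g.[b]]. *)
have [e1 [Oe1 Pe1] he1] := approximate_root vO sP p1 nc2 Pzp Ag2 ng20 ug21.
have ec : b - (c1 + k * (c2 + e1)) = k * (z - e1).
  have -> : b = c1 + y0 by rewrite /y0 addrC subrK.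
  by rewrite ey /z; ring.
exists (c1 + k * (c2 + e1)); first by apply: sfD => //; apply: sfM => //; apply: sfD.
rewrite ec; split.
  rewrite ey; apply: dv_mull => //; apply: (dv_trans vO uy); apply/dv1.
  exact: (vrB vO).
have [r Or er] := he1; rewrite g2z ggy in er; rewrite er.
have -> : g^`().[b] * (k * (r * (g.[b] / q))) = r * (g^`().[b] * k / q) * g.[b] by ring.
apply: dv_Omul; apply: (vrM vO) => //.
apply/dvE => //; apply: (dv_trans vO qe); rewrite /e ey mulrA.
by apply: dv_unit.
Qed.
End Taylor.

(** * Derivations of subfields *)

Section PartialDerivations.
Variable K : fieldType.
Implicit Types (P : K -> Prop) (D : K -> K) (x y s : K) (g h m : {poly K}).

(** A derivation of the subfield [P] into [K], encoded by a function on all of [K] so that extending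
    it to a larger subfield does not change its type. *)
Record pder P D : Prop := PDer {
  pdD : forall x y, P x -> P y -> D (x + y) = D x + D y;
  pdM : forall x y, P x -> P y -> D (x * y) = x * D y + y * D x }.

Definition coefder D g : {poly K} := \poly_(i < size g) D g`_i.

Section Basic.
Variables (P : K -> Prop) (D : K -> K).
Hypothesis sP : subfd P.
Hypothesis dD : pder P D.

Lemma pd0 : D 0 = 0.
Proof. by apply: (addrI (D 0)); rewrite -(pdD dD) ?addr0 //; apply: sf0. Qed.
Lemma pd1 : D 1 = 0.
Proof.
apply: (addrI (D 1)); have := pdM dD (sf1 sP) (sf1 sP).
by rewrite !mul1r addr0 => <-.
Qed.
Lemma pdN x : P x -> D (- x) = - D x.
Proof.
by move=> Px; apply/eqP; rewrite -addr_eq0 -(pdD dD) ?addNr ?pd0 //; apply: sfN.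
Qed.
Lemma pdB x y : P x -> P y -> D (x - y) = D x - D y.
Proof. by move=> Px Py; rewrite (pdD dD) ?pdN //; apply: sfN. Qed.
Lemma pdX x n : P x -> D (x ^+ n) = x ^+ n.-1 * D x *+ n.
Proof.
move=> Px; elim: n => [|n IH]; first by rewrite expr0 pd1 mulr0n.
rewrite exprS (pdM dD) // ?IH; last exact: sfX.
case: n {IH} => [|n]; first by rewrite expr0 !mulr0n mulr0 add0r mulr1n.
by rewrite mulrnAr mulrA -exprS /= -mulrSr.
Qed.
Lemma pdXp p x : p \in [pchar K] -> P x -> D (x ^+ p) = 0.
Proof. by move=> ch Px; rewrite pdX // -mulr_natr (pcharf0 ch) mulr0. Qed.
Lemma pd_sum (I : Type) (r : seq I) (Q : pred I) (f : I -> K) :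
  (forall i, Q i -> P (f i)) -> D (\sum_(i <- r | Q i) f i) = \sum_(i <- r | Q i) D (f i).
Proof.
move=> Pf; elim: r => [|i r IH]; first by rewrite !big_nil pd0.
rewrite !big_cons; case: ifP => Qi //; rewrite (pdD dD) ?IH //; first exact: Pf.
by apply: (sr_sum (subrg_subfd sP)).
Qed.
Lemma coefderE g i : (coefder D g)`_i = D g`_i.
Proof. by rewrite coef_poly; case: ltnP => // ge; rewrite nth_default // pd0. Qed.
Lemma coefderD g h : polyin P g -> polyin P h ->
  coefder D (g + h) = coefder D g + coefder D h.
Proof.
by move=> Pg Ph; apply/polyP => i; rewrite coefD !coefderE coefD (pdD dD).
Qed.
Lemma coefderM g h : polyin P g -> polyin P h ->
  coefder D (g * h) = g * coefder D h + h * coefder D g.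
Proof.
move=> Pg Ph; apply/polyP => i; rewrite coefD !coefderE [h * _]mulrC !coefM pd_sum.
  rewrite -big_split /=; apply: eq_bigr => j _; rewrite (pdM dD) // !coefderE.
  by rewrite [_ * D g`_j]mulrC.
by move=> j _; apply: sfM.
Qed.
Lemma pd_horner g s : polyin P g -> P s -> D g.[s] = (coefder D g).[s] + g^`().[s] * D s.
Proof.
elim/poly_ind: g => [|g c IH] Pg Ps.
  by rewrite horner0 pd0 deriv0 horner0 mul0r addr0 /coefder size_poly0 horner_poly big_ord0.
have Pg' : polyin P g.
  by move=> i; have := Pg i.+1; rewrite coefD coefMX coefC /= addr0.
have Pc : P c by have := Pg 0%N; rewrite coefD coefMX coefC /= add0r.
have PX : polyin P 'X by move=> i; rewrite coefX; apply: (sr_nat (subrg_subfd sP)).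
have Pgs : P g.[s] by apply: (polyin_horner (subrg_subfd sP)).
rewrite coefderD; [|exact: polyinM (subrg_subfd sP) _ _ Pg' PX|exact: polyinC (subrg_subfd sP) _ Pc].
have -> : coefder D c%:P = (D c)%:P.
  by apply/polyP => i; rewrite coefderE !coefC; case: ifP => // _; rewrite pd0.
rewrite coefderM // (_ : coefder D 'X = 0); last first.
  apply/polyP => i; rewrite coefderE coefX coef0; case: eqP => _; [exact: pd1|exact: pd0].
rewrite mulr0 add0r !hornerE derivD derivM derivX derivC addr0 mulr1 !hornerE.
by rewrite (pdD dD) ?(pdM dD) // ?IH //; [ring|apply: sfM].
Qed.
End Basic.

Lemma pder0 P : pder P (fun=> 0).
Proof. by split=> *; rewrite ?mulr0 ?addr0. Qed.
Lemma pder_sub P Q D : (forall x, Q x -> P x) -> pder P D -> pder Q D.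
Proof. by move=> QP [h1 h2]; split=> x y /QP Px /QP Py; [apply: h1|apply: h2]. Qed.

Definition minimal_for P s m := [/\ polyin P m, m.[s] = 0 &
  forall g, polyin P g -> g.[s] = 0 -> exists2 h, polyin P h & g = h * m].

(** The value at [g.[s]] has to be [phi g]. By the Leibniz rule [phi] vanishes on all multiples of
    [m] as soon as it vanishes at [m], so the value is well defined. *)
Lemma der_extend P D s y m : subfd P -> pder P D -> minimal_for P s m ->
  (coefder D m).[s] + m^`().[s] * y = 0 ->
  exists D', [/\ pder (adjoin P s) D', forall x, P x -> D' x = D x & D' s = y].
Proof.
move=> sP dD [Pm ms minm] my; have sR := subrg_subfd sP.
pose phi g := (coefder D g).[s] + g^`().[s] * y.
have phiD g h : polyin P g -> polyin P h -> phi (g + h) = phi g + phi h.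
  by move=> Pg Ph; rewrite /phi (coefderD sP dD) // derivD !hornerD; ring.
have phiM g h : polyin P g -> polyin P h -> phi (g * h) = g.[s] * phi h + h.[s] * phi g.
  move=> Pg Ph; rewrite /phi (coefderM sP dD) // derivM !hornerD !hornerM; ring.
have wd g h : polyin P g -> polyin P h -> g.[s] = h.[s] -> phi g = phi h.
  move=> Pg Ph e; have [||q Pq eq] := minm (g - h).
  - exact: polyinB.
  - by rewrite hornerD hornerN e subrr.
  have -> : g = q * m + h by rewrite -eq subrK.
  rewrite phiD //; last exact: polyinM.
  by rewrite phiM // ms [phi m]my !(mulr0, mul0r) !add0r.
have ex x : exists z, forall g, polyin P g -> x = g.[s] -> z = phi g.
  have [[g Pg eg]|no] := pselect (adjoin P s x).
    by exists (phi g) => h Ph eh; apply: wd => //; rewrite -eg -eh.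
  by exists 0 => g Pg eg; case: no; exists g.
have [D' hD'] := choice ex; exists D'; split.
- split=> _ _ [g Pg ->] [h Ph ->].
    rewrite (hD' _ (g + h)); [|exact: polyinD|by rewrite hornerD].
    by rewrite phiD // (hD' _ g Pg erefl) (hD' _ h Ph erefl).
  rewrite (hD' _ (g * h)); [|exact: polyinM|by rewrite hornerM].
  by rewrite phiM // (hD' _ g Pg erefl) (hD' _ h Ph erefl).
- move=> x Px; have PC := polyinC sR Px; rewrite (hD' _ x%:P) ?hornerC //.
  rewrite /phi derivC horner0 mul0r addr0 horner_coef.
  rewrite (_ : coefder D x%:P = (D x)%:P); last first.
    by apply/polyP => i; rewrite (coefderE sP dD) !coefC; case: ifP => // _; rewrite (pd0 sP dD).
  by rewrite -horner_coef hornerC.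
- have PX : polyin P 'X by move=> i; rewrite coefX; apply: (sr_nat sR).
  rewrite (hD' _ 'X) ?hornerX // /phi derivX hornerC mul1r.
  rewrite (_ : coefder D 'X = 0) ?horner0 ?add0r //.
  apply/polyP => i; rewrite (coefderE sP dD) coefX coef0; case: eqP => _; [exact: pd1 sP dD|exact: pd0 sP dD].
Qed.

Lemma polyin_lift P (sP : subfd P) g : polyin P g ->
  exists g' : {poly sftype sP}, map_poly (sfemb sP) g' = g.
Proof.
move=> Pg; have [c hc] := choice (fun i => sfemb_ex sP (Pg i)).
exists (\poly_(i < size g) c i); apply/polyP => i; rewrite coef_map coef_poly.
by case: ltnP => ge; [exact: hc|rewrite nth_default // rmorph0].
Qed.
Lemma polyin_map P (sP : subfd P) (g : {poly sftype sP}) : polyin P (map_poly (sfemb sP) g).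
Proof. by move=> i; rewrite coef_map; apply: sfembP. Qed.

Lemma alg_minimal P s g : subfd P -> polyin P g -> g != 0 -> g.[s] = 0 ->
  subfd (adjoin P s) /\ exists m, minimal_for P s m.
Proof.
move=> sP Pg g0 gs; have [g' eg] := polyin_lift sP Pg.
have [||m [irr ms _]] := @minimal_poly _ _ (sfemb sP) s g'.
- by rewrite -(map_poly_eq0 (sfemb sP)) eg.
- by rewrite eg /root gs.
have sR := subrg_adjoin (subrg_subfd sP) s; split.
  split; [exact: sr1 sR|exact: srB sR|move=> x _ hx [h Ph ->]; apply: (srM sR) => //].
  have [e|n0] := eqVneq h.[s] 0; first by rewrite e invr0; apply: sr0 sR.
  have [h' eh] := polyin_lift sP Ph; have [|q eq] := @irreducible_inv _ _ (sfemb sP) s m h' irr ms.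
    by rewrite eh.
  by exists (map_poly (sfemb sP) q); [exact: polyin_map|rewrite eq eh].
exists (map_poly (sfemb sP) m); split; [exact: polyin_map|exact/eqP|].
move=> h Ph hs; have [h' eh] := polyin_lift sP Ph.
have mh : m %| h' by rewrite -(irreducible_root h' irr ms) eh /root hs.
exists (map_poly (sfemb sP) (h' %/ m)); first exact: polyin_map.
by rewrite -rmorphM divpK // eh.
Qed.

Lemma vring_True : vring (fun _ : K => True).
Proof. by split => //; left. Qed.

(** For the trivial valuation ring, whose only nonunit is 0, [residue_degree] says that a purely
    inseparable element has degree 1 or [p]. *)
Lemma insep_degree P p s g : subfd P -> p \in [pchar K] -> P (s ^+ p) -> ~ P s ->
  polyin P g -> (size g <= p)%N -> g.[s] = 0 -> g = 0.
Proof.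
move=> sP ch Psp nPs Pg sg gs; apply/eqP/negPn/negP => g0; apply: nPs.
have unit1 (x : K) : vunit (fun=> True) x <-> x != 0.
  by split=> [/vunitE []|x0] //; apply/vunitE.
have [|||c [_ Pc]] := @residue_degree _ _ _ vring_True sP p ch s I Psp g (size g).-1 _ sg.
- by move=> i; split.
- by apply/unit1; rewrite -[g`_ _]/(lead_coef g) lead_coef_eq0.
- by rewrite gs => /unit1; rewrite eqxx.
move=> nu; suff -> : s = c by [].
by apply/eqP; rewrite -subr_eq0; apply/negPn/negP => /unit1.
Qed.

Lemma insep_minimal P p s : subfd P -> p \in [pchar K] -> P (s ^+ p) -> ~ P s ->
  minimal_for P s ('X^p - (s ^+ p)%:P).
Proof.
move=> sP ch Psp nPs; have sR := subrg_subfd sP; have p0 := prime_gt0 (pcharf_prime ch).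
have Pm : polyin P ('X^p - (s ^+ p)%:P).
  by apply: polyinB => //; [apply: polyinXn|apply: polyinC].
split => //; first by rewrite !hornerE subrr.
move=> g Pg gs.
have [q [r [Pq Pr e sr]]] := polyin_edivp sR (monicXnsubC _ p0) Pm Pg.
exists q => //; rewrite e (insep_degree sP ch Psp nPs Pr) ?addr0 //.
  by rewrite size_XnsubC // ltnS in sr.
by move: gs; rewrite e hornerD hornerM !hornerE subrr mulr0 add0r.
Qed.

Lemma insep_adjoin P p s : subfd P -> p \in [pchar K] -> P (s ^+ p) -> subfd (adjoin P s).
Proof.
move=> sP ch Psp; have sR := subrg_subfd sP; have p0 := prime_gt0 (pcharf_prime ch).
have [|||//] := @alg_minimal P s ('X^p - (s ^+ p)%:P) sP.
- by apply: polyinB => //; [apply: polyinXn|apply: polyinC].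
- by rewrite -size_poly_gt0 size_XnsubC.
- by rewrite !hornerE subrr.
Qed.

(** The minimal polynomial of [s] has derivative 0 and, as [D] kills its coefficients, puts no
    condition on the value at [s]. *)
Lemma ext_insep P D p s y : subfd P -> p \in [pchar K] -> pder P D ->
  P (s ^+ p) -> ~ P s -> D (s ^+ p) = 0 ->
  exists D', [/\ pder (adjoin P s) D', forall x, P x -> D' x = D x & D' s = y].
Proof.
move=> sP ch dD Psp nPs Ds; have sR := subrg_subfd sP.
apply: (der_extend sP dD (insep_minimal sP ch Psp nPs)).
rewrite derivB derivXn derivC subr0 -mulr_natr -polyC_natr (pcharf0 ch) polyC0 mulr0.
rewrite horner0 mul0r addr0 (_ : coefder D _ = 0) ?horner0 //.
apply/polyP => i; rewrite (coefderE sP dD) coefB coefXn coefC coef0.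
have Pn : P (i == p)%:R by apply: (sr_nat sR).
have Pc : P (if i == 0%N then s ^+ p else 0) by case: ifP => // _; apply: (sf0 sP).
rewrite (pdB sP dD) //; case: eqP => _; case: eqP => _;
  by rewrite ?Ds ?(pd0 sP dD) ?(pd1 sP dD) subr0.
Qed.

Lemma ext_sep P D s f : subfd P -> pder P D -> polyin P f -> f.[s] = 0 -> f^`().[s] != 0 ->
  exists D', pder (adjoin P s) D' /\ forall x, P x -> D' x = D x.
Proof.
move=> sP dD Pf fs fs'.
have f0 : f != 0 by apply: contraNneq fs' => ->; rewrite deriv0 horner0.
have [_ [m mm]] := alg_minimal sP Pf f0 fs; have [Pm ms minm] := mm.
have [h Ph eh] := minm f Pf fs.
have m0 : m^`().[s] != 0.
  apply: contraNneq fs' => e; rewrite eh derivM hornerD !hornerM ms e.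
  by rewrite !mulr0 addr0.
have [|D' [dD' hD' _]] := @der_extend P D s (- (coefder D m).[s] / m^`().[s]) m sP dD mm.
  by rewrite mulrC divfK // subrr.
by exists D'.
Qed.

End PartialDerivations.

(** * Derivations that respect the values of given elements *)

Section GoodDerivations.
Variables (K : fieldType) (O : K -> Prop).
Hypothesis vO : vring O.
Variable p : nat.
Hypothesis chK : p \in [pchar K].
Local Notation "x %|| y" := (dv O x y) (at level 70).
Let p1 := prime_gt0 (pcharf_prime chK).

Lemma insep_reduce (P : K -> Prop) b x : subfd P -> P (b ^+ p) -> adjoin P b x ->
  exists f : {poly K}, [/\ polyin P f, (size f <= p)%N & x = f.[b]].
Proof.
move=> sP Pbp [g Pg ->]; have sR := subrg_subfd sP.
have [|q [r [Pq Pr e sr]]] := polyin_edivp sR (monicXnsubC (b ^+ p) p1) _ Pg.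
  by apply: polyinB => //; [apply: polyinXn|apply: polyinC].
exists r; split => //; first by rewrite size_XnsubC // ltnS in sr.
by rewrite e hornerD hornerM !hornerE subrr mulr0 add0r.
Qed.

(** Since [taylor_terms] allows every centre that is close enough, the closest of finitely many
    centres serves all polynomials. *)
Lemma taylor_seq (P : K -> Prop) b (fs : seq {poly K}) : subfd P -> P (b ^+ p) ->
  (forall f, f \in fs -> polyin P f /\ (size f <= p)%N) ->
  exists2 c, P c & forall f, f \in fs -> forall l,
    f.[b] %|| (f \Po ('X + c%:P))`_l * (b - c) ^+ l.
Proof.
move=> sP Pbp hfs.
suff [c0 Pc0 hc0] : exists2 c0, P c0 & forall c, P c -> b - c0 %|| b - c ->
    forall f, f \in fs -> forall l, f.[b] %|| (f \Po ('X + c%:P))`_l * (b - c) ^+ l.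
  by exists c0 => //; apply: hc0 => //; apply: dvxx.
elim: fs hfs => [|f fs IH] hfs; first by exists 0 => //; apply: sf0.
have [|c1 Pc1 h1] := IH; first by move=> g gs; apply: hfs; rewrite inE gs orbT.
have [Pf sf] := hfs f (mem_head _ _); have [c2 Pc2 h2] := taylor_terms vO sP chK Pbp Pf sf.
have [h|h] := dv_total vO (b - c1) (b - c2); [exists c2|exists c1] => // c Pc bc g;
  rewrite inE => /predU1P [->|gs] l; [exact: h2| |exact: h2 (dv_trans vO h bc) _|exact: h1].
by apply: h1 => //; apply: dv_trans bc.
Qed.

Lemma adjoin_shift (P : K -> Prop) b c x : subfd P -> P c ->
  adjoin P b x -> adjoin P (b - c) x.
Proof.
move=> sP Pc [g Pg ->]; exists (g \Po ('X + c%:P)); last by rewrite horner_shift.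
exact: polyin_shift (subrg_subfd sP) _ _ Pg Pc.
Qed.

Lemma adjoin_mem (P : K -> Prop) b x : subfd P -> P b -> adjoin P b x -> P x.
Proof. by move=> sP Pb [g Pg ->]; apply: (polyin_horner (subrg_subfd sP)). Qed.

Section Step.
Variables (P : K -> Prop) (b : K).
Hypothesis sP : subfd P.
Hypothesis Pbp : P (b ^+ p).
Hypothesis nPb : ~ P b.
Let sR := subrg_subfd sP.

Let der_at D c y : P c -> pder P D -> D (b ^+ p) = 0 ->
  exists D', [/\ pder (adjoin P b) D', forall x, P x -> D' x = D x &
    forall f, polyin P f -> D' f.[b] = (coefder D (f \Po ('X + c%:P))).[b - c] + f^`().[b] * y].
Proof.
move=> Pc dD Db.
have [|||D' [dD' eD' Du]] := @ext_insep K P D p (b - c) y sP chK dD.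
- by rewrite (frobB chK); apply: (sfB sP) => //; apply: sfX.
- by move=> h; apply: nPb; rewrite -[b](subrK c); apply: sfD.
- rewrite (frobB chK) (pdB sP dD) //; last exact: sfX.
  by rewrite Db (pdXp sP dD chK Pc) subrr.
exists D'; split => //.
  by apply: pder_sub dD' => x; apply: adjoin_shift.
move=> f Pf; have Pf' := polyin_shift sR Pf Pc.
have sA' : subfd (adjoin P (b - c)).
  by apply: (insep_adjoin sP chK); rewrite (frobB chK); apply: (sfB sP) => //; apply: sfX.
have Pa : forall x, P x -> adjoin P (b - c) x by move=> x; apply: adjoin_sub.
rewrite -[in LHS](horner_shift f c) (pd_horner sA' dD'); first last.
- exact: adjoin_gen.
- by move=> i; apply: Pa.
rewrite Du deriv_comp derivD derivX derivC addr0 mulr1 horner_shift.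
congr (_.[_] + _); apply/polyP => i.
rewrite (coefderE sA' dD') (coefderE sP dD); exact: eD'.
Qed.

(* Extend [D] by [0] on a generator [b - c] adapted to the elements of [Y]. *)
Lemma good_extend (Y : seq K) : (forall y, y \in Y -> adjoin P b y) ->
  exists2 Y0 : seq K, forall y, y \in Y0 -> P y &
  forall D, pder P D -> D (b ^+ p) = 0 -> (forall y, y \in Y0 -> y %|| D y) ->
  exists D', [/\ pder (adjoin P b) D', forall x, P x -> D' x = D x &
    forall y, y \in Y -> y %|| D' y].
Proof.
move=> hY.
have /choice [f hf] : forall y, exists f : {poly K}, y \in Y ->
    [/\ polyin P f, (size f <= p)%N & y = f.[b]].
  move=> y; have [yY|] := boolP (y \in Y); last by exists 0.
  by have [f hf] := insep_reduce sP Pbp (hY y yY); exists f.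
have [|c Pc hc] := @taylor_seq P b (map f Y) sP Pbp.
  by move=> _ /mapP [y yY ->]; have [] := hf y yY.
pose ft y := f y \Po ('X + c%:P).
(* [Y0] consists of the Taylor coefficients of the elements of [Y]. If each divides its derivative,
   the derivative of [y] is a sum of multiples of Taylor terms, and [y] divides these by the choice
   of [c]. *)
exists (flatten [seq [seq (ft y)`_l | l <- iota 0 p] | y <- Y]).
  move=> x /flattenP [s /mapP [y yY ->] /mapP [l _ ->]].
  by have [Pf _ _] := hf y yY; apply: polyin_shift.
move=> D dD Db good; have [D' [dD' eD' hD']] := der_at 0 Pc dD Db.
exists D'; split => // y yY; have [Pf sf ey] := hf y yY.
rewrite {2}ey hD' // mulr0 addr0 horner_coef; apply: dv_sum => // l _.
rewrite (coefderE sP dD) -/(ft y).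
have [lp|pl] := ltnP l p; last first.
  rewrite nth_default ?(pd0 sP dD) ?mul0r; first exact: dvx0.
  by rewrite size_shift (leq_trans sf).
have [|r Or ->] := good (ft y)`_l.
  apply/flattenP; exists [seq (ft y)`_l | l <- iota 0 p]; first by apply/mapP; exists y.
  by apply/mapP; exists (nat_of_ord l); rewrite ?mem_iota.
by rewrite -mulrA; apply: dv_mulO => //; rewrite {1}ey; apply: hc; apply: map_f.
Qed.

(* The logarithmic derivation [u d/du] with [u = b - c] for a good centre [c]. *)
Lemma good_log (Y : seq K) e t : (forall y, y \in Y -> adjoin P b y) -> adjoin P b e ->
  (forall c, P c -> ~ t %|| e - c) ->
  exists D, [/\ pder (adjoin P b) D, forall x, P x -> D x = 0,
    forall y, y \in Y -> y %|| D y & ~ t %|| D e].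
Proof.
move=> hY he ne.
have /choice [f hf] : forall y, exists f : {poly K}, y \in Y ->
    [/\ polyin P f, (size f <= p)%N & y = f.[b]].
  move=> y; have [yY|] := boolP (y \in Y); last by exists 0.
  by have [f hf] := insep_reduce sP Pbp (hY y yY); exists f.
have [g [Pg sg eg]] := insep_reduce sP Pbp he.
have Pg' := polyin_deriv sR Pg.
have sg' : (size g^`() <= p)%N.
  apply: leq_trans sg; have [->|g0] := eqVneq g 0; first by rewrite deriv0 size_poly0.
  exact/ltnW/lt_size_deriv.
(* The derivative of [g] joins the list because [D e] is its value at [b] times [b - c]. If [t]
   divided [D e], it would divide every term of [e] of positive degree, and [e] would lie within [t]
   of an element of [P]. *)
have [|c Pc hc] := @taylor_seq P b (g^`() :: map f Y) sP Pbp.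
  by move=> h; rewrite inE => /predU1P [->|/mapP [y yY ->]] //; have [] := hf y yY.
have [D [dD eD hD]] := der_at (b - c) Pc (pder0 P) erefl.
have c0 (h : {poly K}) : coefder (fun=> 0 : K) h = 0.
  by apply/polyP => i; rewrite coef_poly coef0; case: ifP.
have shD (h : {poly K}) : (h \Po ('X + c%:P))^`() = h^`() \Po ('X + c%:P).
  by rewrite deriv_comp derivD derivX derivC addr0 mulr1.
exists D; split => //.
- move=> y yY; have [Pf sf ey] := hf y yY.
  rewrite {2}ey hD // c0 horner0 add0r -(horner_shift (f y)^`() c) -shD horner_coef mulr_suml.
  apply: dv_sum => // l _; rewrite coef_deriv -mulrA -exprSr mulrnAl -mulr_natl.
  apply: dv_mulO => //; first exact: vr_nat.
  by rewrite {1}ey; apply: hc; rewrite inE map_f ?orbT.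
rewrite eg hD // c0 horner0 add0r => td.
pose gc := g \Po ('X + c%:P).
have term l : (0 < l < p)%N -> t %|| gc`_l * (b - c) ^+ l.
  move=> /andP [l0 lp].
  have h : t %|| gc`_l *+ l * (b - c) ^+ l.
    apply: (dv_trans vO td); rewrite -[X in _ ^+ X](prednK l0) exprSr mulrA; apply: dv_mulr => //.
    have := hc _ (mem_head _ _) l.-1; rewrite -shD coef_deriv prednK //.
  have /vunitE [ln0 Ol] : vunit O l%:R by apply: (vunit_natr vO chK); rewrite l0 lp.
  have -> : gc`_l * (b - c) ^+ l = l%:R^-1 * (gc`_l *+ l * (b - c) ^+ l).
    by rewrite -mulr_natr; field.
  exact: dv_mulO.
apply: (ne gc`_0); first exact: polyin_shift.
rewrite eg -(horner_shift g c) (@horner_coef_wide _ p); last by rewrite size_shift.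
rewrite -(big_mkord xpredT (fun l => gc`_l * (b - c) ^+ l)) big_ltn // expr0 mulr1.
rewrite addrAC subrr add0r big_nat; apply: dv_sum => // l ll; exact: term.
Qed.
End Step.

Variable K0 : K -> Prop.
Hypothesis sK0 : subfd K0.

Fixpoint tower (bs : seq K) : K -> Prop :=
  if bs is b :: bs' then adjoin (tower bs') b else K0.

Lemma tower_subfd bs : (forall b, b \in bs -> K0 (b ^+ p)) ->
  subfd (tower bs) /\ forall x, K0 x -> tower bs x.
Proof.
elim: bs => [|b bs IH] hb; first by split.
have [|sT K0T] := IH; first by move=> c cs; apply: hb; rewrite inE cs orbT.
split; first by apply: (insep_adjoin sT chK); apply: K0T; apply: hb; rewrite mem_head.
by move=> x K0x; apply: adjoin_sub (subrg_subfd sT) _ _ (K0T x K0x).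
Qed.
Lemma tower_gen bs b : (forall b, b \in bs -> K0 (b ^+ p)) -> b \in bs -> tower bs b.
Proof.
elim: bs => // c bs IH hb; have hb' x : x \in bs -> K0 (x ^+ p) by move=> xs; apply: hb; rewrite inE xs orbT.
have [sT _] := tower_subfd hb'; rewrite inE => /predU1P [->|bb].
  exact: adjoin_gen (subrg_subfd sT) _.
by apply: adjoin_sub (subrg_subfd sT) _ _ _; apply: IH.
Qed.

(** At each storey there are two main cases. If [a] is not within [t] of the field below, [good_log]
    gives a derivation vanishing on that field. Otherwise [a = e + t * y]: a derivation found for
    [e] extends with [D' y] divisible by [y], and [t * D' y] cannot compensate [D e]. *)
Lemma good_tower bs : (forall b, b \in bs -> K0 (b ^+ p)) ->
  forall (Y : seq K) a t, (forall y, y \in Y -> tower bs y) -> tower bs a -> t != 0 -> K0 t ->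
  (forall c, K0 c -> ~ t %|| a - c) ->
  exists D, [/\ pder (tower bs) D, forall x, K0 x -> D x = 0,
    forall y, y \in Y -> y %|| D y & ~ t %|| D a].
Proof.
elim: bs => [|b bs IH] hb Y a t hY ha t0 K0t na.
  by case: (na a ha); rewrite subrr; apply: dvx0.
have hb' x : x \in bs -> K0 (x ^+ p) by move=> xs; apply: hb; rewrite inE xs orbT.
have [sT K0T] := tower_subfd hb'; have [sT' K0T'] := tower_subfd hb.
have Tbp : tower bs (b ^+ p) by apply: K0T; apply: hb; rewrite mem_head.
have [Tb|nTb] := pselect (tower bs b).
  have Tsub x : tower (b :: bs) x -> tower bs x by apply: adjoin_mem.
  have hYT y : y \in Y -> tower bs y by move=> /hY /Tsub.
  have [D [dD D0 gD nD]] := IH hb' Y a t hYT (Tsub _ ha) t0 K0t na.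
  by exists D; split => //; apply: pder_sub dD.
have [[e Te tae]|no] := pselect (exists2 e, tower bs e & t %|| a - e); last first.
  have [|D [dD D0 gD nD]] := good_log sT Tbp nTb hY ha (t := t).
    by move=> c Tc tc; apply: no; exists c.
  by exists D; split => // x K0x; apply: D0; apply: K0T.
pose y := (a - e) / t; have Oy : O y by apply/dvE.
have Tsub x : tower bs x -> tower (b :: bs) x by apply: adjoin_sub (subrg_subfd sT) _ _.
have Ty : tower (b :: bs) y.
  by apply: (sfdiv sT'); [apply: (sfB sT') => //; apply: Tsub|apply: K0T'].
have [|Y0 hY0 ext] := good_extend sT Tbp nTb (Y := y :: Y).
  by move=> z; rewrite inE => /predU1P [->|/hY].
have [|D [dD D0 gD nD]] := IH hb' Y0 e t hY0 Te t0 K0t.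
  move=> c K0c tc; apply: (na c K0c); have -> : a - c = (a - e) + (e - c) by ring.
  exact: dvD.
have Dbp : D (b ^+ p) = 0 by apply: D0; apply: hb; rewrite mem_head.
have [D' [dD' eD' gD']] := ext D dD Dbp gD.
exists D'; split => //.
- by move=> x K0x; rewrite eD' ?D0 //; apply: K0T.
- by move=> z zY; apply: gD'; rewrite inE zY orbT.
have ea : a = e + t * y by rewrite /y mulrC divfK // addrC subrK.
have K0't := K0T' t K0t.
rewrite ea (pdD dD' (Tsub _ Te) (sfM sT' K0't Ty)) (pdM dD' K0't Ty) (eD' e Te).
rewrite (eD' t (K0T t K0t)) (D0 t K0t) mulr0 addr0.
move=> h; apply: nD.
have ty : t %|| t * D' y.
  rewrite mulrC; apply: dv_Omul.
  have [|r Or ->] := gD' y; first by rewrite mem_head.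
  exact: (vrM vO).
by have := dvB vO h ty; rewrite addrK.
Qed.

Variable F1 : K -> Prop.
Hypothesis F1p : forall s, F1 s -> K0 (s ^+ p).
Hypothesis sepF1 : forall s, exists f : {poly K}, [/\ polyin F1 f, f.[s] = 0 & f^`().[s] != 0].

(** Zorn's lemma on graphs. A maximal extension contains [F1], since it could be extended by 0 on
    any missing element, and then everything, since each element is a simple root of a polynomial
    over [F1]. *)
Lemma der_total (P : K -> Prop) D : subfd P -> (forall x, K0 x -> P x) ->
  pder P D -> (forall x, K0 x -> D x = 0) ->
  exists D', pder (fun=> True) D' /\ forall x, P x -> D' x = D x.
Proof.
move=> sP K0P dD D0.
pose graph (Q : K -> Prop) (E : K -> K) := fun xy : K * K => Q xy.1 /\ xy.2 = E xy.1.
pose ok Q E := [/\ subfd Q, pder Q E, forall x, K0 x -> Q x & forall x, K0 x -> E x = 0].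
pose Phi (Ga : K * K -> Prop) := exists Q E, ok Q E /\ Ga = graph Q E.
have [|C [Ga1 CGa1] CP tot|Ga [[Q [E [[sQ dE K0Q E0] ->]]] sub maxG]] := @zorn_set _ Phi (graph P D).
- by exists P, D.
- pose U := fun xy : K * K => exists Ga, C Ga /\ Ga xy.
  have fn x y y' : U (x, y) -> U (x, y') -> y = y'.
    have key Ga Ga' : C Ga' -> (forall xy, Ga xy -> Ga' xy) -> Ga (x, y) -> Ga' (x, y') -> y = y'.
      move=> CGa' s /s; have [Q [E [_ ->]]] := CP _ CGa'.
      by move=> [_ /= ->] [_ /= ->].
    move=> [Ga [CGa h]] [Ga' [CGa' h']]; have [s|s] := tot Ga Ga' CGa CGa'.
      exact: (key Ga Ga').
    apply: esym; have [Q [E [_ eG]]] := CP _ CGa; move: (s _ h') h; rewrite eG.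
    by move=> [_ /= ->] [_ /= ->].
  pose Q x := exists y, U (x, y).
  have /choice [E hE] : forall x, exists y, Q x -> U (x, y).
    move=> x; have [[y hy]|no] := pselect (Q x); first by exists y.
    by exists 0.
  have common x x' : Q x -> Q x' -> exists Q1 E1, [/\ ok Q1 E1, C (graph Q1 E1), Q1 x & Q1 x'].
    move=> [y [Ga [CGa h]]] [y' [Ga' [CGa' h']]].
    have [Q1 [E1 [ok1 eG1]]] := CP _ CGa; have [Q2 [E2 [ok2 eG2]]] := CP _ CGa'.
    have [s|s] := tot _ _ CGa CGa'.
      exists Q2, E2; rewrite -eG2; split => //; last by move: h'; rewrite eG2 => -[].
      by have := s _ h; rewrite eG2 => -[].
    exists Q1, E1; rewrite -eG1; split => //; first by move: h; rewrite eG1 => -[].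
    by have := s _ h'; rewrite eG1 => -[].
  have inU Q1 E1 x : C (graph Q1 E1) -> Q1 x -> Q x /\ E x = E1 x.
    move=> CG Q1x; have h : U (x, E1 x) by exists (graph Q1 E1).
    have Qx : Q x by exists (E1 x).
    by split => //; apply: (@fn x) => //; apply: hE.
  exists Q, E; split; last first.
    apply/funext => -[x y]; apply/propext; split=> [h|[/= Qx ->]]; last exact: hE.
    have Qx : Q x by exists y.
    by split => //=; apply: (fn x) => //; apply: hE.
  have [Q1 [E1 [[sQ1 dE1 K0Q1 E10] eG1]]] := CP _ CGa1; rewrite eG1 in CGa1.
  split.
  + split; first by have [] := inU _ _ 1 CGa1 (sf1 sQ1).
      move=> x y Qx Qy; have [Q2 [E2 [[sQ2 _ _ _] CG2 Q2x Q2y]]] := common x y Qx Qy.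
      by have [] := inU _ _ (x - y) CG2 (sfB sQ2 Q2x Q2y).
    move=> x y Qx Qy; have [Q2 [E2 [[sQ2 _ _ _] CG2 Q2x Q2y]]] := common x y Qx Qy.
    by have [] := inU _ _ (x / y) CG2 (sfdiv sQ2 Q2x Q2y).
  + split=> x y Qx Qy; have [Q2 [E2 [[sQ2 dE2 _ _] CG2 Q2x Q2y]]] := common x y Qx Qy.
      have [_ ->] := inU _ _ (x + y) CG2 (sfD sQ2 Q2x Q2y).
      have [_ ->] := inU _ _ x CG2 Q2x; have [_ ->] := inU _ _ y CG2 Q2y.
      exact: (pdD dE2).
    have [_ ->] := inU _ _ (x * y) CG2 (sfM sQ2 Q2x Q2y).
    have [_ ->] := inU _ _ x CG2 Q2x; have [_ ->] := inU _ _ y CG2 Q2y.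
    exact: (pdM dE2).
  + by move=> x /K0Q1 Q1x; have [] := inU _ _ x CGa1 Q1x.
  + by move=> x K0x; have [_ ->] := inU _ _ x CGa1 (K0Q1 x K0x); apply: E10.
have max1 s E' : pder (adjoin Q s) E' -> subfd (adjoin Q s) -> (forall x, Q x -> E' x = E x) -> Q s.
  move=> dE' sQ' eE'; have sR := subrg_subfd sQ.
  have [|||//] := maxG (graph (adjoin Q s) E') _ _ (s, E' s).
  - exists (adjoin Q s), E'; split => //; split => //.
      by move=> x K0x; apply: adjoin_sub => //; apply: K0Q.
    by move=> x K0x; rewrite eE' ?E0 //; apply: K0Q.
  - move=> [x y] [/= Qx ->]; split => /=; first exact: adjoin_sub.
    by rewrite eE'.
  - by split => //=; apply: adjoin_gen.
have QF1 s : F1 s -> Q s.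
  move=> F1s; apply: contrapT => nQ; have K0s := F1p F1s.
  have [E' [dE' eE' _]] := ext_insep 0 sQ chK dE (K0Q _ K0s) nQ (E0 _ K0s).
  by apply: nQ; apply: (max1 s E') => //; apply: (insep_adjoin sQ chK); apply: K0Q.
have Qall s : Q s.
  have [f [F1f fs fs']] := sepF1 s; have Qf : polyin Q f by move=> j; apply: QF1.
  have f0 : f != 0 by apply: contraNneq fs' => ->; rewrite deriv0 horner0.
  have [E' [dE' eE']] := ext_sep sQ dE Qf fs fs'.
  by apply: (max1 s E') => //; have [] := alg_minimal sQ Qf f0 fs.
exists E; split; first by apply: pder_sub dE.
by move=> x Px; have [_] := sub (x, D x) (conj Px erefl).
Qed.
End GoodDerivations.

(** * A module detecting differentials through a family of derivations *)

Section KaehlerTarget.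
Local Open Scope quotient_scope.
Variables (F S : fieldType) (j : {rmorphism F -> S}) (OF : F -> Prop) (OS : S -> Prop).
Hypothesis vO : vring OS.
Variables (T : Type) (der : T -> S -> S).
Hypothesis derD : forall d x y, der d (x + y) = der d x + der d y.
Hypothesis derM : forall d x y, der d (x * y) = x * der d y + y * der d x.

Let V : zmodType := (T -> S : Type).
(** [V] consists of the functions on the index set of the derivations, and [b] is sent to its values
    under all of them. Modulo this span the map becomes a derivation over [OF]; its vanishing at [b]
    writes all [der d b] with one common list of coefficients. *)
Definition kspan (f : V) := exists2 s : seq (S * F),
  (forall q, q \in s -> OS q.1 /\ OF q.2) &
  forall d, f d = \sum_(q <- s) q.1 * der d (j q.2).
Definition kspanb : V -> bool := fun f => `[< kspan f >].
Fact kspan_closed : zmod_closed kspanb.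
Proof.
split; first by apply/asboolP; exists [::] => // d; rewrite big_nil.
move=> f g /asboolP [s hs ef] /asboolP [r hr eg]; apply/asboolP.
exists (s ++ [seq (- q.1, q.2) | q <- r]).
  move=> q; rewrite mem_cat => /orP [/hs //|/mapP [q' /hr [O1 O2] ->]].
  by split => //; apply: vrN.
move=> d; rewrite big_cat big_map /= -[(f - g) d]/(f d - g d) ef eg; congr (_ + _).
by rewrite -sumrN; apply: eq_bigr => q _; rewrite mulNr.
Qed.
Definition kspanI : zmodClosed V :=
  HB.pack_for (zmodClosed V) kspanb (GRing.isZmodClosed.Build V kspanb kspan_closed).

Local Notation ktarget := (Quotient.quot kspanI).
Local Notation repr := generic_quotient.repr.
Let scale (a : S) (f : V) : V := fun d => a * f d.
(** Defined on representatives; compatible with the quotient for [a] in [OS], which is where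
    [is_Omodule] asks for it. *)
Definition kact (a : S) (m : ktarget) : ktarget := \pi_ktarget (scale a (repr m)).
Definition kd (b : S) : ktarget := \pi_ktarget ((fun d => der d b) : V).

Let pi_eq (f g : V) : \pi_ktarget f = \pi_ktarget g <-> kspan (f - g).
Proof.
split=> [/eqP|h]; first by rewrite -Quotient.idealrBE => /asboolP.
by apply/eqP; rewrite -Quotient.idealrBE; apply/asboolP.
Qed.
Let kspan_scale a f : OS a -> kspan f -> kspan (scale a f).
Proof.
move=> Oa [s hs ef]; exists [seq (a * q.1, q.2) | q <- s].
  by move=> q /mapP [q' /hs [O1 O2] ->]; split => //; apply: (vrM vO).
move=> d; rewrite big_map /scale ef mulr_sumr; apply: eq_bigr => q _.
by rewrite mulrA.
Qed.
Let kactE a f : OS a -> kact a (\pi f) = \pi_ktarget (scale a f).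
Proof.
move=> Oa; apply/pi_eq.
have -> : scale a (repr (\pi_ktarget f)) - scale a f = scale a (repr (\pi_ktarget f) - f).
  by apply/funext => d; rewrite /scale -[LHS]/(_ - _) -mulrBr.
by apply: kspan_scale => //; apply/pi_eq; rewrite reprK.
Qed.
Let piD (f g : V) : \pi_ktarget (f + g) = \pi f + \pi g.
Proof. exact: Quotient.pi_add. Qed.

Let pi0 : \pi_ktarget (0 : V) = 0.
Proof. by apply: (addrI (\pi_ktarget (0 : V))); rewrite addr0 -piD addr0. Qed.
Definition kmodule : zmodType := ktarget.

Lemma kact_module a b : OS a -> OS b -> forall m n : ktarget,
  [/\ kact a (m + n) = kact a m + kact a n, kact (a + b) m = kact a m + kact b m,
      kact (a * b) m = kact a (kact b m) & kact 1 m = m].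
Proof.
move=> Oa Ob m n; rewrite -[m]reprK -[n]reprK.
have Oab := vrD vO Oa Ob; have Oab' := vrM vO Oa Ob; have O1 := vr1 vO.
rewrite -piD !kactE //; split.
- by rewrite -piD; congr (\pi _); apply/funext => d; rewrite /scale -[LHS]/(_ * (_ + _)) mulrDr.
- by rewrite -piD; congr (\pi _); apply/funext => d; rewrite /scale -[RHS]/(_ + _) mulrDl.
- by congr (\pi _); apply/funext => d; rewrite /scale mulrA.
- by congr (\pi _); apply/funext => d; rewrite /scale mul1r.
Qed.
Lemma kd_add a b : kd (a + b) = kd a + kd b.
Proof. by rewrite /kd -piD; congr (\pi _); apply/funext => d; rewrite derD. Qed.
Lemma kd_mul a b : OS a -> OS b -> kd (a * b) = kact a (kd b) + kact b (kd a).
Proof.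
by move=> Oa Ob; rewrite /kd !kactE // -piD; congr (\pi _); apply/funext => d; rewrite derM.
Qed.
Lemma kd_base c : OF c -> kd (j c) = 0.
Proof.
move=> Oc; rewrite -pi0; apply/pi_eq; exists [:: (1, c)].
  by move=> q; rewrite inE => /eqP ->; split => //; apply: vr1.
by move=> d; rewrite big_seq1 mul1r -[LHS]/(der d (j c) - 0) subr0.
Qed.
Lemma kd_zero b : kd b = 0 -> exists2 s : seq (S * F),
  (forall q, q \in s -> OS q.1 /\ OF q.2) & forall d, der d b = \sum_(q <- s) q.1 * der d (j q.2).
Proof.
rewrite -pi0.
move/pi_eq => [s hs e]; exists s => // d; rewrite -e.
by rewrite -[RHS]/(der d b - 0) subr0.
Qed.
End KaehlerTarget.

(** * Vanishing differentials and density *)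

Section OmegaDense.
Variables (F : fieldType) (G : zmodType) (le : G -> G -> Prop) (v : F -> option G).
Variables (S : fieldType) (j : {rmorphism F -> S}).
Variables (H : zmodType) (leH : H -> H -> Prop) (w : S -> option H).
Hypothesis oagH : is_oag leH.
Hypothesis valw : is_valuation leH w.
Hypothesis ext : extends_val j le v leH w.
Hypothesis sepS : is_sepclosure j.
Hypothesis om : Omega_zero j le v leH w.
Variable p : nat.
Hypothesis chS : p \in [pchar S].
Local Notation OS := (in_vring leH w).
Local Notation OF := (in_vring le v).
Let vO : vring OS := vring_val oagH valw.
Let pr := pcharf_prime chS.
Let p1 := prime_gt0 pr.

(** The list does not depend on [D], so a derivation may be constructed after the list is known. *)
Lemma Omega_finite b : OS b -> exists2 s : seq (S * F),
  (forall q, q \in s -> OS q.1 /\ OF q.2) &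
  forall D, pder (fun=> True) D -> D b = \sum_(q <- s) q.1 * D (j q.2).
Proof.
move=> Ob; pose T := {D : S -> S | pder (fun=> True) D}.
pose der (d : T) := sval d.
have derD (d : T) x y : der d (x + y) = der d x + der d y by apply: (pdD (svalP d)).
have derM (d : T) x y : der d (x * y) = x * der d y + y * der d x by apply: (pdM (svalP d)).
have [|s hs e] := @kd_zero F S j OF OS vO T der b.
  apply: (@om (kmodule j OF vO der) (@kact F S j OF OS vO T der)) => //.
    by move=> a c Oa Oc m n; apply: kact_module.
  split=> [a c _ _|a c Oa Oc|c Oc]; [exact: kd_add|exact: kd_mul|exact: kd_base].
by exists s => // D dD; have := e (exist _ D dD).
Qed.

Let K0 (x : S) := exists e : F, x = j e ^+ p.
Let sK0 : subfd K0.
Proof.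
split; first by exists 1; rewrite rmorph1 expr1n.
  by move=> _ _ [x ->] [y ->]; exists (x - y); rewrite rmorphB (frobB chS).
by move=> _ _ [x ->] [y ->]; exists (x / y); rewrite fmorph_div expr_div_n.
Qed.

Lemma sepclosure_sep (s : S) : exists f : {poly S},
  [/\ polyin (fun x => exists c, x = j c) f, f.[s] = 0 & f^`().[s] != 0].
Proof.
have [q [sq qs]] := sepS.1 s; exists (map_poly j q); split; last 1 first.
- move: sq; rewrite unlock -(coprimep_map j) => /coprimep_root /(_ qs).
  by rewrite deriv_map.
- by move=> k; rewrite coef_map; exists q`_k.
- exact/eqP.
Qed.

(* The Artin-Schreier-like equation [b^p - t b = a] gives [t db = - da] for [t] a p-th power. *)
Lemma Omega_dense_int (a s : F) : OF a -> OF s -> s != 0 ->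
  exists e : F, dv OS (j s ^+ p) (j a - j e ^+ p).
Proof.
move=> /ext Oa /ext Os s0; have js0 : j s != 0 by rewrite fmorph_eq0.
set t := j s ^+ p; have t0 : t != 0 by rewrite expf_neq0.
have Ot : OS t by apply: vrX.
pose q : {poly S} := 'X^p - (t *: 'X + (j a)%:P).
have p2 := prime_gt1 pr.
have sz : size q = p.+1.
  rewrite size_polyDl ?size_polyXn // size_polyN.
  apply: leq_ltn_trans (size_polyD _ _) _; rewrite size_scale // size_polyX size_polyC.
  by case: (_ == _) => /=; lia.
have dq : q^`() = (- t)%:P.
  rewrite derivB derivXn derivD derivZ derivX derivC addr0 -mulr_natr -polyC_natr.
  by rewrite (pcharf0 chS) polyC0 mulr0 add0r -mul_polyC mulr1 polyCN.
have [||b qb] := sepS.2 q; last 2 first.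
- by rewrite sz ltnS.
- move: qb; rewrite /root !hornerE => /eqP /subr0_eq eb.
  have Ob : OS b.
    apply: contrapT => nO; apply: nO.
    have [//|Ob] := vrV vO b; have [->|b0] := eqVneq b 0; first exact: vr0.
    apply: (@vr_root _ _ vO p.-1); first by lia.
    have -> : b ^+ p.-1 = t + j a * b^-1.
      by apply: (mulIf b0); rewrite -exprSr prednK // eb; field.
    by apply: vrD => //; apply: (vrM vO).
  have [l hl el] := Omega_finite Ob.
  apply: contrapT => no.
  (* [K0] is the image of the [p]-th powers of [F], so [no] is the hypothesis of [good_tower] for
     [a]. Each listed element divides its derivative, so these derivatives and with them [D' b] are
     integral; then [t] divides [D' a], a contradiction. *)
  pose Y := [seq j q.2 | q <- l]; pose bs := j a :: Y.
  have hbs x : x \in bs -> K0 (x ^+ p).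
    by rewrite inE => /predU1P [->|/mapP [q' _ ->]]; [exists a|exists q'.2].
  have [|||||D [dD D0 gD nD]] := @good_tower S OS vO p chS K0 sK0 bs hbs Y (j a) t.
  + by move=> y yY; apply: (tower_gen chS sK0) => //; rewrite inE yY orbT.
  + by apply: (tower_gen chS sK0) => //; rewrite mem_head.
  + by [].
  + by exists s.
  + by move=> c [e ->] h; apply: no; exists e.
  have [sT K0T] := tower_subfd chS sK0 hbs.
  have F1p x : (exists c, x = j c) -> K0 (x ^+ p) by move=> [c ->]; exists c.
  have [D' [dD' eD']] := der_total chS F1p sepclosure_sep sT K0T dD D0.
  have sT' : subfd (fun _ : S => True) by [].
  have : D' (b ^+ p) = 0 by apply: (pdXp sT' dD' chS).
  rewrite eb (pdD dD') // (pdM dD') // (_ : D' t = 0); last by apply: (pdXp sT' dD' chS).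
  rewrite mulr0 addr0 (el D' dD') => /eqP; rewrite addrC addr_eq0 => /eqP eDa.
  apply: nD; rewrite -eD'; last by apply: (tower_gen chS sK0) => //; rewrite mem_head.
  rewrite eDa; apply: dvN => //; rewrite mulrC; apply: dv_Omul.
  rewrite big_seq; apply: vr_sum => // q' ql; have [O1 O2] := hl q' ql.
  have yY : j q'.2 \in Y by apply: map_f.
  apply: (vrM vO) => //; rewrite eD'; last by apply: (tower_gen chS sK0) => //; rewrite inE yY orbT.
  by have [r Or ->] := gD _ yY; apply: (vrM vO) => //; apply/ext.
by rewrite unlock dq -[(- t)%:P]mulr1 mul_polyC coprimepZr ?oppr_eq0 // coprimep1.
Qed.

Lemma Omega_dense (a t : F) : t != 0 -> exists e : F, dv OS (j t) (j a - j e ^+ p).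
Proof.
move=> t0; have jt0 : j t != 0 by rewrite fmorph_eq0.
have [s [s0 Os ts]] : exists s : F, [/\ s != 0, OF s & dv OS (j t) (j s ^+ p)].
  have [Ot|nO] := pselect (OS (j t)).
    exists t; split => //; first exact/ext.
    by rewrite -(prednK p1) exprSr; apply: dv_Omul; apply: vrX.
  exists 1; rewrite oner_eq0 rmorph1 expr1n; split => //; first by apply/ext; rewrite rmorph1; apply: vr1.
  by apply/vunitE; split => //; case: (vrV vO (j t)).
have [r [r0 Or Ora]] : exists r : F, [/\ r != 0, OF r & OF (r ^+ p * a)].
  have [Oa|nO] := pselect (OS (j a)).
    exists 1; rewrite oner_eq0 expr1n mul1r; split => //; last exact/ext.
    by apply/ext; rewrite rmorph1; apply: vr1.
  have a0 : a != 0 by apply: contra_notN nO => /eqP ->; rewrite rmorph0; apply: vr0.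
  have OV : OS (j a^-1) by rewrite fmorphV; case: (vrV vO (j a)).
  exists a^-1; rewrite invr_eq0; split => //; first exact/ext.
  by rewrite -(prednK p1) exprSr -mulrA mulVf // mulr1; apply/ext; rewrite rmorphXn; apply: vrX.
have Ors : OF (r * s) by apply/ext; rewrite rmorphM; apply: (vrM vO); apply/ext.
have [|e he] := Omega_dense_int Ora Ors; first by rewrite mulf_neq0.
exists (e / r); apply: (dv_trans vO ts).
have jr0 : j r ^+ p != 0 by rewrite expf_neq0 // fmorph_eq0.
apply: (dv_mul2r jr0).
have -> : (j a - j (e / r) ^+ p) * j r ^+ p = j (r ^+ p * a) - j e ^+ p.
  by rewrite fmorph_div expr_div_n mulrBl divfK // [j (r ^+ p * a)]rmorphM rmorphXn mulrC.
by rewrite -exprMn mulrC -rmorphM.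
Qed.
End OmegaDense.

(** * Separable elements *)

Section SeparableElements.
Variables (F K : fieldType) (j : {rmorphism F -> K}).
Hypothesis algK : algebraic_ext j.

(* [x] is killed by every [F]-derivation defined on a subfield containing [x];
   for algebraic [x] this is separability over [F]. *)
Definition sepel (x : K) := forall P D, subfd P -> pder P D ->
  (forall c, P (j c)) -> (forall c, D (j c) = 0) -> P x -> D x = 0.

(** Otherwise the zero derivation of [P] would extend to [P[x]] with value 1 at [x]. *)
Lemma sepel_deriv P x m : subfd P -> (forall c, P (j c)) -> sepel x ->
  minimal_for P x m -> subfd (adjoin P x) -> m^`().[x] != 0.
Proof.
move=> sP jP sx mm sA; apply/eqP => m'0.
have [|D [dD eD Dx]] := der_extend (y := 1) sP (pder0 P) mm.
  rewrite m'0 mul0r addr0 (_ : coefder _ _ = 0) ?horner0 //.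
  by apply/polyP => k; rewrite coef_poly coef0; case: ifP.
have := sx (adjoin P x) D sA dD; rewrite Dx => h.
have /eqP := h (fun c => adjoin_sub (subrg_subfd sP) x (jP c)) (fun c => eD _ (jP c))
  (adjoin_gen (subrg_subfd sP) x).
by rewrite oner_eq0.
Qed.

Lemma alg_minimal_base P x : subfd P -> (forall c, P (j c)) ->
  subfd (adjoin P x) /\ exists m, minimal_for P x m.
Proof.
move=> sP jP; have [q [q0 qx]] := algK x.
have Pq : polyin P (map_poly j q) by move=> k; rewrite coef_map; apply: jP.
have q1 : map_poly j q != 0 by rewrite map_poly_eq0.
exact: alg_minimal sP Pq q1 (eqP qx).
Qed.

Lemma sepel_extend P D x : subfd P -> pder P D -> (forall c, P (j c)) -> sepel x ->
  subfd (adjoin P x) /\ exists D', pder (adjoin P x) D' /\ forall y, P y -> D' y = D y.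
Proof.
move=> sP dD jP sx; have [sA [m mm]] := alg_minimal_base x sP jP; split => //.
have m'0 := sepel_deriv sP jP sx mm sA.
have [|D' [dD' eD' _]] := der_extend (y := - (coefder D m).[x] / m^`().[x]) sP dD mm.
  by rewrite mulrC divfK // subrr.
by exists D'.
Qed.

Lemma sepel_extend_seq (xs : seq K) P D : (forall x, x \in xs -> sepel x) ->
  subfd P -> pder P D -> (forall c, P (j c)) ->
  exists P' D', [/\ subfd P', pder P' D', forall y, P y -> P' y,
    forall y, P y -> D' y = D y & forall x, x \in xs -> P' x].
Proof.
elim: xs P D => [|x xs IH] P D sx sP dD jP; first by exists P, D.
have [sA [D1 [dD1 eD1]]] := sepel_extend sP dD jP (sx x (mem_head _ _)).
have PA y : P y -> adjoin P x y := adjoin_sub (subrg_subfd sP) x (y := y).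
have [|P' [D' [sP' dD' AP' eD' hxs]]] := IH _ D1 _ sA dD1 (fun c => PA _ (jP c)).
  by move=> y ys; apply: sx; rewrite inE ys orbT.
exists P', D'; split => //.
- by move=> y /PA /AP'.
- by move=> y Py; rewrite eD' ?eD1 //; apply: PA.
- move=> y; rewrite inE => /predU1P [->|/hxs //]; apply: AP'.
  exact: adjoin_gen (subrg_subfd sP) _.
Qed.

(** A derivation defined at [x - y] or [x / y] need not be defined at [x] and [y]; it is first
    extended there, which is possible for separable elements. *)
Lemma subfd_sepel : subfd sepel.
Proof.
split.
- by move=> P D sP dD _ _ _; apply: (pd1 sP dD).
- move=> x y sx sy P D sP dD jP jD Pxy.
  have [|P' [D' [sP' dD' PP' eD' hxs]]] := @sepel_extend_seq [:: x; y] P D _ sP dD jP.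
    by move=> z; rewrite !inE => /orP [] /eqP ->.
  have P'x : P' x by apply: hxs; rewrite !inE eqxx.
  have P'y : P' y by apply: hxs; rewrite !inE eqxx orbT.
  have jP' c : P' (j c) by apply: PP'.
  have jD' c : D' (j c) = 0 by rewrite eD'.
  by rewrite -eD' // (pdB sP' dD') // (sx P' D') // (sy P' D') // subrr.
- move=> x y sx sy P D sP dD jP jD Pxy.
  have [y0|y0] := eqVneq y 0; first by rewrite y0 invr0 mulr0 (pd0 sP dD).
  have [|P' [D' [sP' dD' PP' eD' hxs]]] := @sepel_extend_seq [:: x; y] P D _ sP dD jP.
    by move=> z; rewrite !inE => /orP [] /eqP ->.
  have P'x : P' x by apply: hxs; rewrite !inE eqxx.
  have P'y : P' y by apply: hxs; rewrite !inE eqxx orbT.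
  have jP' c : P' (j c) by apply: PP'.
  have jD' c : D' (j c) = 0 by rewrite eD'.
  have P'xy : P' (x / y) by apply: (sfdiv sP').
  rewrite -eD' //; apply: (mulfI y0); rewrite mulr0.
  have := pdM dD' P'xy P'y; rewrite divfK // (sx P' D') // (sy P' D') //.
  by rewrite mulr0 add0r => <-.
Qed.

Lemma sepel_base c : sepel (j c).
Proof. by move=> P D _ _ _ jD _; apply: jD. Qed.

Lemma sepel_horner (g : {poly F}) x : sepel x -> sepel (map_poly j g).[x].
Proof.
move=> sx; apply: (polyin_horner (subrg_subfd subfd_sepel)) => // k.
by rewrite coef_map; apply: sepel_base.
Qed.

(** A derivation over [F] kills both [x ^+ p] and the coefficients of [q]. *)
Lemma sepel_stable p x (q : {poly F}) : p \in [pchar K] ->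
  x = (map_poly j q).[x ^+ p] -> sepel x.
Proof.
move=> ch e P D sP dD jP jD Px; rewrite e.
rewrite (pd_horner sP dD); [|by move=> k; rewrite coef_map; apply: jP|exact: sfX].
rewrite (pdXp sP dD ch Px) mulr0 addr0 (_ : coefder _ _ = 0) ?horner0 //.
by apply/polyP => k; rewrite (coefderE sP dD) coef0 coef_map jD.
Qed.

Definition sepclo := sftype subfd_sepel.
Definition sepclo_base : {rmorphism F -> sepclo} := sflift subfd_sepel sepel_base.
Local Notation emb := (sfemb subfd_sepel).

(** For closedness: at a simple root of a polynomial with separable coefficients the product rule
    forces every derivation over [F] to vanish, so the root is separable again. *)
Lemma is_sepclosure_sepclo :
  (forall q : {poly K}, separable_poly q -> (1 < size q)%N -> exists r, root q r) ->
  is_sepclosure sepclo_base.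
Proof.
have mapE (g : {poly F}) : map_poly emb (map_poly sepclo_base g) = map_poly j g.
  by rewrite -map_poly_comp; apply: eq_map_poly.
move=> clo; split.
- move=> s; have [q [q0 qs]] := algK (emb s); have [m [irr ms _]] := minimal_poly q0 qs.
  exists m; split; last by rewrite -(fmorph_root emb) mapE.
  have simF := subfd_image j.
  have jP c : exists c', j c = j c' by exists c.
  have [sA _] := alg_minimal_base (emb s) simF jP.
  have mm : minimal_for (fun x => exists c, x = j c) (emb s) (map_poly j m).
    split; [by move=> k; rewrite coef_map; exists m`_k|exact/eqP|].
    move=> g Pg gs; have [c hc] := choice Pg.
    have eg : g = map_poly j (\poly_(k < size g) c k).
      apply/polyP => k; rewrite coef_map coef_poly; case: ltnP => ge; first exact: hc.
      by rewrite (nth_default _ ge) raddf0.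
    have := irreducible_root (\poly_(k < size g) c k) irr ms.
    rewrite -eg /root gs eqxx => /esym /dvdpP -[h eh].
    exists (map_poly j h); first by move=> k; rewrite coef_map; exists h`_k.
    by rewrite eg eh rmorphM.
  have m' := sepel_deriv simF jP (sfembP s) mm sA.
  rewrite unlock irreducible_poly_coprime //; apply/negP => dvd.
  move: m'; rewrite deriv_map; apply/negP; rewrite negbK.
  by have := irreducible_root m^`() irr ms; rewrite dvd.
- move=> q sq q1; have sq' : separable_poly (map_poly emb q) by rewrite separable_map.
  have [|r qr] := clo _ sq'; first by rewrite size_map_poly.
  have q'r : (map_poly emb q)^`().[r] != 0.
    by move: sq'; rewrite unlock => /coprimep_root /(_ qr).
  have sr : sepel r.
    move=> P D sP dD jP jD Pr.
    have [|P' [D' [sP' dD' PP' eD' hxs]]] := @sepel_extend_seq (map_poly emb q) P D _ sP dD jP.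
      by move=> x /(nthP 0) [k _ <-]; rewrite coef_map; apply: sfembP.
    have jP' c : P' (j c) by apply: PP'.
    have jD' c : D' (j c) = 0 by rewrite eD'.
    have Pq : polyin P' (map_poly emb q).
      move=> k; case: (ltnP k (size (map_poly emb q))) => ge; first by apply: hxs; apply: mem_nth.
      by rewrite nth_default //; apply: sf0.
    have := pd_horner sP' dD' Pq (PP' _ Pr); rewrite (eqP qr) (pd0 sP' dD').
    rewrite (_ : coefder _ _ = 0); last first.
      apply/polyP => k; rewrite (coefderE sP' dD') coef0 coef_map.
      have sk : sepel (emb q`_k) := sfembP q`_k.
      by apply: (sk P' D') => //; rewrite -coef_map; apply: Pq.
    rewrite horner0 add0r => /esym/eqP; rewrite mulf_eq0 (negPf q'r) /=.
    by rewrite eD' // => /eqP.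
  have [r' er] := sfemb_ex subfd_sepel sr; exists r'.
  by rewrite -(fmorph_root emb) er.
Qed.
End SeparableElements.

Section SeparablePowers.
Variables (K : fieldType) (p : nat) (P : K -> Prop).
Hypothesis chK : p \in [pchar K].
Hypothesis sP : subfd P.
Implicit Types (b : K) (f : {poly K}).
Local Notation sep_root f b := [/\ polyin P f, f.[b] = 0 & f^`().[b] != 0].

Lemma sep_root_frob b f : sep_root f b -> exists f', sep_root f' (b ^+ p).
Proof.
case=> Pf fb f'b; exists (map_poly (pFrobenius_aut chK) f); rewrite -(pFrobenius_autE chK b).
split; first by move=> k; rewrite coef_map /= pFrobenius_autE; apply: sfX.
  by rewrite horner_map /= fb rmorph0.
by rewrite deriv_map horner_map /= fmorph_eq0.
Qed.

(** Otherwise ['X^p - (b ^+ p)%:P] would be minimal for [b] over [P[b ^+ p]]; its derivative is 0,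
    so [b] would be a multiple root of [f]. *)
Lemma adjoin_frob b f : sep_root f b -> adjoin P (b ^+ p) b.
Proof.
move=> sf; have sR := subrg_subfd sP; have [f1 [Pf1 f1b f1'b]] := sep_root_frob sf.
have [Pf fb f'b] := sf.
have f10 : f1 != 0 by apply: contraNneq f1'b => ->; rewrite deriv0 horner0.
have [sA _] := alg_minimal sP Pf1 f10 f1b.
apply: contrapT => nb; have [_ _ minb] := insep_minimal sA chK (adjoin_gen sR _) nb.
have [|h _ e] := minb f _ fb; first by move=> k; apply: (adjoin_sub sR).
move/negP: f'b; apply; rewrite e derivM derivB derivXn derivC subr0 -mulr_natr.
by rewrite -polyC_natr (pcharf0 chK) polyC0 mulr0 mulr0 addr0 !hornerE subrr mulr0.
Qed.

Lemma adjoin_frobn n b f : sep_root f b -> adjoin P (b ^+ (p ^ n)) b.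
Proof.
have sR := subrg_subfd sP.
move=> sf; suff: adjoin P (b ^+ (p ^ n)) b /\ exists f', sep_root f' (b ^+ (p ^ n)) by case.
elim: n => [|n [[g Pg eb] [f' sf']]]; first by split; [exact: adjoin_gen|exists f].
rewrite expnSr exprM; split; last exact: sep_root_frob sf'.
have h := adjoin_frob sf'; have sA := subrg_adjoin sR ((b ^+ (p ^ n)) ^+ p).
by rewrite [X in adjoin _ _ X]eb; apply: (polyin_horner sA) => // k; apply: (adjoin_sub sR).
Qed.
End SeparablePowers.

Lemma algebraic_trans (F L S : fieldType) (i : {rmorphism F -> L}) (k : {rmorphism L -> S}) :
  algebraic_ext i -> algebraic_ext k -> algebraic_ext (k \o i : {rmorphism F -> S}).
Proof.
move=> algi algk s; have [q [q0 qs]] := algk s.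
suff /integral_algebraic [f f0 fs] :
  integralOver (k \o i : {rmorphism F -> S}) s by exists f.
have /integral_algebraic [m mm ms] : algebraicOver k s by exists q.
apply: (integral_root_monic (p := map_poly k m)) => //; first exact: monic_map.
move=> x /(nthP 0) [n _ <-]; rewrite coef_map; apply: integral_rmorph.
by apply/integral_algebraic; have [f [f0 fl]] := algi m`_n; exists f.
Qed.

Lemma sepclosure_algebraic (F S : fieldType) (j : {rmorphism F -> S}) :
  is_sepclosure j -> algebraic_ext j.
Proof.
by case=> sep _ s; have [q [/separable_poly_neq0 q0 qs]] := sep s; exists q.
Qed.

Section DerivationKernel.
Variables (S : fieldType) (H : zmodType) (leH : H -> H -> Prop) (w : S -> option H).
Hypothesis oagH : is_oag leH.
Hypothesis valw : is_valuation leH w.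
Variables (F : fieldType) (j : {rmorphism F -> S}).
Variables (G : zmodType) (le : G -> G -> Prop) (v : F -> option G).
Variables (M : zmodType) (act : S -> M -> M) (D : S -> M).
Hypothesis modM : is_Omodule leH w act.
Hypothesis derD : is_derivation j le v leH w act D.
Local Notation OS := (in_vring leH w).
Local Notation ker x := (OS x /\ D x = 0).
Let vO : vring OS := vring_val oagH valw.

Lemma derker0 : ker 0.
Proof.
have O0 := vr0 vO; split => //; have [dD _ _] := derD.
by apply: (addrI (D 0)); rewrite -dD // !addr0.
Qed.
Lemma derkerD x y : ker x -> ker y -> ker (x + y).
Proof.
case=> Ox ex [Oy ey]; split; first exact: (vrD vO).
by have [dD _ _] := derD; rewrite dD // ex ey addr0.
Qed.
Lemma derkerM x y : ker x -> ker y -> ker (x * y).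
Proof.
have act0 a : OS a -> act a 0 = 0.
  move=> Oa; have [e _ _ _] := modM Oa Oa 0 0.
  by apply: (addrI (act a 0)); rewrite -e !addr0.
case=> Ox ex [Oy ey]; split; first exact: (vrM vO).
by have [_ dM _] := derD; rewrite dM // ex ey !act0 // addr0.
Qed.
Lemma derker1 : ker 1.
Proof.
have O1 := vr1 vO; split => //; have [_ dM _] := derD; have := dM 1 1 O1 O1.
have act1 m : act 1 m = m by have [] := modM O1 O1 m m.
by rewrite !act1 mul1r => e; apply: (addrI (D 1)); rewrite -e addr0.
Qed.
Lemma derkerX x n : ker x -> ker (x ^+ n).
Proof.
by move=> kx; elim: n => [|n IH]; rewrite ?expr0 ?exprS; [exact: derker1|exact: derkerM].
Qed.
Lemma derker_sum (I : Type) (r : seq I) (Q : pred I) (f : I -> S) :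
  (forall i, Q i -> ker (f i)) -> ker (\sum_(i <- r | Q i) f i).
Proof.
by move=> h; apply: (big_ind (fun x => ker x)) => //; [exact: derker0|exact: derkerD].
Qed.
End DerivationKernel.

(** * Deep ramification of algebraic extensions *)

Section DeeplyRamified.
Variables (F : fieldType) (G : zmodType) (le : G -> G -> Prop) (v : F -> option G).
Variables (L : fieldType) (i : {rmorphism F -> L}).
Variables (H : zmodType) (leH : H -> H -> Prop) (w : L -> option H).
Hypothesis oagH : is_oag leH.
Hypothesis valw : is_valuation leH w.
Hypothesis algL : algebraic_ext i.
Hypothesis ext : extends_val i le v leH w.
Hypothesis drF : deeply_ramified le v.
Variables (S : fieldType) (k : {rmorphism L -> S}).
Variables (HS : zmodType) (leS : HS -> HS -> Prop) (u : S -> option HS).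
Hypothesis sepS : is_sepclosure k.
Hypothesis oagS : is_oag leS.
Hypothesis valu : is_valuation leS u.
Hypothesis extS : extends_val k leH w leS u.
Let j : {rmorphism F -> S} := k \o i.
Let algS : algebraic_ext j := algebraic_trans algL (sepclosure_algebraic sepS).
Let extj : extends_val j le v leS u.
Proof. by move=> x; rewrite -ext -extS. Qed.
Local Notation OS := (in_vring leS u).
Local Notation OL := (in_vring leH w).
Let vOS : vring OS := vring_val oagS valu.
Let vOL : vring OL := vring_val oagH valw.

Lemma deeply_ramified_pchar0 : (forall n, (0 < n)%N -> n%:R != 0 :> F) -> Omega_zero k leH w leS u.
Proof.
move=> ch0 M act D modM [dD dM D0]; apply: (drF _ oagS valu extj modM).
  split; last by have [] := sepS.
  move=> s; have [q [q0 qs]] := algS s; have [m [irr ms _]] := minimal_poly q0 qs.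
  by exists m; split => //; apply: irreducible_separable.
by split => // c Oc; apply: D0; apply/ext.
Qed.

Section PositiveCharacteristic.
Variable p : nat.
Hypothesis chS : p \in [pchar S].
Let chL : p \in [pchar L]. Proof. by rewrite -(fmorph_pchar k). Qed.
Local Notation emb := (sfemb (subfd_sepel algS)).
(** As [S] may be inseparable over [F], the hypothesis on [F] is applied to the elements of [S]
    separable over [F], with the restricted valuation. *)
Let uS (x : sepclo algS) := u (emb x).

Let val_uS : is_valuation leS uS.
Proof.
have [v0 vM vD] := valu; split => [x|x y|x y].
- by rewrite /uS v0; split=> [/eqP|->]; rewrite ?rmorph0 // fmorph_eq0 => /eqP.
- by rewrite /uS rmorphM.
- by rewrite /uS rmorphD.
Qed.
Let ext_uS : extends_val (sepclo_base algS) le v leS uS.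
Proof. by move=> x; rewrite -extj. Qed.
Let sep_uS : is_sepclosure (sepclo_base algS).
Proof. by apply: is_sepclosure_sepclo; have [] := sepS. Qed.
Let om_uS : Omega_zero (sepclo_base algS) le v leS uS := drF sep_uS oagS val_uS ext_uS.

Lemma deeply_ramified_dense (a t : F) : t != 0 -> exists e, near OL true (i t) (i a - i e ^+ p).
Proof.
have ch : p \in [pchar sepclo algS] by rewrite -(fmorph_pchar emb).
move=> t0; have [e he] := Omega_dense oagS val_uS ext_uS sep_uS om_uS ch a t0.
exists e; rewrite /= -rmorphXn -rmorphB; apply/(ext_dv oagH valw ext).
by apply/(ext_dv oagS val_uS ext_uS); rewrite rmorphB rmorphXn.
Qed.

(** Some [s = l ^+ (p ^ n)] is a polynomial over [F] in its own [p]-th power, hence separable, and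
    [l] is approximated by elements of [F[s]]; precision 1 is enough. *)
Lemma sepel_dense (l : L) : exists f : L, OL (l - f) /\ sepel j (k f).
Proof.
have [n [q sq]] := insep_stable p l algL.
have [g hg] := stable_approx vOL algL chL deeply_ramified_dense sq erefl (oner_neq0 L).
exists (map_poly i g).[l ^+ (p ^ n)]; split; first exact/dv1.
have mapE (h : {poly F}) : map_poly k (map_poly i h) = map_poly j h.
  by rewrite -map_poly_comp.
rewrite -horner_map /= mapE; apply: sepel_horner => //.
apply: (sepel_stable (p := p) (q := q)) => //.
by rewrite -rmorphXn -mapE horner_map /= -sq.
Qed.

Lemma deeply_ramified_pchar : Omega_zero k leH w leS u.
Proof.
move=> M act D modM derD b Ob; have [dD dM D0] := derD.
have ker_sep x : sepel j x -> OS x -> OS x /\ D x = 0.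
  move=> /(sfemb_ex (subfd_sepel algS)) [y <-] Oy; split => //.
  apply: (om_uS (M := M) (act := fun y => act (emb y)) (D := fun y => D (emb y))) => //.
    move=> y1 y2 O1 O2 m1 m2; have [e1 e2 e3 e4] := modM _ _ O1 O2 m1 m2.
    by split => //; rewrite ?rmorphD ?rmorphM ?rmorph1.
  split=> [y1 y2 O1 O2|y1 y2 O1 O2|c Oc].
  - by rewrite rmorphD dD.
  - by rewrite rmorphM dM.
  - by rewrite sfliftE; apply: D0; apply/ext.
have ker_base l : OL l -> OS (k l) /\ D (k l) = 0 by move=> Ol; split; [apply/extS|apply: D0].
have [n [q sq]] := insep_stable p b algS; set s := b ^+ (p ^ n) in sq.
have ss : sepel j s by apply: (sepel_stable chS sq).
have Os : OS s by apply: vrX.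
have [f sf] := sepclosure_sep sepS b.
have [g Pg eb] := adjoin_frobn chS (subfd_image k) n sf.
have [c hc] := choice Pg; have [d hd] := choice (fun m => sepel_dense (c m)).
(* The [d m] need not be integral, so the integrality of [A] is seen only from [A = b - R], where
   [R] is a sum of products of integral elements killed by [D]. *)
pose A := \sum_(m < size g) k (d m) * s ^+ m.
pose R := \sum_(m < size g) k (c m - d m) * s ^+ m.
have ebRA : b = R + A.
  rewrite [LHS]eb horner_coef -big_split /=; apply: eq_bigr => m _.
  by rewrite hc -mulrDl rmorphB subrK.
have kR : OS R /\ D R = 0.
  apply: (derker_sum oagS valu derD) => m _.
  apply: (derkerM oagS valu modM derD); first by apply: ker_base; have [] := hd m.
  by apply: (derkerX oagS valu modM derD); apply: ker_sep.
have sA : sepel j A.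
  have sR := subrg_subfd (subfd_sepel algS).
  apply: (sr_sum sR) => m _; apply: (srM sR); first by have [] := hd m.
  exact: (srX sR).
have OA : OS A by rewrite -[A](addKr R) -ebRA; apply: (vrD vOS) => //; apply: (vrN vOS); case: kR.
by have [_] := derkerD oagS valu derD kR (ker_sep A sA OA); rewrite -ebRA.
Qed.
End PositiveCharacteristic.

Lemma deeply_ramified_Omega : Omega_zero k leH w leS u.
Proof.
have [ch0|] := pselect (forall n, (0 < n)%N -> n%:R != 0 :> F); first exact: deeply_ramified_pchar0.
move=> /existsNP [n /not_implyP [n0 /negP/negPn nn]].
have [p ch] := natf0_pchar n0 nn.
by apply: (@deeply_ramified_pchar p); rewrite (fmorph_pchar j).
Qed.
End DeeplyRamified.

Theorem theorem1p9 (F : fieldType) (G : zmodType) (le : G -> G -> Prop)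
  (v : F -> option G) (L : fieldType) (i : {rmorphism F -> L})
  (H : zmodType) (leH : H -> H -> Prop) (w : L -> option H) :
  is_oag le -> is_valuation le v ->
  is_oag leH -> is_valuation leH w ->
  algebraic_ext i -> extends_val i le v leH w ->
  [/\ (deeply_ramified le v -> deeply_ramified leH w),
      (semitame le v -> semitame leH w)
    & (gdr le v -> gdr leH w)].
Proof.
move=> oag val oagH valw alg ext; split.
- move=> dr S k HS leS u sepS oagS valu extS.
  exact: (deeply_ramified_Omega oagH valw alg ext dr sepS oagS valu extS).
- move=> [dr st]; split; last exact: (DRst_ext oag val oagH valw ext alg).
  exact: (DRvr_ext oag val oagH valw alg ext dr (DRst_DRvp oag val st)).
- move=> [dr vp]; split; last exact: (DRvp_ext oag val oagH valw ext).
  exact: (DRvr_ext oag val oagH valw alg ext dr vp).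
Qed.
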